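(* Let $d\ge3$ and let $C,C_1,C_2,\dots\in\mathcal{C}^d_{ar}$ have generators $\psi,\psi_1,\psi_2,\dots$ with pseudo-inverses $\varphi,\varphi_1,\varphi_2,\dots$. The following are equivalent: (1) $(C_n)$ converges uniformly to $C$; (2) for all $i\ne j$ in $\{1,\dots,d\}$, the bivariate marginals $(C_n^{ij})$ converge uniformly to $C^{ij}$; (3) $(\varphi_n)$ converges pointwise to $\varphi$ on $(0,1]$; (4) $(\psi_n)$ converges uniformly to $\psi$ on $[0,\infty)$; (5) $(\psi_n^{(m)})$ converges pointwise to $\psi^{(m)}$ on $(0,\infty)$ for every $m\in\{1,\dots,d-2\}$, and $(D^-\psi_n^{(d-2)})$ converges pointwise to $D^-\psi^{(d-2)}$ on $\mathrm{Cont}(D^-\psi^{(d-2)})$; (6) for every $m\in\{2,\dots,d-1\}$, $(c_n^{1:m})$ converges to $c^{1:m}$ $\lambda_m$-almost everywhere on $\mathbb{I}^m$. Moreover, any of these assertions implies that $(C_n)$ converges weakly conditional to $C$.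
   Context: $\mathbb{I}=[0,1]$. An Archimedean generator is a continuous non-increasing $\psi:[0,\infty)\to\mathbb{I}$ with $\psi(0)=1$, $\lim_{z\to\infty}\psi(z)=0$, strictly decreasing on $[0,\inf\{z:\psi(z)=0\}]$; pseudo-inverse $\varphi(y)=\inf\{z\in[0,\infty]:\psi(z)=y\}$. $\psi$ is $d$-monotone if $(-1)^{d-2}\psi^{(d-2)}$ exists on $(0,\infty)$ and is non-negative, non-increasing and convex. $\mathcal{C}^d_{ar}$: copulas $C(\mathbf{u})=\psi(\sum_i\varphi(u_i))$ with $d$-monotone generator normalized by $\psi(1)=1/2$. $D^-$ is the left-hand derivative, $\mathrm{Cont}(g)$ the set of continuity points of $g$. $C^{ij}$ is the bivariate marginal of coordinates $i,j$; $C^{1:m}(x_1,\dots,x_m)=C(x_1,\dots,x_m,1,\dots,1)$, which for $m<d$ is absolutely continuous with density $c^{1:m}$. For $C\in\mathcal{C}^d_{ar}$ let $K_C$ denote its $(d-1)$-Markov kernel (regular conditional distribution of the last coordinate given the first $d-1$ coordinates), in the version $K_C(\mathbf{x},[0,y])=1$ if $\min_i x_i=1$ or $\sum_{i\le d-1}\varphi(x_i)\ge\varphi(0)$; $=0$ if otherwise and $y<\psi(\varphi(0)-\sum_{i\le d-1}\varphi(x_i))$; and $=D^-\psi^{(d-2)}(\sum_{i\le d-1}\varphi(x_i)+\varphi(y))/D^-\psi^{(d-2)}(\sum_{i\le d-1}\varphi(x_i))$ otherwise (conventions $\psi(\infty)=0$, $\psi(u)=1$ for $u<0$, $D^-\psi^{(d-2)}(\infty)=0$).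 $(C_n)$ converges weakly conditional to $C$ if there is a Borel $\Lambda\subseteq\mathbb{I}^{d-1}$ with $\mu_{C^{1:d-1}}(\Lambda)=1$ such that $K_{C_n}(\mathbf{x},\cdot)\to K_C(\mathbf{x},\cdot)$ weakly for every $\mathbf{x}\in\Lambda$. *)

(* Defs.v *)
From HB Require Import structures.
From mathcomp Require Import all_boot all_order all_algebra.
From mathcomp Require Import all_classical all_reals all_analysis.
Set Implicit Arguments. Unset Strict Implicit. Unset Printing Implicit Defensive.
Import Order.TTheory GRing.Theory Num.Theory.
Import numFieldNormedType.Exports.
Local Open Scope classical_set_scope.
Local Open Scope ring_scope.

Section ArchDefs.
Variable R : realType.

(* psi : [0,oo) -> [0,1] continuous, non-increasing, psi 0 = 1, psi -> 0 at oo,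
   strictly decreasing on [0, inf {z | psi z = 0}]  (the inf may be +oo).
   Values of psi on negative reals are irrelevant junk. *)
Definition is_arch_generator (psi : R -> R) : Prop :=
  {within `[0, +oo[, continuous psi} /\
  psi 0 = 1 /\
  (forall x, 0 <= x -> 0 <= psi x <= 1) /\
  (forall x y, 0 <= x -> x <= y -> psi y <= psi x) /\
  (psi x @[x --> +oo] --> 0) /\
  (forall x y, 0 <= x -> x < y ->
     (forall z, 0 <= z -> psi z = 0 -> y <= z) -> psi y < psi x).

(* pseudo-inverse phi(y) = inf {z in [0,oo] | psi z = y}, with psi(oo) = 0;
   the value +oo is automatic (inf of the empty set, or +oo adjoined for y = 0
   does not change the infimum). *)
Definition phi (psi : R -> R) (y : R) : \bar R :=
  ereal_inf [set z%:E | z in [set z : R | 0 <= z /\ psi z = y]].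

Definition d_monotone (d : nat) (psi : R -> R) : Prop :=
  let g := fun x => (-1) ^+ (d - 2) * derive1n (d - 2) psi x in
  [/\ (forall k x, (k < d - 2)%N -> 0 < x -> derivable (derive1n k psi) x 1),
      (forall x, 0 < x -> 0 <= g x),
      (forall x y, 0 < x -> x <= y -> g y <= g x)
    & (forall x y t, 0 < x -> 0 < y -> 0 <= t <= 1 ->
         g (t * x + (1 - t) * y) <= t * g x + (1 - t) * g y)].

Definition Car_generator (d : nat) (psi : R -> R) : Prop :=
  [/\ is_arch_generator psi, d_monotone d psi & psi 1 = 2^-1].

Definition psiE (psi : R -> R) (z : \bar R) : R :=
  match z with
  | EFin r => if r < 0 then 1 else psi r
  | EPInf => 0
  | ENInf => 1
  end.

Definition cube (m : nat) : set ('I_m -> R) :=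
  [set u | forall i, 0 <= u i <= 1].

Definition archC (d : nat) (psi : R -> R) (u : 'I_d -> R) : R :=
  psiE psi (\sum_(i < d) phi psi (u i))%E.

Definition bivC (d : nat) (psi : R -> R) (i j : 'I_d) (p : R * R) : R :=
  archC psi (fun k : 'I_d => if k == i then p.1 else if k == j then p.2 else 1).

Definition margC (d m : nat) (psi : R -> R) (x : 'I_m -> R) : R :=
  archC psi (fun k : 'I_d =>
    match (insub (nat_of_ord k) : option 'I_m) with Some k' => x k' | None => 1 end).

Definition leftder (g : R -> R) (x : R) : R :=
  lim ((fun h : R => (g (x + h) - g x) / h) @ 0^'-).

Definition DE (psi : R -> R) (k : nat) (z : \bar R) : R :=
  match z with
  | EFin r => leftder (derive1n k psi) r
  | _ => 0
  end.

Definition kernel_cdf (d : nat) (psi : R -> R) (x : 'I_d.-1 -> R) (y : R) : R :=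
  let s := (\sum_(i < d.-1) phi psi (x i))%E in
  if (\big[Order.min/1]_(i < d.-1) x i == 1) || (phi psi 0 <= s)%E then 1
  else if y < psiE psi (phi psi 0 - s)%E then 0
  else DE psi (d - 2) (s + phi psi y)%E / DE psi (d - 2) s.

Definition kernel_cdfR (d : nat) (psi : R -> R) (x : 'I_d.-1 -> R) (y : R) : R :=
  if y < 0 then 0 else if 1 < y then 1 else kernel_cdf psi x y.

(* weak convergence of K_{C_n}(x,.) to K_C(x,.): the (unique) probability
   measures on R with these distribution functions converge weakly, i.e.
   integrals of bounded continuous functions converge. *)
Definition kernel_weak_conv (d : nat) (psis : nat -> R -> R) (psi : R -> R)
    (x : 'I_d.-1 -> R) : Prop :=
  forall (Pn : nat -> probability (measurableTypeR R) R)
         (P : probability (measurableTypeR R) R),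
    (forall n y, Pn n `]-oo, y]%classic = (kernel_cdfR (psis n) x y)%:E) ->
    (forall y, P `]-oo, y]%classic = (kernel_cdfR psi x y)%:E) ->
    forall g : R -> R, continuous g -> (exists M, forall t, `|g t| <= M) ->
      (\int[Pn n]_t (g t)%:E)%E @[n --> \oo] --> (\int[P]_t (g t)%:E)%E.

Definition ocbox (m : nat) (a b : 'I_m -> R) : set ('I_m -> R) :=
  [set t | forall i, a i < t i <= b i].

Definition ccbox (m : nat) (a b : 'I_m -> R) : set ('I_m -> R) :=
  [set t | forall i, a i <= t i <= b i].

Definition borel (m : nat) : set (set ('I_m -> R)) :=
  <<s [set B | exists a b, B = ocbox a b] >>.

Definition borel_fun (m : nat) (f : ('I_m -> R) -> R) : Prop :=
  forall a : R, borel (f @^-1` `]a, +oo[%classic).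

Definition lebesgue_null (m : nat) (N : set ('I_m -> R)) : Prop :=
  forall eps : R, 0 < eps -> exists a b : nat -> 'I_m -> R,
    [/\ (forall k i, a k i <= b k i),
        N `<=` \bigcup_k ccbox (a k) (b k)
      & (\sum_(0 <= k <oo) (\prod_(i < m) (b k i - a k i))%:E < eps%:E)%E].

Definition upd (m : nat) (t : 'I_m -> R) (i : 'I_m) (u : R) : 'I_m -> R :=
  fun j => if j == i then u else t j.

Fixpoint iint (m : nat) (s : seq 'I_m) (x : 'I_m -> R)
    (f : ('I_m -> R) -> \bar R) (t : 'I_m -> R) : \bar R :=
  match s with
  | [::] => f t
  | i :: s' => (\int[lebesgue_measure]_(u in `[0%R, x i]%classic) iint s' x f (upd t i u))%E
  end.

(* integral of f over the box [0,x] of R^m (by Tonelli, for Borel f >= 0,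
   this is the lambda_m-integral) *)
Definition boxint (m : nat) (x : 'I_m -> R) (f : ('I_m -> R) -> \bar R) : \bar R :=
  iint (enum 'I_m) x f x.

Definition is_density (m : nat) (F : ('I_m -> R) -> R) (c : ('I_m -> R) -> R) : Prop :=
  [/\ borel_fun c, (forall t, 0 <= c t)
    & forall x, cube x -> (F x)%:E = boxint x (fun t => (c t)%:E)].

Definition weak_cond_conv (d : nat) (psis : nat -> R -> R) (psi : R -> R) : Prop :=
  exists Lam : set ('I_d.-1 -> R),
    [/\ borel Lam, Lam `<=` @cube d.-1,
        (* mu_{C^{1:d-1}}(Lam) = 1, mu given by the density of C^{1:d-1} *)
        (exists c, is_density (margC d psi) c /\
           boxint (fun _ => 1) (fun t => (\1_Lam t * c t)%:E) = 1%E)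
      & forall x, Lam x -> kernel_weak_conv psis psi x].

Definition unif_conv_on (T : Type) (A : set T) (fn : nat -> T -> R) (f : T -> R) : Prop :=
  forall eps : R, 0 < eps -> exists N, forall n, (N <= n)%N ->
    forall t, A t -> `|fn n t - f t| < eps.

End ArchDefs.

(* Main.v *)
(** All assertions are equivalent to pointwise convergence of the generators.

    Convexity enters only through the slope inequality
    [p y * (y - x) <= g x - g y <= p x * (y - x)] for consecutive signed
    derivatives [g = (-1)^k psi^(k)] and [p = (-1)^(k+1) D^- psi^(k)]; it makes
    pointwise convergence of [g] pass to [p] at continuity points of [p], and,
    summed over fine partitions starting at [psi 1 = 1/2], it recovers [psi]
    from its first derivative.  A bivariate margin determines [psi] on the
    dyadic numbers through [C (psi a) (psi b) = psi (a + b)] and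
    [psi 1 = 1/2].

    The margin [C^{1:m}] has the explicit density
    [p_(m-1)(sum_i phi (t i)) * prod_i phi'(t i)], and any other density agrees
    with it almost everywhere; it converges off the countably many level sets
    of [sum_i phi (t i)] at discontinuities of [p_(m-1)].  Conversely, almost
    everywhere convergence of the densities gives, by Fatou's lemma on a box
    and on its complement in the cube, convergence of the margins.  Finally,
    the conditional distribution functions are quotients of values of
    [D^- psi^(d-2)], and they converge off a countable set of [y]. *)

Require Import Defs.
From HB Require Import structures.
From mathcomp Require Import all_boot all_order all_algebra.
From mathcomp Require Import all_classical all_reals all_analysis.
From mathcomp Require Import lra ring zify measurable_realfun.
Import Order.TTheory GRing.Theory Num.Theory.
Import numFieldNormedType.Exports.
Set Implicit Arguments. Unset Strict Implicit. Unset Printing Implicit Defensive.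
Local Open Scope classical_set_scope.
Local Open Scope ring_scope.

(** * Slope inequalities *)

Section Slopes.
Variable R : realType.
Implicit Types (g p : R -> R) (x y z w : R).

(** The obstacle is the top order [k = d - 2]: the derivative of order [d - 2] need not be
    differentiable, and its left derivative may jump at countably many points. The slope inequality
    holds there in the same form as at lower orders, so one argument serves all orders, and
    integrals of a possibly discontinuous derivative are evaluated by monotone partitions instead of
    the fundamental theorem of calculus.

    The normalization is what makes the generator recoverable at all: [psi] and its rescalings of
    the argument generate the same copula.

    Densities are stated through iterated one-dimensional integrals, and null sets through coverings
    by boxes. The iterated integral is therefore turned into measures on the cube, compared on lower
    orthants. A set with vanishing integral gets small coverings through Caratheodory's criterion,
    which makes Borel sets measurable for the outer measure of coverings. *)

Definition slopes g p := forall x y, 0 < x -> x < y ->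
  p y * (y - x) <= g x - g y <= p x * (y - x).

Lemma slopes_noninc g p : slopes g p ->
  forall x y, 0 < x -> x <= y -> p y <= p x.
Proof.
move=> s x y x0; rewrite le_eqVlt => /predU1P[->//|xy].
have /andP[h1 h2] := s _ _ x0 xy.
by rewrite -(ler_pM2r (_ : 0 < y - x)) ?subr_gt0// (le_trans h1).
Qed.

Lemma leftder_derive1 g x : derivable g x 1 -> leftder g x = derive1 g x.
Proof.
move=> dg; rewrite derive1E; apply/cvg_lim => //=.
apply: cvg_dnbhs_at_left.
have h : (fun h : R => h^-1 *: (g (h *: 1 + x) - g x)) @ 0^' --> 'D_1 g x by exact: dg.
apply: cvg_trans h; apply: near_eq_cvg; near=> h.
by rewrite mulrC /GRing.scale/= mulr1 (addrC x).
Unshelve. all: by end_near. Qed.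

Definition convex_pos g := forall x y t, 0 < x -> 0 < y -> 0 <= t <= 1 ->
  g (t * x + (1 - t) * y) <= t * g x + (1 - t) * g y.

(** The three-chord inequality with its denominators cleared; [t] is the weight that writes [y] as a
    combination of [x] and [z]. *)
Lemma convex_pos3 g x y z : convex_pos g -> 0 < x -> x < y -> y < z ->
  (g y - g x) * (z - y) <= (g z - g y) * (y - x).
Proof.
move=> cg x0 xy yz.
have xz : 0 < z - x by lra.
pose t := (z - y) / (z - x).
have t01 : 0 <= t <= 1.
  by rewrite /t divr_ge0 ?ler_pdivrMr//=; lra.
have := cg x z t x0 (lt_trans x0 (lt_trans xy yz)) t01.
have tz : t * (z - x) = z - y by rewrite /t mulfVK// gt_eqF.
have -> : t * x + (1 - t) * z = y by lra.
rewrite -(ler_pM2r xz).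
have -> : (t * g x + (1 - t) * g z) * (z - x) =
  (t * (z - x)) * g x + ((z - x) - t * (z - x)) * g z by ring.
by rewrite tz; lra.
Qed.

(** Chord slopes into [x] from the left increase with the base point and are bounded by every chord
    slope to the right of [x]. Hence the left limit exists, [leftder] is a genuine limit, and it
    separates the two families of slopes. *)
Lemma convex_leftder g x : convex_pos g -> 0 < x ->
  [/\ cvg ((fun h : R => (g (x + h) - g x) / h) @ 0^'-),
  (forall w, 0 < w -> w < x -> g x - g w <= leftder g x * (x - w)) &
  (forall y, x < y -> leftder g x * (y - x) <= g y - g x)].
Proof.
move=> cg x0.
pose f (h : R) := (g (x + h) - g x) / h.
have slope_le h y : - x < h -> h < 0 -> x < y -> f h <= (g y - g x) / (y - x).
  move=> xh h0 xy; have := @convex_pos3 g (x + h) x y cg _ _ xy.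
  have -> : x - (x + h) = - h by lra.
  move=> H; rewrite /f ler_ndivrMr// mulrAC ler_pdivrMr ?subr_gt0//.
  suff : (g x - g (x + h)) * (y - x) <= (g y - g x) * - h by lra.
  by apply: H; lra.
have ndf h k : - x < h -> h <= k -> k < 0 -> f h <= f k.
  move=> xh; rewrite le_eqVlt => /predU1P[->//|hk k0].
  have := @convex_pos3 g (x + h) (x + k) x cg _ _ _.
  have -> : x - (x + k) = - k by lra.
  have -> : x + k - (x + h) = k - h by lra.
  move=> H; rewrite /f ler_ndivrMr; last lra.
  rewrite mulrAC ler_ndivrMr//.
  suff : (g (x + k) - g (x + h)) * - k <= (g x - g (x + k)) * (k - h) by nra.
  by apply: H; lra.
have cf : cvg (f @ 0^'-).
  apply: nondecreasing_at_left_is_cvgr.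
    near=> t => h k; rewrite !in_itv/= => /andP[th h0] /andP[tk k0] hk.
    apply: ndf => //; apply: lt_trans th; near: t; apply: nbhs_left_gt; lra.
  near=> t; exists ((g (x + 1) - g x) / (x + 1 - x)).
  move=> _ [h /= + <-]; rewrite in_itv/= => /andP[th h0].
  apply: slope_le => //; last lra.
  apply: lt_trans th; near: t; apply: nbhs_left_gt; lra.
have lfE : leftder g x = lim (f @ 0^'-) by [].
split=> [//|w w0 wx|y xy]; rewrite lfE.
  suff : f (w - x) <= lim (f @ 0^'-).
    rewrite /f addrCA subrr addr0 ler_ndivrMr ?subr_lt0//; lra.
  apply: limr_ge => //; near=> h; apply: ndf; first lra.
    by near: h; apply: nbhs_left_ge; lra.
  by [].
rewrite -ler_pdivlMr ?subr_gt0//; apply: limr_le => //; near=> h.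
by apply: slope_le => //; near: h; apply: nbhs_left_gt; lra.
Unshelve. all: by end_near. Qed.

Lemma convex_slopes g : convex_pos g -> slopes g (fun x => - leftder g x).
Proof.
move=> cg x y x0 xy.
have [_ _ /(_ _ xy)] := convex_leftder cg x0.
have [_ /(_ _ x0 xy) + _] := convex_leftder cg (lt_trans x0 xy).
by rewrite !mulNr => h1 h2; apply/andP; split; lra.
Qed.

Lemma MVT_pos g g' : (forall x : R, 0 < x -> is_derive x 1 g (g' x)) ->
  forall x y, 0 < x -> x < y ->
  exists2 c, x < c < y & g y - g x = g' c * (y - x).
Proof.
move=> dg x y x0 xy; have [||c] := @MVT _ g g' x y xy.
- by move=> z; rewrite in_itv/= => /andP[/(lt_trans x0) z0 _]; exact: dg.
- apply: derivable_within_continuous => z; rewrite in_itv/= => /andP[xz _].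
  by have := dg z (lt_le_trans x0 xz) => -[].
- by rewrite in_itv/= => cxy e; exists c.
Qed.

Lemma slopes_derive g p : (forall x : R, 0 < x -> is_derive x 1 g (- p x)) ->
  (forall x y, 0 < x -> x <= y -> p y <= p x) -> slopes g p.
Proof.
move=> dg np x y x0 xy.
have [c /andP[xc cy] e] := MVT_pos dg x0 xy.
have -> : g x - g y = p c * (y - x) by lra.
by rewrite !ler_wpM2r ?np//; lra.
Qed.

(** Since [p] is monotone, on [[x / 2, x * 2]] it is bounded by its values at the endpoints, so [g]
    is Lipschitz there with constant [M]. *)
Lemma slopes_continuous g p x : slopes g p -> 0 < x -> {for x, continuous g}.
Proof.
move=> s x0; have x2 : 0 < x / 2 by lra.
have sn := slopes_noninc s.
pose M := `|p (x / 2)| + `|p (x * 2)| + 1.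
have M0 : 0 < M by rewrite /M; have := normr_ge0 (p (x / 2)); have := normr_ge0 (p (x * 2)); lra.
have bd y z : x / 2 <= y -> y < z -> z <= x * 2 -> `|g y - g z| <= M * (z - y).
  move=> xy yz zx; have /andP[h1 h2] := s y z (lt_le_trans x2 xy) yz.
  have zy : 0 < z - y by lra.
  have := sn _ _ x2 xy; have := sn z _ (lt_trans (lt_le_trans x2 xy) yz) zx.
  have := ler_norm (p (x / 2)); have := ler_norm (- p (x * 2)).
  have := normr_ge0 (p (x / 2)); have := normr_ge0 (p (x * 2)); rewrite normrN.
  by rewrite ler_norml /M => *; apply/andP; split; nra.
apply/cvgrPdist_lt => e e0.
have eM : 0 < e / M by rewrite divr_gt0.
near=> y.
have yb : x / 2 <= y by near: y; apply: (cvgr_ge x) => //; lra.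
have yb' : y <= x * 2 by near: y; apply: (cvgr_le x) => //; lra.
have d : `|x - y| < e / M.
  by near: y; move: (e / M) eM; apply/cvgrPdist_lt.
rewrite ltr_pdivlMr// in d.
have [xy|yx|->] := ltgtP x y.
- apply: le_lt_trans (bd _ _ _ xy yb') _; first lra.
  by rewrite ltr0_norm in d; lra.
- rewrite distrC; apply: le_lt_trans (bd _ _ yb yx _) _; first lra.
  by rewrite gtr0_norm in d; lra.
- by rewrite subrr normr0.
Unshelve. all: by end_near. Qed.

(** The arithmetic of [slopes_cvg], multiplied through by the step [h]: [Pn], [P], [P0] are slopes
    times [h], while [G1], [G2] are values of [g] and [H1], [H2] values of [gn n]. *)
Let difference_quotient_le (Pn P P0 G1 G2 H1 H2 q : R) :
  Pn <= H1 - H2 -> G1 - G2 <= P -> `|G1 - H1| < q -> `|G2 - H2| < q ->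
  P - P0 < 2 * q -> Pn - P0 < 4 * q.
Proof. by rewrite !ltr_norml => ? ? /andP[? ?] /andP[? ?] ?; lra. Qed.

Let difference_quotient_ge (Pn P P0 G1 G2 H1 H2 q : R) :
  H1 - H2 <= Pn -> P <= G1 - G2 -> `|G1 - H1| < q -> `|G2 - H2| < q ->
  P0 - P < 2 * q -> P0 - Pn < 4 * q.
Proof. by rewrite !ltr_norml => ? ? /andP[? ?] /andP[? ?] ?; lra. Qed.

(* The slope inequality squeezes [pn n (xn n)] between difference quotients of
   [gn n] on either side of [x], which converge to those of [g]. *)
Lemma slopes_cvg (gn pn : nat -> R -> R) g p (xn : nat -> R) x :
  (forall n, slopes (gn n) (pn n)) -> slopes g p ->
  (forall z, 0 < z -> gn n z @[n --> \oo] --> g z) ->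
  0 < x -> xn n @[n --> \oo] --> x -> {for x, continuous p} ->
  pn n (xn n) @[n --> \oo] --> p x.
Proof.
move=> sn s cg x0 cx cp.
apply/cvgrPdist_lt => e e0.
have /nbhs_ballP[r /= r0 rp] : \forall y \near x, `|p x - p y| < e / 2.
  by move/cvgrPdist_lt : cp; apply; lra.
(* Dividing by 3 keeps [x - 2 * h] positive and both [x - 2 * h] and [x + 2 * h] inside the ball of
   radius [r]. *)
pose h := Num.min r x / 3.
have h0 : 0 < h by rewrite divr_gt0// lt_min r0 x0.
have hr : h * 3 <= r by rewrite /h divfK// ge_min lexx.
have hx : h * 3 <= x by rewrite /h divfK// ge_min lexx orbT.
have pr : `|p x - p (x + 2 * h)| < e / 2.
  by apply: rp; rewrite /ball/= opprD addrA subrr add0r normrN gtr0_norm; lra.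
have pl : `|p x - p (x - 2 * h)| < e / 2.
  by apply: rp; rewrite /ball/= opprB addrC subrK gtr0_norm; lra.
have q : 0 < e / 4 * h by rewrite mulr_gt0//; lra.
have G z : 0 < z -> \forall n \near \oo, `|g z - gn n z| < e / 4 * h.
  by move=> z0; move/cvgrPdist_lt : (cg z z0); apply.
have x1 : 0 < x - 2 * h by lra.
have x2 : 0 < x - h by lra.
have x3 : 0 < x + h by lra.
have x4 : 0 < x + 2 * h by lra.
have l12 : x - 2 * h < x - h by lra.
have l34 : x + h < x + 2 * h by lra.
have E1 : x - h - (x - 2 * h) = h by lra.
have E2 : x + 2 * h - (x + h) = h by lra.
have q2 : e / 2 * h = 2 * (e / 4 * h) by field.
have {}pr : p x * h - p (x + 2 * h) * h < 2 * (e / 4 * h).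
  by rewrite -mulrBl -q2 ltr_pM2r// (le_lt_trans (ler_norm _)).
have {}pl : p (x - 2 * h) * h - p x * h < 2 * (e / 4 * h).
  by rewrite -mulrBl -q2 ltr_pM2r// (le_lt_trans (ler_norm _))// distrC.
near=> n.
have G1 : `|g (x - 2 * h) - gn n (x - 2 * h)| < e / 4 * h by near: n; exact: G.
have G2 : `|g (x - h) - gn n (x - h)| < e / 4 * h by near: n; exact: G.
have G3 : `|g (x + h) - gn n (x + h)| < e / 4 * h by near: n; exact: G.
have G4 : `|g (x + 2 * h) - gn n (x + 2 * h)| < e / 4 * h by near: n; exact: G.
have xl : x - h <= xn n by near: n; apply: (cvgr_ge x) => //; lra.
have xr : xn n <= x + h by near: n; apply: (cvgr_le x) => //; lra.
have snn := slopes_noninc (sn n).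
have U1 := snn _ _ x2 xl.
have U2 := snn _ _ (lt_le_trans x2 xl) xr.
have /andP[A2 _] := sn n (x - 2 * h) (x - h) x1 l12.
have /andP[_ A3] := s (x - 2 * h) (x - h) x1 l12.
have /andP[_ B1] := sn n (x + h) (x + 2 * h) x3 l34.
have /andP[B2 _] := s (x + h) (x + 2 * h) x3 l34.
rewrite E1 in A2 A3; rewrite E2 in B1 B2.
rewrite -(ler_pM2r h0) in U1; rewrite -(ler_pM2r h0) in U2.
have q4 : e * h = 4 * (e / 4 * h) by field.
rewrite ltr_norml -(ltr_pM2r h0) -(ltr_pM2r h0 _ e) !mulrBl mulNr q4; apply/andP; split.
- rewrite ltrNl opprB.
  exact: difference_quotient_le (le_trans U1 A2) A3 G1 G2 pl.
- exact: difference_quotient_ge (le_trans B1 U2) B2 G3 G4 pr.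
Unshelve. all: by end_near. Qed.

End Slopes.

(** * Signed derivatives of a d-monotone generator *)

Section Signed_derivatives.
Variables (R : realType) (psi : R -> R).

Implicit Types x y z w e c : R.

(** The signs make both families nonnegative and nonincreasing. [sleft k] has order [k.+1]: below
    the top it equals [sder k.+1], and at [k = d - 2] it stands in for a derivative that may fail to
    exist. *)
Definition sder k x : R := (-1) ^+ k * derive1n k psi x.
Definition sleft k x : R := (-1) ^+ k.+1 * leftder (derive1n k psi) x.

Lemma sder0 x : sder 0 x = psi x.
Proof. by rewrite /sder expr0 mul1r. Qed.

Lemma derive1n_sder k x : derive1n k psi x = (-1) ^+ k * sder k x.
Proof. by rewrite /sder mulrA -expr2 sqrr_sign mul1r. Qed.

Lemma leftder_sleft k x : leftder (derive1n k psi) x = (-1) ^+ k.+1 * sleft k x.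
Proof. by rewrite /sleft mulrA -expr2 sqrr_sign mul1r. Qed.

Lemma leftder_sign (g : R -> R) k x :
  cvg ((fun h : R => ((-1) ^+ k * g (x + h) - (-1) ^+ k * g x) / h) @ 0^'-) ->
  leftder g x = (-1) ^+ k * leftder (fun y => (-1) ^+ k * g y) x.
Proof.
move=> c; apply/cvg_lim => //; rewrite /leftder.
set F := (fun h : R => _) in c; set G := (fun h : R => (g _ - g _) / _).
have -> : G = (fun h : R => (-1) ^+ k * F h).
  apply/funext => h; rewrite /F /G -mulrBr !mulrA -expr2 sqrr_sign mul1r //.
by apply: cvgM; [exact: cvg_cst|exact: c].
Qed.

Lemma sder_is_derive k (x : R) : derivable (derive1n k psi) x 1 ->
  is_derive x 1 (sder k) (- sder k.+1 x).
Proof.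
move=> dk; rewrite /sder exprS mulN1r mulNr opprK derive1nS derive1E.
have := is_deriveZ ((-1) ^+ k) (DeriveDef dk erefl).
by move=> h; apply: h.
Qed.

Variable d : nat.
Hypothesis gen : Car_generator d psi.

Lemma psi_ge0 x : 0 <= x -> 0 <= psi x.
Proof. by case: gen => [[_ [_ [h _]]] _ _] /h /andP[]. Qed.

Lemma psi_le1 x : 0 <= x -> psi x <= 1.
Proof. by case: gen => [[_ [_ [h _]]] _ _] /h /andP[]. Qed.

Lemma psi0 : psi 0 = 1.
Proof. by case: gen => [[_ [h _]] _ _]. Qed.

Lemma psi1 : psi 1 = 2^-1.
Proof. by case: gen. Qed.

Lemma psi_noninc x y : 0 <= x -> x <= y -> psi y <= psi x.
Proof. by case: gen => [[_ [_ [_ [h _]]]] _ _]; exact: h. Qed.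

Lemma psi_cvgy : psi x @[x --> +oo] --> (0 : R).
Proof. by case: gen => [[_ [_ [_ [_ [h _]]]]] _ _]. Qed.

Lemma psi_lt x y : 0 <= x -> x < y -> 0 < psi x -> psi y < psi x.
Proof.
move=> x0 xy px; have y0 : 0 <= y by rewrite (le_trans x0)// ltW.
have := psi_ge0 y0; rewrite le_eqVlt => /predU1P[<-//|py].
case: gen => [[_ [_ [_ [_ [_ h]]]]] _ _]; apply: h => // z z0 pz.
rewrite leNgt; apply/negP => zy.
by have := psi_noninc z0 (ltW zy); rewrite pz leNgt py.
Qed.

Lemma psi_small e : 0 < e -> exists2 M, 0 < M & forall x, M <= x -> psi x < e.
Proof.
move=> e0; have /cvgrPdist_lt/(_ _ e0)[M [Mr hM]] := psi_cvgy.
exists (Num.max M 0 + 1); first by rewrite ltr_wpDl// le_max lexx orbT.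
move=> x Mx; have := hM x; rewrite sub0r normrN => h.
apply: le_lt_trans (ler_norm _) (h _).
by rewrite (lt_le_trans _ Mx)// ltr_pwDr// le_max lexx.
Qed.

Lemma psi_continuous_within : {within `[0, +oo[, continuous psi}.
Proof. by case: gen => [[h _] _ _]. Qed.

Lemma is_derive_sder k (x : R) : (k < d - 2)%N -> 0 < x ->
  is_derive x 1 (sder k) (- sder k.+1 x).
Proof.
by move=> kd x0; apply: sder_is_derive; case: gen => _ [h _ _ _] _; exact: h.
Qed.

(* If a signed derivative stayed away from zero with constant sign, so would
   all lower ones, up to [psi] itself. *)
Let sder_bounded_away k : (k <= d - 2)%N ->
  forall (s : bool) c x0, 0 < c -> 0 < x0 ->
  (forall y, x0 <= y -> c <= (-1) ^+ s * sder k y) -> False.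
Proof.
elim: k => [|k IH] kd s c x0 c0 x00 h.
  have [M M0 hM] := psi_small c0.
  have := h (Num.max M x0); rewrite le_max lexx orbT => /(_ isT).
  have := hM (Num.max M x0); rewrite le_max lexx => /(_ isT).
  have := @psi_ge0 (Num.max M x0); rewrite le_max (ltW M0) => /(_ isT).
  by rewrite sder0; case: s {h} => /=; rewrite ?expr1 ?expr0; lra.
pose D := (`|sder k x0| + 1) / c.
have D0 : 0 < D by rewrite divr_gt0// ltr_pwDr.
apply: (IH (ltnW kd) (~~ s) 1 (x0 + D)) => //; first by rewrite addr_gt0.
move=> y hy; have xy : x0 < y by apply: lt_le_trans hy; lra.
have [z z0|z /andP[xz _] e] := @MVT_pos _ (sder k) (fun x => - sder k.+1 x) _ x0 y x00 xy.
  exact: is_derive_sder.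
have -> : sder k y = sder k x0 - sder k.+1 z * (y - x0) by lra.
have hz := h z (ltW xz).
have : `|sder k x0| + 1 <= c * (y - x0).
  by rewrite -ler_pdivrMl// mulrC -/D; lra.
have : c * (y - x0) <= ((-1) ^+ s * sder k.+1 z) * (y - x0) by rewrite ler_pM2r//; lra.
have := ler_norm (sder k x0); have := ler_norm (- sder k x0); rewrite normrN.
move: (sder k x0) (sder k.+1 z) (y - x0) (`|_|) => a b t n.
by clear; case: s => /=; rewrite ?expr1 ?expr0; lra.
Qed.

Let sder_top : [/\ forall x, 0 < x -> 0 <= sder (d - 2) x,
  forall x y, 0 < x -> x <= y -> sder (d - 2) y <= sder (d - 2) x &
  convex_pos (sder (d - 2))].
Proof. by case: gen => _ [_ h1 h2 h3] _; split. Qed.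

(** Downward induction from order [d - 2]. If [sder i x] were negative, nonnegativity one order
    higher would keep [sder i] below that value on all of [[x, +oo)], which [sder_bounded_away]
    forbids. *)
Lemma sder_ge0 k x : (k <= d - 2)%N -> 0 < x -> 0 <= sder k x.
Proof.
move=> kd; rewrite -(subKn kd); move: (_ - k)%N (leq_subr k (d - 2)) => {kd}.
move=> j; elim: j x => [|j IH] x jd x0.
  by rewrite subn0; case: sder_top => /(_ _ x0).
have jd' := ltnW jd.
set i := (_ - j.+1)%N; have iS : i.+1 = (d - 2 - j)%N by rewrite /i subnSK.
have id2 : (i < d - 2)%N by rewrite iS leq_subr.
rewrite leNgt; apply/negP => lt0.
apply: (@sder_bounded_away i (ltnW id2) true (- sder i x) x) => //; first lra.
move=> y; rewrite expr1 mulN1r lerN2 le_eqVlt => /predU1P[->//|xy].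
have [z z0|z /andP[xz _] e] := @MVT_pos _ (sder i) (fun x => - sder i.+1 x) _ x y x0 xy.
  exact: is_derive_sder.
have : 0 <= sder i.+1 z * (y - x).
  by rewrite mulr_ge0 ?subr_ge0 ?(ltW xy)// iS IH// (lt_trans x0).
lra.
Qed.

Lemma sder_noninc k x y : (k <= d - 2)%N -> 0 < x -> x <= y -> sder k y <= sder k x.
Proof.
rewrite leq_eqVlt => /predU1P[->|kd] x0; first by case: sder_top => _ /(_ _ y x0).
rewrite le_eqVlt => /predU1P[->//|xy].
have [z z0|z /andP[xz _] e] := @MVT_pos _ (sder k) (fun x => - sder k.+1 x) _ x y x0 xy.
  exact: is_derive_sder.
have : 0 <= sder k.+1 z * (y - x).
  by rewrite mulr_ge0 ?subr_ge0 ?(ltW xy)// sder_ge0// (lt_trans x0).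
lra.
Qed.

Lemma sleftE k x : (k < d - 2)%N -> 0 < x -> sleft k x = sder k.+1 x.
Proof.
move=> kd x0; rewrite /sleft /sder derive1nS leftder_derive1//.
by case: gen => _ [h _ _ _] _; exact: h.
Qed.

(** Below the top order this is the mean value theorem with a monotone derivative; at the top order
    it is convexity. *)
Lemma sder_slopes k : (k <= d - 2)%N -> slopes (sder k) (sleft k).
Proof.
rewrite leq_eqVlt => /predU1P[->|kd].
  have [_ _ cv] := sder_top => x y x0 xy.
  have E z : 0 < z -> sleft (d - 2) z = - leftder (sder (d - 2)) z.
    move=> z0; have [cz _ _] := convex_leftder cv z0.
    by rewrite /sleft (leftder_sign cz) exprS mulN1r mulNr mulrA -expr2 sqrr_sign mul1r.
  rewrite (E _ x0) (E _ (lt_trans x0 xy)); exact: (convex_slopes cv x0 xy).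
move=> x y x0 xy; rewrite (sleftE kd x0) (sleftE kd (lt_trans x0 xy)).
apply: (slopes_derive (p := sder k.+1)) => // [z z0|z w z0 zw].
  exact: is_derive_sder.
exact: sder_noninc.
Qed.

Lemma sleft_noninc k x y : (k <= d - 2)%N -> 0 < x -> x <= y -> sleft k y <= sleft k x.
Proof. by move=> kd; apply: slopes_noninc; exact: sder_slopes. Qed.

Lemma sleft_ge0 k x : (k <= d - 2)%N -> 0 < x -> 0 <= sleft k x.
Proof.
move=> kd x0; have x1 : x < x + 1 by lra.
have /andP[_] := sder_slopes kd x0 x1.
have := sder_noninc kd x0 (ltW x1).
have -> : x + 1 - x = 1 by lra.
by rewrite mulr1; lra.
Qed.

Lemma sder_continuous k (x : R) : (k <= d - 2)%N -> 0 < x -> {for x, continuous (sder k)}.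
Proof. by move=> kd; apply: slopes_continuous; exact: sder_slopes. Qed.

Lemma sleft_continuous k (x : R) : (k < d - 2)%N -> 0 < x ->
  {for x, continuous (sleft k)}.
Proof.
move=> kd x0; rewrite /prop_for/continuous_at sleftE//.
have := sder_continuous (k := k.+1) kd x0; apply: cvg_trans.
apply: near_eq_cvg; near=> y; rewrite sleftE//.
by near: y; exact: (cvgr_gt x).
Unshelve. all: by end_near. Qed.

Lemma sder_eq0 k w z : (k <= d - 2)%N -> 0 <= w -> psi w = 0 -> w < z -> sder k z = 0.
Proof.
move=> kd w0 pw; elim: k kd z => [|k IH] kd z wz.
  have z0 : 0 <= z by rewrite (le_trans w0)// ltW.
  by rewrite sder0; apply: le_anti; rewrite psi_ge0// andbT -pw psi_noninc// ltW.
pose v := (w + z) / 2.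
have wv : w < v by rewrite /v; lra.
have vz : v < z by rewrite /v; lra.
have v0 : 0 < v by rewrite (le_lt_trans w0).
have /andP[] := sder_slopes (ltnW kd) v0 vz.
rewrite (IH (ltnW kd) _ wv) (IH (ltnW kd) _ wz) subrr (sleftE kd (lt_trans v0 vz)) => + _.
rewrite pmulr_lle0 ?subr_gt0// => h.
by apply: le_anti; rewrite h sder_ge0// (lt_trans v0).
Qed.

Lemma sleft_eq0 k w z : (k <= d - 2)%N -> 0 <= w -> psi w = 0 -> w < z -> sleft k z = 0.
Proof.
move=> kd w0 pw wz; pose v := (w + z) / 2.
have wv : w < v by rewrite /v; lra.
have vz : v < z by rewrite /v; lra.
have v0 : 0 < v by rewrite (le_lt_trans w0).
have /andP[] := sder_slopes kd v0 vz.
rewrite (sder_eq0 kd w0 pw wv) (sder_eq0 kd w0 pw wz) subrr => + _.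
rewrite pmulr_lle0 ?subr_gt0// => h.
by apply: le_anti; rewrite h sleft_ge0// (lt_trans v0).
Qed.

(** The requirement [0 < psi z] matters: it places [z] before every [phir psi a] with [a] small. If
    [psi] never vanishes, [sder k] tends to 0 at infinity; otherwise [z] is taken just before the
    first zero of [psi]. *)
Lemma sder_small k e : (k <= d - 2)%N -> 0 < e ->
  exists z, [/\ 0 < z, 0 < psi z & sder k z < e].
Proof.
move=> kd e0.
have [[w w0 pw]|npsi] := pselect (exists2 w, 0 <= w & psi w = 0); last first.
  have [M M0 /(_ M (lexx _)) hM] : exists2 M, 0 < M & forall z, M <= z -> sder k z < e.
    elim: k kd e e0 => [|k IH] kd e e0.
      by have [M M0 hM] := psi_small e0; exists M => // z /hM; rewrite sder0.
    (* On an interval of length 1 the slope inequality bounds [sder k.+1 z] by [sder k (z - 1)],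
       whence the shift by 1. *)
    have [M M0 hM] := IH (ltnW kd) e e0; exists (M + 1); first lra.
    move=> z zM; have v0 : 0 < z - 1 by lra.
    have zz : z - 1 < z by lra.
    have /andP[] := sder_slopes (ltnW kd) v0 zz.
    have -> : z - (z - 1) = 1 by lra.
    have Mz : M <= z - 1 by lra.
    have z0 : 0 < z by lra.
    rewrite mulr1 (sleftE kd z0).
    by have := hM _ Mz; have := sder_ge0 (ltnW kd) z0; lra.
  exists M; split => //; rewrite lt_neqAle psi_ge0 ?ltW// andbT eq_sym.
  by apply/eqP => pM; apply: npsi; exists M => //; exact: ltW.
(* To the right of [inf Z] the function [sder k] vanishes, and it is continuous at [inf Z]; so it is
   small slightly to the left, where [psi] is still positive. *)
pose Z := [set w | 0 <= w /\ psi w = 0].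
have Z1 : lbound Z 1.
  move=> v [v0 pv]; rewrite leNgt; apply/negP => v1.
  by have := psi_noninc v0 (ltW v1); rewrite pv psi1 leNgt invr_gt0 ltr0n.
have hZ : has_inf Z by split; [exists w|exists 1].
have i1 : 1 <= inf Z by apply: lb_le_inf => //; case: hZ.
have i0 : 0 < inf Z by lra.
have right0 z : inf Z < z -> sder k z = 0.
  by move=> /(inf_lt hZ.1)[v [v0 pv] vz]; exact: sder_eq0 kd v0 pv vz.
have cs := sder_continuous kd i0.
have si : sder k (inf Z) < e.
  rewrite ltNge; apply/negP => es.
  have /(cvgr_gt _)/(_ 0 _) : sder k x @[x --> inf Z] --> sder k (inf Z) by exact: cs.
  move=> /(_ (lt_le_trans e0 es)) /nbhs_ballP[r /= r0 h].
  have := h (inf Z + r / 2).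
  rewrite right0 ?ltxx; last by rewrite ltrDl divr_gt0.
  suff b : ball (inf Z) r (inf Z + r / 2) by move=> /(_ b).
  rewrite /ball/= opprD addrA subrr add0r normrN gtr0_norm ?divr_gt0//.
  by rewrite ltr_pdivrMr// ltr_pMr// ltr1n.
have /(cvgr_lt _)/(_ e si) : sder k x @[x --> inf Z] --> sder k (inf Z) by exact: cs.
move=> /nbhs_ballP[r /= r0 h].
pose z := Num.max (inf Z - r / 2) (inf Z / 2).
have zi : z < inf Z.
  by rewrite /z gt_max ltrBlDr ltrDl divr_gt0//= ltr_pdivrMr// ltr_pMr// ltr1n.
have z0 : 0 < z by rewrite /z lt_max [X in _ || X]divr_gt0// orbT.
exists z; split => //.
  rewrite lt_neqAle psi_ge0 ?(ltW z0)// andbT eq_sym; apply/eqP => pz.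
  by have := @ge_inf _ Z (ex_intro _ 1 Z1) z (conj (ltW z0) pz); rewrite leNgt zi.
apply: h; rewrite /ball/= gtr0_norm ?subr_gt0// ltrBlDl -ltrBlDr.
by rewrite lt_max ltrD2l ltrN2 ltr_pdivrMr// ltr_pMr// ltr1n.
Qed.

Let sleft_sder_eq0 k z : (k <= d - 2)%N -> 0 < z -> sleft k z = 0 -> sder k z = 0.
Proof.
move=> kd z0 pz; apply/eqP; rewrite eq_le sder_ge0// andbT.
rewrite leNgt; apply/negP => /(sder_small kd)[y [y0 _ yz]].
have zy : z < y by rewrite ltNge; apply/negP => /(sder_noninc kd y0); lra.
by have /andP[_] := sder_slopes kd z0 zy; rewrite pz mul0r; lra.
Qed.

(** If the slope vanished at [z], then [sder k] would be constant beyond [z], yet it takes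
    arbitrarily small values, so [sder k z = 0]. This is a zero slope one order lower, and
    descending reaches [psi z = 0]. These slopes occur as denominators in densities and kernels. *)
Lemma sleft_gt0 k z : (k <= d - 2)%N -> 0 < z -> 0 < psi z -> 0 < sleft k z.
Proof.
move=> kd z0 pz; rewrite lt_neqAle sleft_ge0// andbT eq_sym; apply/eqP.
elim: k kd => [|k IH] kd pk0.
  suff : psi z = 0 by apply/eqP; rewrite gt_eqF.
  by rewrite -sder0; exact: sleft_sder_eq0.
by apply: IH; [exact: ltnW|rewrite sleftE//; exact: sleft_sder_eq0].
Qed.

End Signed_derivatives.

(** * Generators and pseudo-inverses *)

(** [fine] sends [+oo] to 0, so [phir psi u] represents [phi psi u] reliably only for
    [0 < u <= 1]. *)
Definition phir (R : realType) (psi : R -> R) (u : R) : R := fine (phi psi u).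

Section Pseudo_inverse.
Variables (R : realType) (psi : R -> R) (d : nat).
Hypothesis gen : Car_generator d psi.
Implicit Types x y z w u v a b c : R.

Lemma psi_ltW z w : 0 <= w -> psi w < psi z -> z < w.
Proof. by move=> w0; rewrite !ltNge; apply: contra => /(psi_noninc gen w0). Qed.

Lemma psi_gt0_lt z w : 0 <= z -> 0 <= w -> 0 < psi z -> (psi w < psi z) = (z < w).
Proof.
move=> z0 w0 pz; apply/idP/idP; first exact: psi_ltW.
by move=> zw; exact: (psi_lt gen).
Qed.

Lemma psi_continuous_gt0 (x : R) : 0 < x -> {for x, continuous psi}.
Proof.
move=> x0; have -> : psi = sder psi 0 by apply/funext => y; rewrite sder0.
exact: (sder_continuous gen (leq0n _)).
Qed.

Lemma psi_slopes : slopes psi (sleft psi 0).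
Proof. by move=> x y x0 xy; have := sder_slopes gen (leq0n _) x0 xy; rewrite !sder0. Qed.

Lemma phi_psi z : 0 <= z -> 0 < psi z -> phi psi (psi z) = z%:E.
Proof.
move=> z0 pz; rewrite /phi.
suff -> : [set t | 0 <= t /\ psi t = psi z] = [set z] by rewrite image_set1 ereal_inf1.
apply/seteqP; split=> [t [t0 e]|t /= ->//].
apply/eqP; rewrite eq_le !leNgt; apply/andP; split; apply/negP => h.
  by have := psi_lt gen z0 h pz; rewrite e ltxx.
by have := psi_lt gen t0 h; rewrite e ltxx => /(_ pz).
Qed.

Lemma phir_psi z : 0 <= z -> 0 < psi z -> phir psi (psi z) = z.
Proof. by move=> z0 pz; rewrite /phir phi_psi. Qed.

Lemma psi_surj u : 0 < u <= 1 -> exists2 z, 0 <= z & psi z = u.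
Proof.
move=> /andP[u0 u1]; have [M M0 /(_ M (lexx _)) hM] := psi_small gen u0.
have [||z zM <-] := @IVT _ psi 0 M u (ltW M0); last by exists z => //; rewrite (itvP zM).
  apply: continuous_subspaceW (psi_continuous_within gen).
  by move=> x /=; rewrite !in_itv/= => /andP[->].
by rewrite (psi0 gen) ge_min le_max (ltW hM) u1 orbT.
Qed.

Lemma phi_fin u : 0 < u <= 1 -> phi psi u = (phir psi u)%:E.
Proof.
by move=> /[dup] u01 /psi_surj[z z0 e]; move: u01; rewrite -e => /andP[? _]; rewrite /phir phi_psi.
Qed.

Lemma phir_ge0 u : 0 < u <= 1 -> 0 <= phir psi u.
Proof.
by move=> /[dup] u01 /psi_surj[z z0 e]; move: u01; rewrite -e => /andP[? _]; rewrite phir_psi.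
Qed.

Lemma psi_phir u : 0 < u <= 1 -> psi (phir psi u) = u.
Proof.
by move=> /[dup] u01 /psi_surj[z z0 e]; move: u01; rewrite -e => /andP[? _]; rewrite phir_psi.
Qed.

Lemma phir1 : phir psi 1 = 0.
Proof. by rewrite -[X in phir _ X](psi0 gen) phir_psi// (psi0 gen). Qed.

Lemma phi1 : phi psi 1 = 0%E.
Proof. by rewrite phi_fin ?ltr01 ?lexx// phir1. Qed.

Lemma phir_lt u v : 0 < u -> u < v -> v <= 1 -> phir psi v < phir psi u.
Proof.
move=> u0 uv v1; have v0 := lt_trans u0 uv.
have uI : 0 < u <= 1 by rewrite u0 ltW// (lt_le_trans uv).
have vI : 0 < v <= 1 by rewrite v0 v1.
by rewrite -psi_gt0_lt ?phir_ge0// !psi_phir.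
Qed.

Lemma phir_le u v : 0 < u -> u <= v -> v <= 1 -> phir psi v <= phir psi u.
Proof.
move=> u0; rewrite le_eqVlt => /predU1P[->//|uv] v1; exact/ltW/phir_lt.
Qed.

Lemma phir_gt0 u : 0 < u < 1 -> 0 < phir psi u.
Proof. by move=> /andP[u0 u1]; rewrite -phir1; exact: phir_lt. Qed.

Lemma phi_ge0 u : (0 <= phi psi u)%E.
Proof. by apply: le_ereal_inf_tmp => _ [z [z0 _] <-]; rewrite lee_fin. Qed.

(** If [psi z] is positive, then by continuity [psi] is still positive at some [w] beyond [z], and
    every zero lies to the right of [w]. This turns the guards of [psiE] and of the kernel into
    conditions on [psi]. *)
Lemma phi0_le z : 0 <= z -> (phi psi 0 <= z%:E)%E = (psi z == 0).
Proof.
move=> z0; apply/idP/eqP => [h|pz]; last first.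
  by apply: ge_ereal_inf; exists z%:E => //; exists z.
apply/eqP; move: h; apply: contraTT => pz.
have {}pz : 0 < psi z by rewrite lt_neqAle (psi_ge0 gen)// eq_sym pz.
rewrite -ltNge.
suff [w zw pw] : exists2 w, z < w & 0 < psi w.
  apply: (@lt_le_trans _ _ w%:E); first by rewrite lte_fin.
  apply: le_ereal_inf_tmp => _ [t [t0 pt] <-]; rewrite lee_fin leNgt.
  by apply/negP => /ltW/(psi_noninc gen t0); rewrite pt leNgt pw.
move: z0; rewrite le_eqVlt => /predU1P[<-|z0].
  by exists 1; rewrite ?ltr01// (psi1 gen) invr_gt0.
have /(cvgr_gt _)/(_ 0 pz) : psi x @[x --> z] --> psi z := psi_continuous_gt0 z0.
move=> /nbhs_ballP[r /= r0 h]; exists (z + r / 2); first by rewrite ltrDl divr_gt0.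
apply: h; rewrite /ball/= opprD addrA subrr add0r normrN gtr0_norm ?divr_gt0//.
by rewrite ltr_pdivrMr// ltr_pMr// ltr1n.
Qed.

Lemma psiE_phi0 s : (phi psi 0 <= s)%E -> psiE psi s = 0.
Proof.
case: s => [z| |] //= h; last by have := le_trans (phi_ge0 0) h.
have z0 : 0 <= z by rewrite -lee_fin (le_trans (phi_ge0 0)).
by rewrite ltNge z0/=; apply/eqP; rewrite -phi0_le.
Qed.

(** A zero coordinate pushes the sum to at least [phi psi 0], finite or not, where [psiE] vanishes;
    otherwise all summands are finite. Later arguments can thus stay in the reals. *)
Lemma psiE_sum (I : finType) (u : I -> R) : (forall i, 0 <= u i <= 1) ->
  psiE psi (\sum_i phi psi (u i))%E =
  if [exists i, u i == 0] then 0 else psi (\sum_i phir psi (u i)).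
Proof.
move=> u01; case: ifPn => [/existsP[i /eqP ui]|].
  apply: psiE_phi0; rewrite (bigD1 i)//= ui leeDl//.
  by apply: sume_ge0 => j _; exact: phi_ge0.
rewrite negb_exists => /forallP un0.
have u0 i : 0 < u i <= 1.
  by have /andP[h ->] := u01 i; rewrite andbT lt_neqAle eq_sym un0.
under eq_bigr do rewrite phi_fin//.
rewrite sumEFin/= ltNge sumr_ge0// => i _; exact: phir_ge0.
Qed.

(** Decrements of a convex function shrink under right shifts. If [b <= a + c], compare slopes over
    [[a, b]] and [[a + c, b + c]]; otherwise compare [[a, a + c]] with [[b, b + c]] and
    rearrange. *)
Let psi_shift_pos a b c : 0 < a -> a < b -> 0 <= c ->
  psi (a + c) - psi (b + c) <= psi a - psi b.
Proof.
move=> a0 ab; rewrite le_eqVlt => /predU1P[<-|c0]; first by rewrite !addr0.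
have sn := slopes_noninc psi_slopes.
have ac : a < a + c by lra.
have bc : b < b + c by lra.
have acbc : a + c < b + c by lra.
have ac0 : 0 < a + c by lra.
have b0 : 0 < b by lra.
have [bac|acb] := leP b (a + c).
  have /andP[h1 _] := psi_slopes a0 ab.
  have /andP[_ h2] := psi_slopes ac0 acbc.
  have h3 : sleft psi 0 (a + c) * (b - a) <= sleft psi 0 b * (b - a).
    by apply: ler_wpM2r; [rewrite subr_ge0 ltW|exact: sn].
  have E : b + c - (a + c) = b - a by ring.
  by rewrite E in h2; apply: le_trans h2 (le_trans h3 h1).
have /andP[h1 _] := psi_slopes a0 ac.
have /andP[_ h2] := psi_slopes b0 bc.
have E1 : a + c - a = c by ring.
have E2 : b + c - b = c by ring.
rewrite E1 in h1; rewrite E2 in h2.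
have h3 : sleft psi 0 b * c <= sleft psi 0 (a + c) * c.
  by apply: ler_wpM2r; [exact: ltW|apply: sn => //; exact: ltW].
by have := le_trans h2 (le_trans h3 h1); lra.
Qed.

Lemma psi_shift a b c : 0 <= a -> a <= b -> 0 <= c ->
  psi (a + c) - psi (b + c) <= psi a - psi b.
Proof.
move=> a0; rewrite le_eqVlt => /predU1P[->|ab]; first by rewrite !subrr.
rewrite [0 <= c]le_eqVlt => /predU1P[<-|c0]; first by rewrite !addr0.
move: a0; rewrite le_eqVlt => /predU1P[a0|a0]; last exact: psi_shift_pos (ltW c0).
(* Slopes are available on the open half-line only: 0 is replaced by a small [a'], at a cost of at
   most [e] by continuity of [psi] at [c]. *)
rewrite -a0 add0r in ab *; apply/ler_addgt0Pr => e e0.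
have /(cvgr_gt _)/(_ (psi c - e)) : psi x @[x --> c] --> psi c := psi_continuous_gt0 c0.
rewrite ltrBlDr ltrDl => /(_ e0) /nbhs_ballP[r /= r0 h].
pose a' := Num.min (r / 2) (b / 2).
have a'0 : 0 < a' by rewrite lt_min !divr_gt0.
have a'r : a' < r by rewrite gt_min ltr_pdivrMr// ltr_pMr// ltr1n.
have a'b : a' < b by rewrite gt_min [X in _ || X]ltr_pdivrMr// ltr_pMr// ltr1n orbT.
have := h (a' + c); rewrite /ball/= opprD addrCA subrr addr0 normrN gtr0_norm// => /(_ a'r).
have := psi_shift_pos a'0 a'b (ltW c0).
by have := psi_noninc gen (lexx 0) (ltW a'0); lra.
Qed.

(** Summands are exchanged one at a time, each exchange being controlled by [psi_shift]. With
    summands [phir psi (u i)] this is the Lipschitz property of copulas. *)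
Lemma psi_sum_lip (I : Type) (r : seq I) (z w : I -> R) :
  (forall i, 0 <= z i) -> (forall i, 0 <= w i) ->
  `|psi (\sum_(i <- r) z i) - psi (\sum_(i <- r) w i)| <=
    \sum_(i <- r) `|psi (z i) - psi (w i)|.
Proof.
move=> z0 w0.
have sh a b c : 0 <= a -> 0 <= b -> 0 <= c ->
    `|psi (a + c) - psi (b + c)| <= `|psi a - psi b|.
  wlog : a b / a <= b => [wl a0 b0 c0|ab a0 b0 c0].
    by have [ab|/ltW ba] := leP a b; [|rewrite distrC [leRHS]distrC]; apply: wl.
  rewrite !ger0_norm ?subr_ge0 ?(psi_noninc gen) ?addr_ge0 ?lerD2r//.
  exact: psi_shift.
elim: r => [|i r IH]; first by rewrite !big_nil subrr normr0.
rewrite !big_cons.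
have zs : 0 <= \sum_(i <- r) z i by rewrite sumr_ge0.
have ws : 0 <= \sum_(i <- r) w i by rewrite sumr_ge0.
apply: le_trans (ler_distD (psi (w i + \sum_(i <- r) z i)) _ _) _.
apply: lerD; first exact: sh.
by apply: le_trans IH; rewrite ![w i + _]addrC; exact: sh.
Qed.

End Pseudo_inverse.

(** * Margins and Lipschitz bounds of Archimedean copulas *)

Section Margins.
Variables (R : realType) (psi : R -> R) (d : nat).
Hypothesis gen : Car_generator d psi.

Lemma archCE (u : 'I_d -> R) : cube u ->
  archC psi u = if [exists i, u i == 0] then 0 else psi (\sum_i phir psi (u i)).
Proof. exact: (psiE_sum gen). Qed.

Lemma bivCE (i j : 'I_d) (p : R * R) : i != j ->
  bivC psi i j p = psiE psi (phi psi p.1 + phi psi p.2)%E.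
Proof.
move=> ij; rewrite /bivC /archC (bigD1 i)//= eqxx (bigD1 j)/=; last by rewrite eq_sym.
rewrite eq_sym (negbTE ij) eqxx big1 ?adde0// => k /andP[ki kj].
by rewrite (negbTE ki) (negbTE kj) (phi1 gen).
Qed.

Lemma margCE m (x : 'I_m -> R) : (m <= d)%N ->
  margC d psi x = psiE psi (\sum_i phi psi (x i))%E.
Proof.
move=> md; rewrite /margC /archC; congr (psiE _ _).
pose F k := phi psi (match (insub k : option 'I_m) with Some k' => x k' | None => 1 end).
rewrite -(big_mkord xpredT F) (big_cat_nat _ (n := m))//=.
rewrite [X in (_ + X)%E]big_nat_cond [X in (_ + X)%E]big1 ?adde0; last first.
  move=> k /andP[/andP[mk _] _]; rewrite /F insubF ?(phi1 gen)//.
  by rewrite ltnNge mk.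
rewrite big_mkord; apply: eq_bigr => k _.
by rewrite /F valK.
Qed.

End Margins.

(** Each cell contributes an error of at most the increment of [W] times the mesh. Both sides
    telescope, leaving the total increment of [W] times the mesh. *)
Lemma partition_bound (R : realType) (E W : R -> R) (a b : R) (N : nat) :
  (0 < N)%N ->
  let x i := a + i%:R * ((b - a) / N%:R) in
  (forall i, (i < N)%N -> `|E (x i.+1) - E (x i)| <= (W (x i.+1) - W (x i)) * ((b - a) / N%:R)) ->
  `|E b - E a| <= (W b - W a) * ((b - a) / N%:R).
Proof.
move=> N0 x h.
have x0 : x 0%N = a by rewrite /x mul0r addr0.
have xN : x N = b by rewrite /x mulrC divfK ?pnatr_eq0 -?lt0n// addrCA subrr addr0.
rewrite -{1 2}xN -{1 2}x0 -!(telescope_sumr (fun i => _ (x i)))//.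
rewrite mulr_suml (le_trans (ler_norm_sum _ _ _))// !big_mkord.
by apply: ler_sum => i _; exact: h.
Qed.

Section Copula_lipschitz.
Variables (R : realType) (psi : R -> R) (d : nat).
Hypothesis gen : Car_generator d psi.

Lemma psiE_sum_le (I : finType) (u : I -> R) i : (forall i, 0 <= u i <= 1) ->
  0 <= psiE psi (\sum_i phi psi (u i))%E <= u i.
Proof.
move=> u01; rewrite (psiE_sum gen)//; have /andP[ui0 ui1] := u01 i.
case: ifPn => [_|]; first by rewrite lexx.
rewrite negb_exists => /forallP un0.
have u0 j : 0 < u j <= 1.
  by have /andP[h ->] := u01 j; rewrite andbT lt_neqAle eq_sym un0.
have p0 j := phir_ge0 gen (u0 j).
rewrite (psi_ge0 gen) ?sumr_ge0//= -[leRHS](psi_phir gen (u0 i)).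
by apply: (psi_noninc gen) => //; rewrite (bigD1 i)//= lerDl sumr_ge0.
Qed.

(** With positive coordinates this is [psi_sum_lip]. A zero coordinate makes one value 0, and the
    other is at most its own corresponding coordinate. *)
Lemma psiE_sum_lip (I : finType) (u v : I -> R) :
  (forall i, 0 <= u i <= 1) -> (forall i, 0 <= v i <= 1) ->
  `|psiE psi (\sum_i phi psi (u i))%E - psiE psi (\sum_i phi psi (v i))%E| <=
  \sum_i `|u i - v i|.
Proof.
have zero (w w' : I -> R) i : (forall i, 0 <= w i <= 1) -> (forall i, 0 <= w' i <= 1) ->
    w i = 0 ->
    `|psiE psi (\sum_i phi psi (w i))%E - psiE psi (\sum_i phi psi (w' i))%E| <=
    \sum_i `|w i - w' i|.
  move=> w1 w'1 wi.
  have -> : psiE psi (\sum_i phi psi (w i))%E = 0.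
    by apply: le_anti; rewrite andbC; have := psiE_sum_le i w1; rewrite wi.
  have /andP[h1 h2] := psiE_sum_le i w'1.
  rewrite sub0r normrN ger0_norm// (le_trans h2)// (bigD1 i)//= wi sub0r normrN.
  by rewrite ger0_norm ?lerDl ?sumr_ge0//; case/andP : (w'1 i).
move=> u1 v1; have [/existsP[i /eqP ui]|un0] := boolP [exists i, u i == 0].
  exact: zero ui.
have [/existsP[i /eqP vi]|vn0] := boolP [exists i, v i == 0].
  rewrite distrC (eq_bigr (fun i => `|v i - u i|)) => [|j _]; last exact: distrC.
  exact: zero vi.
rewrite !(psiE_sum gen)// (negbTE un0) (negbTE vn0).
have pos (w : I -> R) : (forall i, 0 <= w i <= 1) -> ~~ [exists i, w i == 0] ->
    forall i, 0 < w i <= 1.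
  move=> w1; rewrite negb_exists => /forallP wn0 i.
  by have /andP[h ->] := w1 i; rewrite andbT lt_neqAle eq_sym wn0.
have {un0}u0 := pos _ u1 un0; have {vn0}v0 := pos _ v1 vn0.
apply: le_trans (psi_sum_lip gen _ _ _) _ => [i|i|].
- exact: (phir_ge0 gen).
- exact: (phir_ge0 gen).
- by apply: ler_sum => i _; rewrite !(psi_phir gen).
Qed.

Definition cop2 (u v : R) : R := psiE psi (phi psi u + phi psi v)%E.

(** Indexing the two summands by [bool] makes the results on finite sums applicable. *)
Lemma cop2E u v : cop2 u v = psiE psi (\sum_(b : bool) phi psi (if b then u else v))%E.
Proof. by rewrite big_bool. Qed.

Lemma cop2_lip u v u' v' : 0 <= u <= 1 -> 0 <= v <= 1 -> 0 <= u' <= 1 -> 0 <= v' <= 1 ->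
  `|cop2 u v - cop2 u' v'| <= `|u - u'| + `|v - v'|.
Proof.
move=> u1 v1 u1' v1'; rewrite !cop2E; apply: le_trans (psiE_sum_lip _ _) _ => [[]|[]|]//.
by rewrite big_bool.
Qed.

(** Beyond the first zero of [psi] the inverse no longer returns [a] or [b], but there both sides
    are 0 by monotonicity. *)
Lemma cop2_psi a b : 0 <= a -> 0 <= b -> cop2 (psi a) (psi b) = psi (a + b).
Proof.
move=> a0 b0; have pa := psi_ge0 gen a0; have pb := psi_ge0 gen b0.
have ab0 := addr_ge0 a0 b0.
rewrite cop2E (psiE_sum gen); last by case; rewrite ?(psi_ge0 gen)// (psi_le1 gen).
case: ifPn => [/existsP[[] /eqP p0]|].
- by apply/esym/le_anti; rewrite (psi_ge0 gen)// andbT -p0 (psi_noninc gen)// lerDl.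
- by apply/esym/le_anti; rewrite (psi_ge0 gen)// andbT -p0 (psi_noninc gen)// lerDr.
- rewrite negb_exists => /forallP h; rewrite big_bool/=.
  by rewrite !(phir_psi gen)// lt_neqAle eq_sym ?(h true) ?(h false).
Qed.

Lemma cop2_le u v u' v' : 0 <= u -> u <= u' -> u' <= 1 -> 0 <= v -> v <= v' -> v' <= 1 ->
  cop2 u v <= cop2 u' v'.
Proof.
move=> u0 uu' u1 v0 vv' v1.
have U : forall b, 0 <= (if b then u else v) <= 1.
  by case; [rewrite u0 (le_trans uu')|rewrite v0 (le_trans vv')].
have U' : forall b, 0 <= (if b then u' else v') <= 1.
  by case; [rewrite u1 (le_trans u0)|rewrite v1 (le_trans v0)].
have /andP[g0 _] := psiE_sum_le true U'.
rewrite !cop2E; rewrite {1}(psiE_sum gen)//; case: ifPn => // /existsPn hn.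
have {}u0 : 0 < u by rewrite lt_neqAle u0 eq_sym (hn true).
have {}v0 : 0 < v by rewrite lt_neqAle v0 eq_sym (hn false).
rewrite (psiE_sum gen)// ifF; last first.
  apply/negbTE; rewrite negb_exists; apply/forallP => -[].
    by rewrite gt_eqF// (lt_le_trans u0).
  by rewrite gt_eqF// (lt_le_trans v0).
rewrite !big_bool/=; apply: (psi_noninc gen).
  by apply: addr_ge0; apply: (phir_ge0 gen); rewrite ?u1 ?v1 andbT; [exact: lt_le_trans uu'|exact: lt_le_trans vv'].
by apply: lerD; exact: (phir_le gen).
Qed.

End Copula_lipschitz.

(** * Convergence of generators *)

Section Convergence.
Variables (R : realType) (d : nat) (psi : R -> R) (psis : nat -> R -> R).
Hypothesis gen : Car_generator d psi.
Hypothesis gens : forall n, Car_generator d (psis n).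
Implicit Types x y z w u v a b c e : R.

Definition pt_conv := forall x : R, 0 <= x -> psis n x @[n --> \oo] --> psi x.

(** Polya's argument for monotone functions: the points [z j], where [psi] takes the values
    [1 - j / N], cut the range into slices of height [1 / N], and monotonicity carries the error at
    neighbouring points to every [t], however large. *)
Lemma pt_conv_unif : pt_conv -> unif_conv_on `[0, +oo[%classic psis psi.
Proof.
move=> cv e e0.
pose N := (Num.truncn (2 / e)).+1.
have N0 : 0 < N%:R :> R by rewrite ltr0n.
have Ne : 1 / N%:R < e / 2.
  by rewrite ltr_pdivrMr// -ltr_pdivrMl ?divr_gt0// mulr1 invf_div truncnS_gt.
pose z (j : 'I_N) := phir psi (1 - j%:R / N%:R).
have jb (j : 'I_N) : 0 < (1 - j%:R / N%:R : R) <= 1.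
  by rewrite subr_gt0 ltr_pdivrMr// mul1r ltr_nat ltn_ord/= gerBl divr_ge0.
have z0 j : 0 <= z j := phir_ge0 gen (jb j).
have [M _ hM] : \forall n \near \oo, forall j : 'I_N, `|psi (z j) - psis n (z j)| < e / 2.
  apply: filter_forall => j; have /cvgrPdist_lt := cv (z j) (z0 j).
  by apply; rewrite divr_gt0.
exists M => n /hM {hM} hM t /=; rewrite in_itv/= andbT => t0.
have pt0 := psi_ge0 gen t0; have pt1 := psi_le1 gen t0.
have [j hj] : exists j : 'I_N, 1 - j.+1%:R / N%:R <= psi t <= 1 - j%:R / N%:R.
  pose q := Num.truncn ((1 - psi t) * N%:R).
  have /truncn_itv/andP[q1 q2] : 0 <= (1 - psi t) * N%:R by rewrite mulr_ge0 ?subr_ge0.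
  rewrite -ler_pdivrMr// in q1; rewrite -ltr_pdivlMr// in q2.
  have [qN|Nq] := ltnP q N.
    by exists (Ordinal qN); apply/andP; split=> /=; lra.
  (* [N <= q] happens only when [psi t = 0]; such a [t] is assigned to the last slice. *)
  exists ord_max; rewrite divff ?gt_eqF//= subrr pt0/= lerBrDl -lerBrDr.
  by apply: le_trans q1; rewrite ler_pM2r ?invr_gt0// ler_nat ltnW.
have pz k : psi (z k) = 1 - k%:R / N%:R := psi_phir gen (jb k).
have /andP[j1 j2] := hj.
have SE : j.+1%:R / N%:R = j%:R / N%:R + 1 / N%:R :> R by rewrite -mulrDl -natr1.
have up : psis n t <= psi t + 1 / N%:R + e / 2.
  have zt : z j <= t.
    rewrite leNgt; apply/negP => tz; have /andP[p0 _] := jb j.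
    have pzt := psi_noninc gen t0 (ltW tz); rewrite pz in pzt.
    by have := psi_lt gen t0 tz (lt_le_trans p0 pzt); rewrite pz; lra.
  have h1 := psi_noninc (gens n) (z0 j) zt.
  have := hM j; rewrite pz ltr_norml => /andP[h2 h3]; lra.
(* The last slice has no grid point on its right, since [phi psi 0] may be infinite; there the bound
   comes from [psis n] being nonnegative. *)
have lo : psi t - 1 / N%:R - e / 2 <= psis n t.
  have [jN|Nj] := ltnP j.+1 N.
    pose k := Ordinal jN; have /andP[p0 _] := jb k.
    have tz : t <= z k.
      rewrite leNgt; apply/negP => zt; have := psi_lt gen (z0 k) zt; rewrite pz => /(_ p0).
      by rewrite ltNge j1.
    have h1 := psi_noninc (gens n) t0 tz.
    have := hM k; rewrite pz ltr_norml /= => /andP[h2 h3]; lra.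
  have := psi_ge0 (gens n) t0.
  have jE : j.+1 = N by apply/eqP; rewrite eqn_leq ltn_ord.
  by rewrite jE divff ?gt_eqF// in SE; lra.
by rewrite ltr_norml; apply/andP; split; lra.
Qed.

Lemma unif_pt_conv : unif_conv_on `[0, +oo[%classic psis psi -> pt_conv.
Proof.
move=> U x x0; apply/cvgrPdist_lt => e e0; have [N hN] := U e e0.
by exists N => // n /= Nn; rewrite distrC; apply: hN => //=; rewrite in_itv/= x0.
Qed.

(** [psi] decreases strictly around [phir psi y], so [y] lies strictly between the values of [psi]
    at two nearby points. Eventually the same holds for [psis n], which traps [phir (psis n) y]
    between these points. *)
Lemma pt_conv_phir : pt_conv -> forall y, 0 < y <= 1 ->
  phir (psis n) y @[n --> \oo] --> phir psi y.
Proof.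
move=> cv y y01; have /andP[y0 y1] := y01.
move: y1; rewrite le_eqVlt => /predU1P[->|y1].
  rewrite (phir1 gen); under eq_fun do rewrite (phir1 (gens _)); exact: cvg_cst.
have z0 := phir_gt0 gen (_ : 0 < y < 1); rewrite y0 y1 in z0.
have {}z0 := z0 isT.
have pz := psi_phir gen y01.
apply/cvgrPdist_lt => e e0.
pose a := Num.max 0 (phir psi y - e / 2).
have a0 : 0 <= a by rewrite le_max lexx.
have az : a < phir psi y by rewrite gt_max z0/= ltrBlDr ltrDl divr_gt0.
have ea : phir psi y - e < a by rewrite lt_max; apply/orP; right; lra.
have zb : phir psi y < phir psi y + e / 2 by rewrite ltrDl divr_gt0.
have b0 : 0 <= phir psi y + e / 2 by lra.
have ya : y < psi a.
  have := psi_noninc gen a0 (ltW az); rewrite pz => ya.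
  by have := psi_lt gen a0 az (lt_le_trans y0 ya); rewrite pz.
have yb : psi (phir psi y + e / 2) < y.
  by rewrite -[ltRHS]pz; apply: (psi_lt gen); rewrite ?pz// ltW.
apply: filterS2 (cvgr_gt _ (cv a a0) _ ya) (cvgr_lt _ (cv _ b0) _ yb) => n ha hb.
have pn := psi_phir (gens n) y01; have pn0 := phir_ge0 (gens n) y01.
have : a < phir (psis n) y by apply: (psi_ltW (gens n)); rewrite ?pn.
have : phir (psis n) y < phir psi y + e / 2 by apply: (psi_ltW (gens n)); rewrite ?pn.
rewrite ltr_norml => *; apply/andP; split; lra.
Qed.

Lemma pt_conv_phi : pt_conv -> forall y, 0 < y <= 1 ->
  phi (psis n) y @[n --> \oo] --> phi psi y.
Proof.
move=> cv y y01; rewrite (phi_fin gen)//.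
under eq_fun do rewrite (phi_fin (gens _))//.
by apply: cvg_EFin; [exact: nearW|exact: pt_conv_phir].
Qed.

Lemma phi_pt_conv : (forall y, 0 < y <= 1 ->
  phi (psis n) y @[n --> \oo] --> phi psi y) -> pt_conv.
Proof.
move=> cphi.
have cv y : 0 < y <= 1 -> phir (psis n) y @[n --> \oo] --> phir psi y.
  by move=> y01; have := cphi y y01; rewrite (phi_fin gen)// => /fine_cvg.
move=> x x0; apply/cvgrPdist_lt => e e0.
have px0 := psi_ge0 gen x0; have px1 := psi_le1 gen x0.
have upper : \forall n \near \oo, psis n x < psi x + e.
  have [h|h] := ltP (psi x + e / 2) 1; last first.
    by apply: nearW => n; have := psi_le1 (gens n) x0; lra.
  have y01 : 0 < psi x + e / 2 <= 1 by apply/andP; split; lra.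
  have p0 := phir_ge0 gen y01.
  have /(cvgr_lt _ (cv _ y01)) : phir psi (psi x + e / 2) < x.
    by apply: (psi_ltW gen) => //; rewrite (psi_phir gen y01); lra.
  apply: filterS => n /ltW/(psi_noninc (gens n) (phir_ge0 (gens n) y01)).
  by rewrite (psi_phir (gens n) y01); lra.
have lower : \forall n \near \oo, psi x - e < psis n x.
  have [h|h] := ltP 0 (psi x - e / 2); last first.
    by apply: nearW => n; have := psi_ge0 (gens n) x0; lra.
  have y01 : 0 < psi x - e / 2 <= 1 by apply/andP; split; lra.
  have p0 := phir_ge0 gen y01.
  have /(cvgr_gt _ (cv _ y01)) : x < phir psi (psi x - e / 2).
    by apply: (psi_ltW gen) => //; rewrite (psi_phir gen y01); lra.
  apply: filterS => n /ltW/(psi_noninc (gens n) x0).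
  by rewrite (psi_phir (gens n) y01); lra.
apply: filterS2 upper lower => n h1 h2.
by rewrite ltr_norml; apply/andP; split; lra.
Qed.

Lemma pt_conv_archC : pt_conv ->
  unif_conv_on (@cube R d) (fun n => archC (psis n)) (archC psi).
Proof.
move=> /pt_conv_unif U e e0.
(* Of [d + 2] equal shares of [e], one pays for the outer function and [d] for the coordinates; the
   remaining share gives strictness. *)
have e'0 : 0 < e / (d.+1%:R + 1) by rewrite divr_gt0// ltr_wpDl.
have [N hN] := U _ e'0; exists N => n Nn u u1.
have {U}hN t : 0 <= t -> `|psis n t - psi t| < e / (d.+1%:R + 1).
  by move=> t0; apply: hN => //=; rewrite in_itv/= t0.
rewrite (archCE (gens n))// (archCE gen)//; case: ifPn => [_|].
  by rewrite subrr normr0.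
rewrite negb_exists => /forallP un0.
have u0 i : 0 < u i <= 1.
  by have /andP[h ->] := u1 i; rewrite andbT lt_neqAle eq_sym un0.
have p0 i := phir_ge0 gen (u0 i); have pn0 i := phir_ge0 (gens n) (u0 i).
apply: le_lt_trans (ler_distD (psi (\sum_i phir (psis n) (u i))) _ _) _.
apply: (@le_lt_trans _ _ (e / (d.+1%:R + 1) + d%:R * (e / (d.+1%:R + 1)))).
  apply: lerD; first by apply/ltW/hN; rewrite sumr_ge0.
  apply: le_trans (psi_sum_lip gen _ pn0 p0) _.
  rewrite mulr_natl -[X in _ *+ X]card_ord -sumr_const; apply: ler_sum => i _.
  rewrite (psi_phir gen)// -[X in _ - X](psi_phir (gens n) (u0 i)) distrC.
  exact/ltW/hN.
have fE : e / (d.+1%:R + 1) * (d.+1%:R + 1) = e by rewrite divfK// gt_eqF// ltr_wpDl.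
rewrite -natr1 in fE e'0 *; lra.
Qed.

Lemma cop2_pt_conv :
  (forall u v, 0 <= u <= 1 -> 0 <= v <= 1 ->
    cop2 (psis n) u v @[n --> \oo] --> cop2 psi u v) -> pt_conv.
Proof.
move=> cc.
pose S r := psis n r @[n --> \oo] --> psi r.
have I01 (f : R -> R) (gf : Car_generator d f) r : 0 <= r -> 0 <= f r <= 1.
  by move=> r0; rewrite (psi_ge0 gf)// (psi_le1 gf).
have S1 : S 1.
  rewrite /S (psi1 gen); under eq_fun do rewrite (psi1 (gens _)); exact: cvg_cst.
have S0 : S 0.
  rewrite /S (psi0 gen); under eq_fun do rewrite (psi0 (gens _)); exact: cvg_cst.
(* The Lipschitz bound for [cop2 (psis n)] is uniform in [n], so its arguments may be replaced by
   the limits [psi a] and [psi b]. *)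
have SD a b : 0 <= a -> 0 <= b -> S a -> S b -> S (a + b).
  move=> a0 b0 Sa Sb; apply/cvgrPdist_lt => e e0.
  have e3 : 0 < e / 3 by rewrite divr_gt0.
  have /cvgrPdist_lt/(_ _ e3) h1 := Sa; have /cvgrPdist_lt/(_ _ e3) h2 := Sb.
  have /cvgrPdist_lt/(_ _ e3) h3 := cc _ _ (I01 _ gen a a0) (I01 _ gen b b0).
  apply: filterS3 h1 h2 h3 => n h1 h2 h3.
  rewrite -(cop2_psi gen)// -(cop2_psi (gens n))//.
  apply: le_lt_trans (ler_distD (cop2 (psis n) (psi a) (psi b)) _ _) _.
  have h4 := cop2_lip (gens n) (I01 _ gen a a0) (I01 _ gen b b0)
    (I01 _ (gens n) a a0) (I01 _ (gens n) b b0).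
  by apply: le_lt_trans (lerD (ltW h3) h4) _; lra.
(* The diagonal value at [psis n (a / 2)] is [psis n a]. If [t > a / 2] and
   [psis n (a / 2) <= psi t], monotonicity of [cop2] bounds [psis n a] by a quantity tending to
   [psi (t + t) < psi a], which eventually fails; points below [a / 2] are symmetric. *)
have Shalf a : 0 < a -> 0 < psi a -> S a -> S (a / 2).
  move=> a0 pa Sa; have h0 : 0 < a / 2 by rewrite divr_gt0.
  have aE : a / 2 + a / 2 = a by field.
  have lo t : a / 2 < t -> \forall n \near \oo, psi t < psis n (a / 2).
    move=> at2; have t0 := lt_trans h0 at2.
    have lt : cop2 psi (psi t) (psi t) < psi a.
      by rewrite (cop2_psi gen (ltW t0) (ltW t0)) (psi_lt gen (ltW a0))//; lra.
    pose m := (cop2 psi (psi t) (psi t) + psi a) / 2.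
    have m1 : cop2 psi (psi t) (psi t) < m by rewrite /m; lra.
    have m2 : m < psi a by rewrite /m; lra.
    have It := I01 _ gen t (ltW t0).
    apply: filterS2 (cvgr_lt _ (cc _ _ It It) _ m1) (cvgr_gt _ Sa _ m2) => n k1 k2.
    rewrite ltNge; apply/negP => k3; have /andP[It0 It1] := It.
    have := cop2_le (gens n) (psi_ge0 (gens n) (ltW h0)) k3 It1
      (psi_ge0 (gens n) (ltW h0)) k3 It1.
    by rewrite (cop2_psi (gens n) (ltW h0) (ltW h0)) aE; lra.
  have up t : 0 <= t -> t < a / 2 -> \forall n \near \oo, psis n (a / 2) < psi t.
    move=> t0 ta2.
    have lt : psi a < cop2 psi (psi t) (psi t).
      rewrite (cop2_psi gen)// (psi_gt0_lt gen)//; [lra|lra|exact: ltW|].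
      by rewrite (lt_le_trans pa)// (psi_noninc gen)//; lra.
    pose m := (cop2 psi (psi t) (psi t) + psi a) / 2.
    have m1 : m < cop2 psi (psi t) (psi t) by rewrite /m; lra.
    have m2 : psi a < m by rewrite /m; lra.
    have It := I01 _ gen t t0.
    apply: filterS2 (cvgr_gt _ (cc _ _ It It) _ m1) (cvgr_lt _ Sa _ m2) => n k1 k2.
    rewrite ltNge; apply/negP => k3; have /andP[It0 It1] := It.
    have := cop2_le (gens n) It0 k3 (psi_le1 (gens n) (ltW h0))
      It0 k3 (psi_le1 (gens n) (ltW h0)).
    by rewrite (cop2_psi (gens n) (ltW h0) (ltW h0)) aE; lra.
  apply/cvgrPdist_lt => e e0.
  have /cvgrPdist_lt/(_ _ e0)/nbhs_ballP[r /= r0 hr] := psi_continuous_gt0 gen h0.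
  pose s := Num.min (r / 2) (a / 4).
  have s0 : 0 < s by rewrite lt_min !divr_gt0.
  have sr : s < r by rewrite gt_min; apply/orP; left; lra.
  have sa : s <= a / 4 by rewrite ge_min lexx orbT.
  have B1 := hr (a / 2 + s); rewrite /ball/= opprD addrA subrr add0r normrN gtr0_norm// in B1.
  have B2 := hr (a / 2 - s); rewrite /ball/= opprB addrC subrK gtr0_norm// in B2.
  have t1 : a / 2 < a / 2 + s by lra.
  have t2 : 0 <= a / 2 - s by lra.
  have t3 : a / 2 - s < a / 2 by lra.
  apply: filterS2 (lo _ t1) (up _ t2 t3) => n k1 k2.
  by move: (B1 sr) (B2 sr); rewrite !ltr_norml => /andP[? ?] /andP[? ?]; apply/andP; split; lra.
have Sdyad j k : S (k%:R / 2 ^+ j).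
  have Sj : S (1 / 2 ^+ j).
    elim: j {k} => [|j IH]; first by rewrite expr0 divr1.
    have q0 : 0 < 1 / 2 ^+ j :> R by rewrite divr_gt0// exprn_gt0.
    have q1 : 1 / 2 ^+ j <= 1 :> R.
      by rewrite ler_pdivrMr ?exprn_gt0// mul1r exprn_ege1// ler1n.
    rewrite exprSr invfM mulrA; apply: (Shalf _ q0 _ IH).
    have := psi_noninc gen (ltW q0) q1; rewrite (psi1 gen).
    by apply: lt_le_trans; rewrite invr_gt0.
  elim: k => [|k IH]; first by rewrite mul0r.
  by rewrite -natr1 mulrDl; apply: SD => //; rewrite divr_ge0// exprn_ge0.
move=> x; rewrite le_eqVlt => /predU1P[<-//|x0].
apply/cvgrPdist_lt => e e0; have e2 : 0 < e / 2 by rewrite divr_gt0.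
have /cvgrPdist_lt/(_ _ e2)/nbhs_ballP[r /= r0 hr] := psi_continuous_gt0 gen x0.
(* [2 ^ j.+1 > j.+1 > 1 / r] makes the dyadic mesh smaller than [r]; monotonicity of [psis n] then
   encloses its value at [x] between those at the two neighbouring dyadic numbers. *)
pose j := Num.truncn (1 / r).
have j2 : 1 / 2 ^+ j.+1 < r.
  rewrite ltr_pdivrMr ?exprn_gt0// -ltr_pdivrMl// mulrC.
  apply: lt_trans (truncnS_gt _) _.
  by rewrite -natrX ltr_nat ltn_expl.
pose k := Num.truncn (x * 2 ^+ j.+1).
have p2 : (0 : R) < 2 ^+ j.+1 by rewrite exprn_gt0.
have /truncn_itv/andP[k1 k2] : 0 <= x * 2 ^+ j.+1 by rewrite mulr_ge0// ltW.
rewrite -/k in k1 k2.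
have l1 : k%:R / 2 ^+ j.+1 <= x by rewrite ler_pdivrMr.
have l2 : x < k.+1%:R / 2 ^+ j.+1 by rewrite ltr_pdivlMr.
have l3 : k.+1%:R / 2 ^+ j.+1 = k%:R / 2 ^+ j.+1 + 1 / 2 ^+ j.+1 :> R.
  by rewrite -mulrDl natr1.
have B1 := hr (k%:R / 2 ^+ j.+1); rewrite /ball/= ger0_norm ?subr_ge0// in B1.
have B2 := hr (k.+1%:R / 2 ^+ j.+1); rewrite /ball/= ltr0_norm ?subr_lt0// in B2.
have /cvgrPdist_lt/(_ _ e2) C1 := Sdyad j.+1 k.
have /cvgrPdist_lt/(_ _ e2) C2 := Sdyad j.+1 k.+1.
apply: filterS2 C1 C2 => n C1 C2.
have q0 : 0 <= k%:R / 2 ^+ j.+1 :> R by rewrite divr_ge0// ltW.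
have h1 := psi_noninc (gens n) q0 l1.
have h2 := psi_noninc (gens n) (ltW x0) (ltW l2).
have {}B1 := B1 ltac:(lra); have {}B2 := B2 ltac:(lra).
move: C1 C2 B1 B2; rewrite !ltr_norml.
by move=> /andP[? ?] /andP[? ?] /andP[? ?] /andP[? ?]; apply/andP; split; lra.
Qed.

Lemma sder_cvg k (x : R) : pt_conv -> (k <= d - 2)%N -> 0 < x ->
  sder (psis n) k x @[n --> \oo] --> sder psi k x.
Proof.
move=> cv; elim: k x => [|k IH] x kd x0.
  rewrite sder0; under eq_fun do rewrite sder0; exact/cv/ltW.
rewrite -(sleftE gen)//; under eq_fun do rewrite -(sleftE (gens _))//.
apply: (@slopes_cvg _ (fun n => sder (psis n) k) (fun n => sleft (psis n) k)
  (sder psi k) (sleft psi k)) => //.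
- by move=> n; apply: (sder_slopes (gens n)); exact: ltnW.
- by apply: (sder_slopes gen); exact: ltnW.
- by move=> z z0; apply: IH => //; exact: ltnW.
- exact: cvg_cst.
- exact: (sleft_continuous gen).
Qed.

(** The moving argument [xn n] is meant for sums of [phir (psis n) (t i)], which change with [n]. *)
Lemma sleft_cvg k (xn : nat -> R) (x : R) : pt_conv -> (k <= d - 2)%N -> 0 < x ->
  xn n @[n --> \oo] --> x -> {for x, continuous (sleft psi k)} ->
  sleft (psis n) k (xn n) @[n --> \oo] --> sleft psi k x.
Proof.
move=> cv kd x0 cx cs.
apply: (@slopes_cvg _ (fun n => sder (psis n) k) (fun n => sleft (psis n) k)
  (sder psi k) (sleft psi k)) => //.
- by move=> n; exact: (sder_slopes (gens n)).
- exact: (sder_slopes gen).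
- by move=> z z0; exact: sder_cvg.
Qed.

(** The first derivatives are monotone, so their convergence at finitely many partition points
    controls increments of [psis n - psi] over compact intervals; the common value at 1 then fixes
    the constant. *)
Lemma sder1_pt_conv : (0 < d - 2)%N ->
  (forall x, 0 < x -> sder (psis n) 1 x @[n --> \oo] --> sder psi 1 x) -> pt_conv.
Proof.
move=> d2 cv.
pose p := sder psi 1; pose pn n := sder (psis n) 1.
have s x y : 0 < x -> x < y -> p y * (y - x) <= psi x - psi y <= p x * (y - x).
  by move=> x0 xy; rewrite /p -!(sleftE gen)//; [exact: (psi_slopes gen)|exact: lt_trans xy].
have sn n x y : 0 < x -> x < y -> pn n y * (y - x) <= psis n x - psis n y <= pn n x * (y - x).
  by move=> x0 xy; rewrite /pn -!(sleftE (gens n))//; [exact: (psi_slopes (gens n))|exact: lt_trans xy].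
have main a b : 0 < a -> a < b -> forall e, 0 < e ->
    \forall n \near \oo, `|(psis n b - psi b) - (psis n a - psi a)| < e.
  move=> a0 ab e e0; have ba : 0 < b - a by rewrite subr_gt0.
  pose c := (p a - p b) * (b - a).
  have c0 : 0 <= c.
    by apply: mulr_ge0; [rewrite subr_ge0; exact/(sder_noninc gen d2 a0)/ltW|exact: ltW].
  pose N := (Num.truncn (2 * c / e)).+1.
  have N0 : 0 < N%:R :> R by rewrite ltr0n.
  have cN : c / N%:R < e / 2.
    rewrite ltr_pdivrMr// -ltr_pdivrMl ?divr_gt0// invf_div.
    by rewrite mulrAC truncnS_gt.
  pose f := e / (2 * (b - a)).
  have f0 : 0 < f by rewrite divr_gt0// mulr_gt0.
  pose x (i : nat) := a + i%:R * ((b - a) / N%:R).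
  have x0 i : 0 < x i.
    by rewrite /x ltr_wpDr// mulr_ge0// divr_ge0// ltW.
  have xS i : x i.+1 - x i = (b - a) / N%:R.
    by rewrite /x -natr1 mulrDl mul1r addrA [LHS]addrC addKr.
  have dN : 0 < (b - a) / N%:R by rewrite divr_gt0.
  have xlt i : x i < x i.+1 by rewrite -subr_gt0 xS.
  have near_pn : \forall n \near \oo, forall i : 'I_N.+1, `|p (x i) - pn n (x i)| < f.
    by apply: filter_forall => i; have /cvgrPdist_lt/(_ _ f0) := cv _ (x0 i).
  apply: filterS near_pn => n hn.
  (* The linear term adds [f], the error at partition points, on every cell; [- p] adds the
     oscillation of [p]. The total is [f * (b - a) + c / N], with [f] and [N] chosen so that the
     first term is [e / 2] and the second is below [e / 2]. *)
  pose W u := f * ((u - a) / ((b - a) / N%:R)) - p u.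
  have := @partition_bound R (fun u => psis n u - psi u) W a b N isT.
  rewrite -/(x _) => /(_ _)/le_lt_trans; apply.
    move=> i iN; rewrite -/(x i) -/(x i.+1).
    have := hn (Ordinal (ltnW iN : (i < N.+1)%N)); have := hn (Ordinal (iN : (i.+1 < N.+1)%N)).
    rewrite /= !ltr_norml => /andP[h1 h2] /andP[h3 h4].
    have /andP[s1 s2] := s _ _ (x0 i) (xlt i).
    have /andP[t1 t2] := sn n _ _ (x0 i) (xlt i).
    have -> : W (x i.+1) - W (x i) = f + p (x i) - p (x i.+1).
      rewrite /W; have -> : x i.+1 - a = (x i.+1 - x i) + (x i - a) by ring.
      rewrite xS [(_ + (x i - a)) / _]mulrDl divff ?gt_eqF//; ring.
    move: dN s1 s2 t1 t2; rewrite xS; move: ((b - a) / N%:R) => D D0 s1 s2 t1 t2.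
    have k1 : pn n (x i) * D <= (p (x i) + f) * D by apply: ler_wpM2r; [exact: ltW|lra].
    have k2 : (p (x i.+1) - f) * D <= pn n (x i.+1) * D by apply: ler_wpM2r; [exact: ltW|lra].
    rewrite mulrDl in k1; rewrite mulrBl in k2; rewrite mulrBl mulrDl.
    move: s1 s2 t1 t2 k1 k2; clear; move: (p _ * D) (p _ * D) (pn _ _ * D) (pn _ _ * D) (f * D).
    by move=> ? ? ? ? ? *; rewrite ler_norml; apply/andP; split; lra.
  have -> : (W b - W a) * ((b - a) / N%:R) = f * (b - a) + c / N%:R.
    by rewrite /W /c; field; rewrite gt_eqF//= gt_eqF.
  have -> : f * (b - a) = e / 2 by rewrite /f; field; rewrite gt_eqF.
  lra.
move=> x; rewrite le_eqVlt => /predU1P[<-|x0].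
  rewrite (psi0 gen); under eq_fun do rewrite (psi0 (gens _)); exact: cvg_cst.
apply/cvgrPdist_lt => e e0.
have [x1|x1|->] := ltgtP x 1; last by apply: nearW => n; rewrite (psi1 gen) (psi1 (gens n)) subrr normr0.
- apply: filterS (main x 1 x0 x1 e e0) => n.
  by rewrite (psi1 gen) (psi1 (gens n)) subrr sub0r normrN distrC.
- apply: filterS (main 1 x ltr01 x1 e e0) => n.
  by rewrite (psi1 gen) (psi1 (gens n)) subrr subr0 distrC.
Qed.

End Convergence.

(** * Integrals of monotone products *)

Section Monotone.
Variable R : realType.
Implicit Types (f : R -> R) (D : set R).

Lemma nonincreasing_in_measurable D f : is_interval D ->
  (forall x y, D x -> D y -> x <= y -> f y <= f x) -> measurable_fun D f.
Proof.
move=> iD nf.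
apply: (measurability (@measurable_realfun.RGenCInfty.G R)) => [|/= _ [_] [r] -> <-].
  exact: measurable_realfun.RGenCInfty.measurableE.
apply: is_interval_measurable => s t/= [Ds +] [Dt +] u /andP[su ut].
rewrite !in_itv/= !andbT => fs ft.
have Du : D u by apply: (iD s t) => //; rewrite su ut.
by split => //=; rewrite ?in_itv/= ?andbT (le_trans ft)// nf.
Qed.

(** At every point the one-sided limits of a monotone function exist, and if they agree the value is
    squeezed between them; so each point of non-continuity is a jump. The half-line is exhausted by
    the intervals from [n.+1%:R^-1] to [n.+1%:R]. *)
Lemma nonincreasing_discontinuities f :
  (forall x y, 0 < x -> x <= y -> f y <= f x) ->
  countable [set x : R | 0 < x /\ ~ {for x, continuous f}].
Proof.
move=> nf.
pose D n := [set x : R | (x \in `](n.+1%:R^-1), (n.+1%:R)[) /\ discontinuity (fun y => - f y) x].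
have cD n : countable (D n).
  apply: discontinuity_countable => x y; rewrite !in_itv/= => /andP[nx _] _ xy.
  by rewrite lerN2 nf// (lt_le_trans _ nx).
have cU : countable (\bigcup_n D n) by apply: bigcup_countable.
apply: sub_countable cU; apply: subset_card_le => x [x0 ncf].
pose n := Num.truncn (x + x^-1).
have xn : x < n.+1%:R by apply: lt_trans (truncnS_gt _); rewrite ltrDl invr_gt0.
have nx : n.+1%:R^-1 < x.
  by rewrite invf_plt ?posrE//; apply: lt_trans (truncnS_gt _); rewrite ltrDr.
exists n => //; split; first by rewrite in_itv/= nx.
have x2 : x / 2 < x by rewrite ltr_pdivrMr// ltr_pMr// ltr1n.
have x20 : 0 < x / 2 by rewrite divr_gt0.
have ndN y z : 0 < y -> y <= z -> - f y <= - f z by move=> y0 yz; rewrite lerN2 nf.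
have cl : cvg (- f y @[y --> x^'-]).
  apply: nondecreasing_at_left_is_cvgr.
    near=> s => u v; rewrite !in_itv/= => /andP[su _] _; apply: ndN; apply: lt_trans su.
    by near: s; exact: nbhs_left_gt.
  near=> s; exists (- f x) => _ [u /= + <-]; rewrite in_itv/= => /andP[su ux].
  apply: ndN; last exact: ltW; apply: lt_trans su.
  by near: s; exact: nbhs_left_gt.
have cr : cvg (- f y @[y --> x^'+]).
  apply: nondecreasing_at_right_is_cvgr.
    near=> s => u v; rewrite !in_itv/= => /andP[xu _] _; apply: ndN; exact: lt_trans xu.
  near=> s; exists (- f x) => _ [u /= + <-]; rewrite in_itv/= => /andP[xu us].
  by apply: ndN => //; exact: ltW.
split => //; apply/eqP => e; apply: ncf.
have l1 : lim (- f y @[y --> x^'-]) <= - f x.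
  apply: limr_le => //; near=> y; apply: ndN.
    by near: y; exact: nbhs_left_gt.
  by near: y; exact: nbhs_left_le.
have l2 : - f x <= lim (- f y @[y --> x^'+]).
  apply: limr_ge => //; near=> y; apply: ndN => //.
rewrite -e in l2; have E : lim (- f y @[y --> x^'-]) = - f x by apply: le_anti; rewrite l1.
have c : {for x, continuous (fun y => - f y)}.
  apply/left_right_continuousP; split; first by rewrite -E.
  by rewrite -E e.
have -> : f = (fun y => - - f y) by apply/funext => y; rewrite opprK.
exact: cvgN c.
Unshelve. all: by end_near. Qed.

(* Both [H v - H u] and the integral over [u, v] lie within
   [(W v - W u) * (v - u)] of each other, where [W := Q a * A - A b * Q] is
   monotone; summing over fine partitions, the difference vanishes. *)
Lemma integral_monotone_product (A Q H : R -> R) (a b : R) : a <= b ->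
  (forall u, a <= u <= b -> 0 <= A u) -> (forall u, a <= u <= b -> 0 <= Q u) ->
  (forall u v, a <= u -> u <= v -> v <= b -> A u <= A v) ->
  (forall u v, a <= u -> u <= v -> v <= b -> Q v <= Q u) ->
  (forall u v, a <= u -> u < v -> v <= b ->
    A u * Q v * (v - u) <= H v - H u <= A v * Q u * (v - u)) ->
  (\int[lebesgue_measure]_(u in `[a, b]) (A u * Q u)%:E)%E = (H b - H a)%:E.
Proof.
move=> ab A0 Q0 ndA niQ hH.
have mAQ : measurable_fun `[a, b] (fun u => (A u * Q u)%:E).
  apply/measurable_EFinP/measurable_funM; last first.
    apply: nonincreasing_in_measurable; first exact: interval_is_interval.
    move=> u v /=; rewrite !in_itv/= => /andP[au _] /andP[_ vb] uv; exact: niQ.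
  rewrite -[A]opprK; apply: measurableT_comp => //.
  apply: nonincreasing_in_measurable; first exact: interval_is_interval.
  move=> u v /=; rewrite !in_itv/= => /andP[au _] /andP[_ vb] uv.
  by rewrite lerN2; exact: ndA.
pose F u := (A u * Q u)%:E.
have F0 u : a <= u <= b -> (0 <= F u)%E.
  by move=> ub; rewrite lee_fin mulr_ge0 ?A0 ?Q0.
(* Half-open cells, so that consecutive ones are disjoint and the integral is additive along a
   partition. *)
have piece u v : a <= u -> u <= v -> v <= b ->
    ((A u * Q v * (v - u))%:E <= \int[lebesgue_measure]_(x in `]u, v]) F x <=
    (A v * Q u * (v - u))%:E)%E.
  move=> au uv vb.
  have mF : measurable_fun `]u, v] F.
    apply: measurable_funS mAQ => //; apply: subset_itv => //; rewrite bnd_simp//.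
  have cst r : (\int[lebesgue_measure]_(x in `]u, v]) (cst r%:E x))%E = (r * (v - u))%:E.
    rewrite integral_cst//= lebesgue_measure_itv/= lte_fin.
    move: uv; rewrite le_eqVlt => /predU1P[->|->]; last by rewrite -EFinD.
    by rewrite ltxx mule0 subrr mulr0.
  have sub x : `]u, v]%classic x -> [/\ u <= x, a <= x, x <= v & x <= b].
    rewrite /= in_itv/= => /andP[/ltW ux xv]; split => //.
      exact: le_trans ux.
    exact: le_trans vb.
  have vu : v \in `[a, b] by rewrite in_itv/= vb (le_trans au).
  rewrite -!cst; apply/andP; split.
    apply: ge0_le_integral => //=.
    - move=> x _; rewrite lee_fin mulr_ge0//.
        by rewrite A0// au (le_trans uv).
      by rewrite Q0// vb (le_trans au).
    - move=> x /sub[ux ax xv xb]; rewrite lee_fin ler_pM//.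
      + by rewrite A0// au (le_trans uv).
      + by rewrite Q0// vb (le_trans au).
      + exact: ndA.
      + exact: niQ.
  apply: ge0_le_integral => //=.
  - by move=> x /sub[ux ax xv xb]; rewrite F0// ax.
  - move=> x /sub[ux ax xv xb]; rewrite lee_fin ler_pM//.
    + by rewrite A0// ax.
    + by rewrite Q0// ax.
    + exact: ndA.
    + exact: niQ.
pose J u := fine (\int[lebesgue_measure]_(x in `]a, u]) F x)%E.
have fin u v : a <= u -> u <= v -> v <= b ->
    (\int[lebesgue_measure]_(x in `]u, v]) F x)%E \is a fin_num.
  move=> au uv vb; have /andP[h1 h2] := piece u v au uv vb.
  by rewrite fin_real// (lt_le_trans (ltNyr _) h1) (le_lt_trans h2 (ltry _)).
have JD u v : a <= u -> u <= v -> v <= b ->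
    J v - J u = fine (\int[lebesgue_measure]_(x in `]u, v]) F x)%E.
  move=> au uv vb; have av := le_trans au uv.
  have E : `]a, v]%classic = `]a, u] `|` `]u, v] by apply: itv_bndbnd_setU; rewrite bnd_simp.
  have mF : measurable_fun (`]a, u] `|` `]u, v]) F.
    rewrite -E; apply: measurable_funS mAQ => //; apply: subset_itv; rewrite bnd_simp//.
  have F0' x : (`]a, u] `|` `]u, v])%classic x -> (0 <= F x)%E.
    rewrite -E /= in_itv/= => /andP[/ltW ax xv].
    by rewrite F0// ax (le_trans xv).
  have dis : [disjoint `]a, u]%classic & `]u, v]%classic].
    apply/disj_set2P; rewrite -subset0 => x [] /=; rewrite !in_itv/= => /andP[_ xu] /andP[ux _].
    by move: ux; rewrite ltNge xu.
  rewrite /J E (ge0_integral_setU lebesgue_measure _ _ mF F0' dis)//.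
  by rewrite fineD ?fin ?(le_trans uv)// addrC addKr.
pose W u := Q a * A u - A b * Q u.
pose E u := J u - H u.
have bd u v : a <= u -> u < v -> v <= b -> `|E v - E u| <= (W v - W u) * (v - u).
  move=> au uv vb; have /andP[h1 h2] := hH u v au uv vb.
  have uv' := ltW uv.
  have := piece u v au uv' vb; rewrite -(fineK (fin u v au uv' vb)).
  rewrite -JD// !lee_fin => /andP[h3 h4].
  have -> : E v - E u = (J v - J u) - (H v - H u) by rewrite /E; ring.
  have : (A v * Q u - A u * Q v) * (v - u) <= (W v - W u) * (v - u).
    apply: ler_wpM2r; first by rewrite subr_ge0.
    have aI : a <= u <= b by rewrite au (le_trans uv').
    have vI : a <= v <= b by rewrite vb (le_trans au).
    have -> : A v * Q u - A u * Q v = Q u * (A v - A u) + A u * (Q u - Q v) by ring.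
    have -> : W v - W u = Q a * (A v - A u) + A b * (Q u - Q v) by rewrite /W; ring.
    apply: lerD; apply: ler_wpM2r; rewrite ?subr_ge0.
    - exact: ndA.
    - by apply: niQ => //; case/andP : aI.
    - exact: niQ.
    - by apply: ndA => //; case/andP : aI.
  rewrite mulrBl => h5; rewrite ler_norml.
  have h6 := lerB h4 h1; have h7 := lerB h2 h3.
  rewrite lerNl opprB; apply/andP; split; first exact: le_trans h7 h5.
  exact: le_trans h6 h5.
have key : E b - E a = 0.
  move: ab; rewrite le_eqVlt => /predU1P[->|ab]; first by rewrite subrr.
  apply/eqP/negPn/negP; rewrite -normr_gt0 => e0.
  have ba : 0 < b - a by rewrite subr_gt0.
  pose N := (Num.truncn (`|W b - W a| * (b - a) / `|E b - E a|)).+1.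
  have N0 : 0 < N%:R :> R by rewrite ltr0n.
  have := @partition_bound R E W a b N isT; rewrite leNgt => /(_ _)/negP; apply.
    move=> i iN.
    pose x := a + i%:R * ((b - a) / N%:R); pose y := a + i.+1%:R * ((b - a) / N%:R).
    have xS : y - x = (b - a) / N%:R by rewrite /x /y -natr1; ring.
    rewrite -/x -/y -xS; apply: bd.
    - by rewrite lerDl mulr_ge0// divr_ge0// ltW.
    - by rewrite -subr_gt0 xS divr_gt0.
    - rewrite -lerBrDl mulrCA -[leRHS]mulr1 ler_pM2l// ler_pdivrMr// mul1r ler_nat//.
  apply: le_lt_trans (_ : `|W b - W a| * ((b - a) / N%:R) < _).
    by apply: ler_wpM2r (ler_norm _); rewrite divr_ge0// ltW.
  rewrite mulrA ltr_pdivrMr// -ltr_pdivrMl// [ltLHS]mulrC; exact: truncnS_gt.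
have -> : (\int[lebesgue_measure]_(u in `[a, b]) (A u * Q u)%:E)%E =
    (\int[lebesgue_measure]_(u in `]a, b]) F u)%E.
  rewrite [RHS]integral_itv_obnd_cbnd//; apply: measurable_funS mAQ => //.
  by apply: subset_itv; rewrite bnd_simp.
rewrite -(fineK (fin a b (lexx a) ab (lexx b))); congr EFin.
rewrite -/(J b); have Ja : J a = 0 by rewrite /J set_itvoc0 integral_set0.
by move: key; rewrite /E Ja sub0r; lra.
Qed.

End Monotone.

(** By the rule for inverse functions this is minus the (one-sided) derivative of the
    pseudo-inverse, hence positive on the open unit interval. *)
Definition dphi (R : realType) (psi : R -> R) (u : R) : R := (sleft psi 0 (phir psi u))^-1.

(** * Integrating out one variable of the density *)

Section One_dimensional_density.
Variables (R : realType) (psi : R -> R) (d : nat).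
Hypothesis gen : Car_generator d psi.
Implicit Types x y z u v S : R.

Lemma psi_phir_oo u : 0 < u < 1 -> psi (phir psi u) = u.
Proof. by move=> /andP[u0 u1]; rewrite (psi_phir gen)// u0 ltW. Qed.

Lemma sleft_phir_gt0 k u : (k <= d - 2)%N -> 0 < u < 1 -> 0 < sleft psi k (phir psi u).
Proof.
move=> kd u01; apply: (sleft_gt0 gen) => //; first exact: (phir_gt0 gen).
by rewrite psi_phir_oo//; case/andP : u01.
Qed.

Lemma dphi_gt0 u : 0 < u < 1 -> 0 < dphi psi u.
Proof. by move=> u01; rewrite invr_gt0; exact: sleft_phir_gt0. Qed.

Lemma phir_slopes u v : 0 < u -> u < v -> v < 1 ->
  dphi psi v * (v - u) <= phir psi u - phir psi v <= dphi psi u * (v - u).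
Proof.
move=> u0 uv v1; have u1 := lt_trans uv v1; have v0 := lt_trans u0 uv.
have uI : 0 < u < 1 by rewrite u0.
have vI : 0 < v < 1 by rewrite v0.
have pv := phir_gt0 gen vI.
have puv := phir_lt gen u0 uv (ltW v1).
have /andP[] := psi_slopes gen pv puv; rewrite !psi_phir_oo// => h1 h2.
by rewrite /dphi ler_pdivrMl ?ler_pdivlMl ?sleft_phir_gt0// h1 h2.
Qed.

Lemma dphi_le u v : 0 < u -> u <= v -> v < 1 -> dphi psi v <= dphi psi u.
Proof.
move=> u0; rewrite le_eqVlt => /predU1P[->//|uv] v1.
have /andP[h1 h2] := phir_slopes u0 uv v1.
by rewrite -(ler_pM2r (_ : 0 < v - u)) ?subr_gt0// (le_trans h1).
Qed.

Lemma phir_cvg (un : nat -> R) x : (forall n, 0 < un n <= 1) -> 0 < x <= 1 ->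
  un n @[n --> \oo] --> x -> phir psi (un n) @[n --> \oo] --> phir psi x.
Proof.
move=> un01 x01 cu; have px := psi_phir gen x01; have px0 := phir_ge0 gen x01.
have /andP[x0 x1] := x01.
apply/cvgrPdist_lt => e e0.
have lower : \forall n \near \oo, phir psi x - e < phir psi (un n).
  have [h|h] := ltP (phir psi x - e) 0.
    by apply: nearW => n; apply: lt_le_trans h _; exact: (phir_ge0 gen).
  have xe : phir psi x - e < phir psi x by lra.
  have pe : x <= psi (phir psi x - e) by rewrite -[leLHS]px (psi_noninc gen)// ltW.
  have := psi_lt gen h xe (lt_le_trans x0 pe); rewrite px => /(cvgr_lt _ cu).
  apply: filterS => n hn; apply: (psi_ltW gen); first exact: (phir_ge0 gen).
  by rewrite (psi_phir gen).
have upper : \forall n \near \oo, phir psi (un n) < phir psi x + e.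
  have e1 : phir psi x < phir psi x + e by lra.
  have := psi_lt gen px0 e1; rewrite px => /(_ x0) /(cvgr_gt _ cu).
  apply: filterS => n hn; apply: (psi_ltW gen); first lra.
  by rewrite (psi_phir gen).
apply: filterS2 lower upper => n h1 h2.
by rewrite ltr_norml; apply/andP; split; lra.
Qed.

Lemma measurable_phir : measurable_fun `](0 : R), 1[ (phir psi).
Proof.
apply: nonincreasing_in_measurable; first exact: interval_is_interval.
move=> x y /=; rewrite !in_itv/= => /andP[x0 _] /andP[_ y1] xy.
exact: (phir_le gen x0 xy (ltW y1)).
Qed.

Lemma measurable_dphi : measurable_fun `](0 : R), 1[ (dphi psi).
Proof.
apply: nonincreasing_in_measurable; first exact: interval_is_interval.
move=> x y /=; rewrite !in_itv/= => /andP[x0 _] /andP[_ y1] xy.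
exact: (dphi_le x0 xy y1).
Qed.

Lemma measurable_sleft k : (k <= d - 2)%N -> measurable_fun `](0 : R), +oo[ (sleft psi k).
Proof.
move=> kd; apply: nonincreasing_in_measurable; first exact: interval_is_interval.
move=> x y /=; rewrite !in_itv/= !andbT => x0 _; exact: (sleft_noninc gen).
Qed.

Lemma measurable_sleft_phir k S : (k <= d - 2)%N -> 0 <= S ->
  measurable_fun `](0 : R), 1[ (fun u => sleft psi k (S + phir psi u)).
Proof.
move=> kd S0; apply: (measurable_comp (F := `](0 : R), +oo[) _ _ (measurable_sleft kd)) => //.
  move=> _ [u /= + <-]; rewrite !in_itv/= andbT => /(phir_gt0 gen) p0.
  by rewrite ltr_wpDl.
by apply: measurable_funD => //; exact: measurable_phir.
Qed.

(** The change of variables [u -> S + phir psi u]. The integrand is a nondecreasing factor times a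
    nonincreasing one, and multiplying the two slope inequalities gives the bounds required by
    [integral_monotone_product], with no continuity of [sleft psi k]. *)
Lemma integral_sleft_phir_cc k S a b : (k <= d - 2)%N -> 0 <= S ->
  0 < a -> a <= b -> b < 1 ->
  (\int[lebesgue_measure]_(u in `[a, b]) (sleft psi k (S + phir psi u) * dphi psi u)%:E)%E =
  (sder psi k (S + phir psi b) - sder psi k (S + phir psi a))%:E.
Proof.
move=> kd S0 a0 ab b1.
have I u : a <= u <= b -> 0 < u < 1.
  by move=> /andP[au ub]; rewrite (lt_le_trans a0)// (le_lt_trans ub).
have P u : a <= u <= b -> 0 < S + phir psi u.
  by move=> /I /(phir_gt0 gen) ?; rewrite ltr_wpDl.
apply: (integral_monotone_product (H := fun u => sder psi k (S + phir psi u))) => //.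
- by move=> u /P ?; exact: (sleft_ge0 gen).
- by move=> u /I /dphi_gt0/ltW.
- move=> u v au uv vb; have u0 := lt_le_trans a0 au.
  apply: (sleft_noninc gen) => //; first by apply: P; rewrite vb (le_trans au).
  by rewrite lerD2l; apply: (phir_le gen) => //; exact: le_trans vb (ltW b1).
- by move=> u v au uv vb; apply: dphi_le => //; [exact: lt_le_trans au|exact: le_lt_trans b1].
- move=> u v au uv vb; have u0 := lt_le_trans a0 au; have v1 := le_lt_trans vb b1.
  have uI : a <= u <= b by rewrite au (le_trans (ltW uv)).
  have vI : a <= v <= b by rewrite vb (le_trans au)// ltW.
  have puv := phir_lt gen u0 uv (ltW v1).
  have Suv : S + phir psi v < S + phir psi u by rewrite ltrD2l.
  have /andP[h1 h2] := phir_slopes u0 uv v1.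
  have /andP[] := sder_slopes gen kd (P _ vI) Suv.
  have -> : S + phir psi u - (S + phir psi v) = phir psi u - phir psi v by ring.
  move=> h3 h4; apply/andP; split; [rewrite -[leLHS]mulrA|rewrite -[leRHS]mulrA].
    by apply: le_trans h3; apply: ler_wpM2l => //; apply: (sleft_ge0 gen) => //; exact: P.
  by apply: le_trans h4 _; apply: ler_wpM2l => //; apply: (sleft_ge0 gen) => //; exact: P.
Qed.

(** Compact intervals exhaust [(0, x)]. At the lower end the boundary term tends to 0 even if
    [phi psi 0] is infinite. At the upper end [x = 1] the argument tends to [S], and derivatives of
    [psi] are controlled only away from 0: hence the alternative [k = 0] or [0 < S]. *)
Lemma integral_sleft_phir k S x : (k <= d - 2)%N -> 0 <= S -> (k = 0)%N \/ 0 < S ->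
  0 <= x <= 1 ->
  (\int[lebesgue_measure]_(u in `[0%R, x])
     (if 0 < u < 1 then sleft psi k (S + phir psi u) * dphi psi u else 0)%:E)%E =
  (if x == 0 then 0 else sder psi k (S + phir psi x))%:E.
Proof.
move=> kd S0 kS /andP[]; rewrite le_eqVlt => /predU1P[<- _|x0 x1].
  by rewrite eqxx set_itv1 integral_set1.
rewrite gt_eqF//.
pose f u : \bar R := (sleft psi k (S + phir psi u) * dphi psi u)%:E.
have If u : 0 < u -> u < x -> 0 < u < 1 by move=> -> /lt_le_trans ->.
have mf : measurable_fun `](0 : R), 1[ f.
  apply/measurable_EFinP/measurable_funM; first exact: measurable_sleft_phir.
  exact: measurable_dphi.
have mfx : measurable_fun `]0, x[ f.
  by apply: measurable_funS mf => //; apply: subset_itv; rewrite bnd_simp.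
rewrite integral_itv_bndoo; last first.
  apply: eq_measurable_fun mfx => u; rewrite inE/= in_itv/= => /andP[u0 ux].
  by rewrite If.
transitivity (\int[lebesgue_measure]_(u in `](0 : R)%R, x[) f u)%E.
  by apply: eq_integral => u; rewrite inE/= in_itv/= => /andP[u0 ux]; rewrite If.
(* Starting with denominator 2 gives [a 0 = b 0 = x / 2], so [a n <= b n] for all [n]. *)
pose a n := x / n.+2%:R.
pose b n := x - x / n.+2%:R.
have a0 n : 0 < a n by rewrite divr_gt0.
have bx n : b n < x by rewrite ltrBlDr ltrDl a0.
have a_small e : 0 < e -> exists N, forall n, (N <= n)%N -> a n < e.
  move=> e0; exists (Num.truncn (x / e)) => n Nn.
  rewrite ltr_pdivrMr// mulrC -ltr_pdivrMr//; apply: lt_le_trans (truncnS_gt _) _.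
  by rewrite ler_nat (leq_trans _ (leqnSn _)).
have nia n m : (n <= m)%N -> a m <= a n.
  by move=> nm; rewrite ler_pM2l// lef_pV2 ?posrE// ler_nat.
have ab n : a n <= b n.
  rewrite /b -/(a n); have : a n <= a 0%N by exact: nia.
  have : a 0%N = x / 2 by [].
  lra.
have bigF : \bigcup_n `[a n, b n]%classic = `](0 : R), x[%classic.
  apply/seteqP; split=> [u [n _]|u] /=; rewrite !in_itv/= => /andP[u1 u2].
    by rewrite (lt_le_trans (a0 n))// (le_lt_trans u2).
  have ux : 0 < x - u by rewrite subr_gt0.
  have [N1 h1] := a_small u u1; have [N2 h2] := a_small _ ux.
  exists (maxn N1 N2) => //=; rewrite in_itv/=; apply/andP; split.
    by apply/ltW/h1; rewrite leq_maxl.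
  rewrite /b -/(a _); have := h2 _ (leq_maxr N1 N2); lra.
have ca : a n @[n --> \oo] --> 0.
  apply/cvgrPdist_lt => e e0; have [N hN] := a_small e e0.
  by exists N => // n /= /hN; rewrite sub0r normrN gtr0_norm.
have cb : b n @[n --> \oo] --> x.
  rewrite -[x in _ --> x]subr0; apply: cvgB => //; exact: cvg_cst.
have ndF : nondecreasing_seq (fun n => `[a n, b n]%classic).
  move=> n m nm; apply/subsetPset; apply: subset_itv; rewrite bnd_simp ?nia//.
  by rewrite /b lerB// nia.
have sF n : `[a n, b n] `<=` `](0 : R), x[%classic by rewrite -bigF => u hu; exists n.
have cvgH : (\int[lebesgue_measure]_(u in `[a n, b n]) f u)%E @[n --> \oo] -->
    (\int[lebesgue_measure]_(u in `](0 : R)%R, x[) f u)%E.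
  rewrite -bigF; apply: ge0_nondecreasing_set_cvg_integral => // [n|n u /sF].
    by apply: measurable_funS mfx => //; exact: sF.
  rewrite /= in_itv/= => /andP[u0 ux]; rewrite lee_fin mulr_ge0//.
    by apply: (sleft_ge0 gen) => //; rewrite ltr_wpDl// (phir_gt0 gen)// If.
  by apply/ltW/dphi_gt0/If.
have E n : (\int[lebesgue_measure]_(u in `[a n, b n]) f u)%E =
    (sder psi k (S + phir psi (b n)) - sder psi k (S + phir psi (a n)))%:E.
  by apply: integral_sleft_phir_cc => //; exact: lt_le_trans (bx n) x1.
rewrite (funext E) in cvgH.
suff cvgE : (sder psi k (S + phir psi (b n)) - sder psi k (S + phir psi (a n)))%:E
    @[n --> \oo] --> (sder psi k (S + phir psi x))%:E by exact: cvg_unique cvgH cvgE.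
apply: cvg_EFin; first exact: nearW.
rewrite -[X in _ --> X]subr0; apply: cvgB.
  have bI n : 0 < b n <= 1 by rewrite (lt_le_trans (a0 n) (ab n)) (le_trans (ltW (bx n))).
  have xI : 0 < x <= 1 by rewrite x0.
  have cp := phir_cvg bI xI cb.
  have [Sp|Sp] := ltP 0 (S + phir psi x).
    have cs := sder_continuous gen kd Sp.
    by apply: (continuous_cvg _ cs); apply: cvgD => //; exact: cvg_cst.
  (* Here [S = 0] and [phir psi x = 0], so [k = 0]; [psi] inverts [phir psi] exactly, and no limit
     at 0 has to be taken. *)
  have p0 := phir_ge0 gen xI; have S00 : S = 0 by lra.
  have {kS}-> : k = 0%N by case: kS => //; rewrite S00 ltxx.
  rewrite S00 sder0 add0r (psi_phir gen)//.
  by under eq_fun do rewrite sder0 add0r (psi_phir gen)//.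
(* As soon as [a n < psi z], the point [phir psi (a n)] lies beyond [z], where [sder psi k] is below
   [e]. *)
apply/cvgrPdist_lt => e e0; have [z [z0 pz sz]] := sder_small gen kd e0.
have [N hN] := a_small _ pz; exists N => // n /= /hN an.
have aI : 0 < a n <= 1 by rewrite a0 (le_trans (ab n))// (le_trans (ltW (bx n))).
have zp : z < phir psi (a n) by apply: (psi_ltW gen); rewrite ?(phir_ge0 gen) ?(psi_phir gen).
have zS : z <= S + phir psi (a n) by rewrite ltW// ltr_wpDl.
rewrite sub0r normrN ger0_norm ?(sder_ge0 gen)// ?(lt_le_trans z0)//.
exact: le_lt_trans (sder_noninc gen kd z0 zS) sz.
Qed.

End One_dimensional_density.

(** * Iterated integrals over boxes *)

Section Borel_boxes.
Variables (R : realType) (m : nat).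

(** The generators of [borel], used to equip functions on ['I_m] with a measurable structure whose
    measurable sets are exactly the sets in [borel]. *)
Definition boxes : set (set ('I_m -> R)) := [set B | exists a b, B = ocbox a b].
Definition boxT := g_sigma_algebraType boxes.

Lemma measurable_ocbox (a b : 'I_m -> R) : measurable (ocbox a b : set boxT).
Proof. by apply: sub_sigma_algebra; exists a, b. Qed.

Lemma measurable_coord (i : 'I_m) : measurable_fun setT (fun t : boxT => t i).
Proof.
apply: (measurability (@measurable_realfun.RGenOInfty.G R)) => [|/= _ [_] [r] -> <-].
  exact: measurable_realfun.RGenOInfty.measurableE.
rewrite setTI.
pose a (n : nat) (j : 'I_m) : R := if j == i then r else - n%:R.
pose b (n : nat) (j : 'I_m) : R := n%:R.
suff -> : (fun t : boxT => t i) @^-1` `]r, +oo[ = \bigcup_n (ocbox (a n) (b n) : set boxT).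
  by apply: bigcupT_measurable => n; exact: measurable_ocbox.
apply/seteqP; split=> [t|t [n _ /(_ i)]] /=; rewrite in_itv/= andbT; last first.
  by rewrite /a eqxx => /andP[].
move=> rt; pose n := (Num.truncn (\sum_j `|t j|)).+1; exists n => // j.
have tn : `|t j| < n%:R.
  apply: le_lt_trans (truncnS_gt _); rewrite (bigD1 j)//= lerDl.
  by apply: sumr_ge0.
move: tn; rewrite ltr_norml /a /b => /andP[h1 h2].
by rewrite ltW// andbT; case: eqVneq => [->|].
Qed.

Lemma measurable_to_boxT d' (T' : measurableType d') (f : T' -> boxT) :
  (forall i, measurable_fun setT (fun x => f x i)) -> measurable_fun setT f.
Proof.
move=> mf; apply: (measurability (boxes : set (set boxT))) => // _ [_ [a [b ->]] <-].
rewrite setTI.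
have -> : f @^-1` ocbox a b =
    \bigcap_(i in [set: 'I_m]) ((fun x => f x i) @^-1` `]a i, b i]%classic).
  apply/seteqP; split=> x /= h => [i _|i]; first by rewrite /= in_itv/=; exact: h.
  by have := h i I; rewrite /= in_itv.
apply: fin_bigcap_measurable => // i _.
by rewrite -[X in measurable X]setTI; exact: mf.
Qed.

Lemma measurable_upd (i : 'I_m) :
  measurable_fun setT (fun z : (boxT * measurableTypeR R)%type => upd z.1 i z.2 : boxT).
Proof.
apply: measurable_to_boxT => j; rewrite /upd; case: eqVneq => _.
  exact: measurable_snd.
apply: (measurableT_comp (f := fun t : boxT => t j)); first exact: measurable_coord.
exact: measurable_fst.
Qed.

Lemma measurable_upd_snd (t : boxT) (i : 'I_m) :
  measurable_fun setT (fun u : measurableTypeR R => upd t i u : boxT).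
Proof.
apply: measurable_to_boxT => j; rewrite /upd; case: eqVneq => _ //.
Qed.

End Borel_boxes.
Arguments boxes : clear implicits.
Arguments boxT : clear implicits.

Section Iterated_integral.
Variables (R : realType) (m : nat).
Local Notation T := (boxT R m).
Local Notation mu := (@lebesgue_measure R).
Implicit Types (s : seq 'I_m) (x t : 'I_m -> R) (f g : T -> \bar R).
Local Open Scope ereal_scope.

Lemma iint_ge0 s x f t : (forall t, 0 <= f t) -> 0 <= iint s x f t.
Proof.
move=> f0; elim: s t => [|i s IH] t //=.
by apply: integral_ge0 => u _; exact: IH.
Qed.

(** A guard inside the integrand absorbs the integration bounds, so that one step of the iteration
    is an integral over sections and Tonelli's measurability result applies. *)
Lemma measurable_iint s x f : measurable_fun setT f -> (forall t, 0 <= f t) ->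
  measurable_fun setT (iint s x f : T -> \bar R).
Proof.
move=> mf f0; elim: s => [//|i s IH] /=.
pose h (z : (T * measurableTypeR R)%type) : \bar R :=
  if (0 <= z.2 <= x i)%R then iint s x f (upd z.1 i z.2) else 0.
have -> : (fun t => \int[mu]_(u in `[0%R, x i]) iint s x f (upd t i u)) =
    fubini_F mu h.
  apply/funext => t; rewrite integral_mkcond; apply: eq_integral => u _.
  by rewrite /h patchE mem_setE in_itv.
apply: measurable_fun_fubini_tonelli_F => [|z]; last first.
  by rewrite /h; case: ifPn => // _; exact: iint_ge0.
apply: measurable_fun_ifT => //.
  apply: measurable_and; apply: measurable_fun_ler => //; exact: measurable_snd.
by apply: measurableT_comp IH _; exact: measurable_upd.
Qed.

Lemma measurable_iint_upd s x f t i : measurable_fun setT f -> (forall t, 0 <= f t) ->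
  measurable_fun setT (fun u : measurableTypeR R => iint s x f (upd t i u)).
Proof.
move=> mf f0; apply: (measurableT_comp (measurable_iint s x mf f0)).
exact: measurable_upd_snd.
Qed.

Lemma iint_eq s x f g t :
  (forall t', (forall i, i \in s -> (0 <= t' i <= x i)%R) ->
              (forall i, i \notin s -> t' i = t i) -> f t' = g t') ->
  iint s x f t = iint s x g t.
Proof.
elim: s t => [|i s IH] t h /=; first by apply: h.
apply: eq_integral => u; rewrite inE/= in_itv/= => u01; apply: IH => t' h1 h2.
apply: h => j; rewrite inE.
  have [js _|js] := boolP (j \in s); first exact: h1.
  by rewrite orbF => /eqP ji; rewrite ji in js *; rewrite (h2 _ js) /upd eqxx.
by rewrite negb_or => /andP[ji js]; rewrite h2// /upd (negbTE ji).
Qed.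

Lemma iint_off s x f t t' : (forall i, i \notin s -> t i = t' i) ->
  iint s x f t = iint s x f t'.
Proof.
elim: s t t' => [|i s IH] t t' h /=.
  by congr f; apply/funext => i; exact: h.
apply: eq_integral => u _; apply: IH => j js; rewrite /upd; case: eqVneq => // ji.
by apply: h; rewrite inE negb_or ji.
Qed.

Lemma le_iint s x f g t : measurable_fun setT f -> measurable_fun setT g ->
  (forall t, 0 <= f t) -> (forall t, f t <= g t) ->
  iint s x f t <= iint s x g t.
Proof.
move=> mf mg f0 fg; have g0 t' := le_trans (f0 t') (fg t').
elim: s t => [|i s IH] t /=; first exact: fg.
apply: ge0_le_integral => //.
- by move=> u _; exact: iint_ge0.
- by apply: measurable_funTS; exact: measurable_iint_upd.
- by apply: measurable_funTS; exact: measurable_iint_upd.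
Qed.

Lemma iint0 s x t : iint s x (fun _ : T => 0) t = 0.
Proof.
by elim: s t => [//|i s IH] t /=; apply: integral0_eq => u _; exact: IH.
Qed.

Lemma iintD s x f g t : measurable_fun setT f -> measurable_fun setT g ->
  (forall t, 0 <= f t) -> (forall t, 0 <= g t) ->
  iint s x (fun t => f t + g t) t = iint s x f t + iint s x g t.
Proof.
move=> mf mg f0 g0; elim: s t => [//|i s IH] t /=.
rewrite -ge0_integralD//.
- by apply: eq_integral => u _; exact: IH.
- by move=> u _; exact: iint_ge0.
- by apply: measurable_funTS; exact: measurable_iint_upd.
- by move=> u _; exact: iint_ge0.
- by apply: measurable_funTS; exact: measurable_iint_upd.
Qed.

Lemma iintZ s x f t (c : R) : measurable_fun setT f -> (forall t, 0 <= f t) ->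
  (0 <= c)%R -> iint s x (fun t => c%:E * f t) t = c%:E * iint s x f t.
Proof.
move=> mf f0 c0; elim: s t => [//|i s IH] t /=.
rewrite -ge0_integralZl_EFin//.
- by apply: eq_integral => u _; exact: IH.
- by move=> u _; exact: iint_ge0.
- by apply: measurable_funTS; exact: measurable_iint_upd.
Qed.

Lemma iint_nneseries s x (f : nat -> T -> \bar R) t :
  (forall n, measurable_fun setT (f n)) -> (forall n t, 0 <= f n t) ->
  iint s x (fun t => \sum_(n <oo) f n t) t = \sum_(n <oo) iint s x (f n) t.
Proof.
move=> mf f0; elim: s t => [//|i s IH] t /=.
rewrite -integral_nneseries//.
- by apply: eq_integral => u _; exact: IH.
- by move=> n; apply: measurable_funTS; exact: measurable_iint_upd.
- by move=> n u _; exact: iint_ge0.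
Qed.

Lemma iint_fatou s x (f : nat -> T -> \bar R) t :
  (forall n, measurable_fun setT (f n)) -> (forall n t, 0 <= f n t) ->
  iint s x (fun t => limn_einf (f^~ t)) t <= limn_einf (fun n => iint s x (f n) t).
Proof.
move=> mf f0.
have einf0 (a : nat -> \bar R) : (forall n, 0 <= a n) -> 0 <= limn_einf a.
  move=> a0; rewrite limn_einf_lim; apply: lime_ge; first exact: is_cvg_einfs.
  by apply: nearW => n; apply: le_ereal_inf_tmp => _ [k _ <-].
have mlim (h : nat -> T -> \bar R) : (forall n, measurable_fun setT (h n)) ->
    measurable_fun setT (fun t : T => limn_einf (h^~ t)).
  move=> mh; apply: (measurableT_comp (f := -%E) (g := fun t : T => limn_esup (\- (h^~ t)))) => //.
  apply: (@measurable_fun_limn_esup _ T R setT (fun n t => - h n t)) => n.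
  by apply: measurableT_comp.
elim: s t => [//|i s IH] t /=.
apply: le_trans (fatou mu _ _ _) => //; last 2 first.
- by move=> n; apply: measurable_funTS; exact: measurable_iint_upd.
- by move=> n u _; exact: iint_ge0.
apply: ge0_le_integral => //.
- by move=> u _; apply: iint_ge0 => t'; apply: einf0.
- apply: measurable_funTS; apply: measurable_iint_upd; first exact: mlim.
  by move=> t'; apply: einf0.
- apply: measurable_funTS.
  apply: (measurableT_comp (f := fun t : T => limn_einf (fun n => iint s x (f n) t))).
    by apply: mlim => n; exact: measurable_iint.
  exact: measurable_upd_snd.
Qed.

End Iterated_integral.

Section Box_integral.
Variables (R : realType) (m : nat).
Local Notation T := (boxT R m).
Local Notation mu := (@lebesgue_measure R).
Implicit Types (s : seq 'I_m) (x t : 'I_m -> R) (f g : T -> \bar R) (A : set T).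
Local Open Scope ereal_scope.

Lemma iint_guard s x (P : R -> bool) i f t : i \notin s ->
  iint s x (fun t' : T => if P (t' i) then f t' else 0) t =
  if P (t i) then iint s x f t else 0.
Proof.
move=> si; rewrite (@iint_eq _ _ s x _ (fun t' : T => if P (t i) then f t' else 0)).
  by case: ifPn => // _; exact: iint0.
by move=> t' _ /(_ i si) ->.
Qed.

(** Moving the bounds into an indicator puts all boxes [[0, x]] on the common domain of the unit
    cube, so their integrals become values of one measure. *)
Lemma iint_restrict s x f t : uniq s -> (forall i, x i <= 1)%R ->
  iint s x f t =
  iint s (fun=> 1%R) (fun t' : T => if all (fun i => t' i <= x i)%R s then f t' else 0) t.
Proof.
move=> + x1; elim: s t => [//|i s IH] t /= /andP[si us].
transitivity (\int[mu]_(u in `[0%R, 1%R])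
    if (u <= x i)%R then iint s x f (upd t i u) else 0).
  rewrite [LHS]integral_mkcond [RHS]integral_mkcond; apply: eq_integral => u _.
  rewrite !patchE !mem_setE !in_itv/=.
  case: (leP u (x i)) => ux; last by rewrite andbF; case: ifP.
  by rewrite andbT (le_trans ux (x1 i)) andbT.
apply: eq_integral => u _; rewrite IH//.
set h := (fun t' : T => _).
have := iint_guard (fun=> 1%R) (fun v => v <= x i)%R h (upd t i u) si.
have -> : upd t i u i = u by rewrite /upd eqxx.
move=> <-; apply: iint_eq => t' _ _.
by rewrite /h; case: (leP (t' i)).
Qed.

Lemma boxint_restrict x f : cube x ->
  boxint x f = boxint (fun=> 1%R) (fun t : T => if [forall i, t i <= x i]%R then f t else 0).
Proof.
move=> x01; rewrite /boxint iint_restrict ?enum_uniq//; last by move=> i; case/andP: (x01 i).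
rewrite (@iint_off _ _ _ _ _ _ (fun=> 1%R)); last by move=> i; rewrite mem_enum.
apply: iint_eq => t' _ _; congr (if _ then _ else _).
by apply/allP/forallP => h i; [apply: h; rewrite mem_enum|move=> _; exact: h].
Qed.

Definition cubeint f : \bar R := boxint (fun=> 1%R) f.

Lemma cubeint_eq f g : (forall t, cube t -> f t = g t) -> cubeint f = cubeint g.
Proof.
move=> fg; apply: iint_eq => t' h _; apply: fg => i; apply: h.
by rewrite mem_enum.
Qed.

Definition einds A t : \bar R := (\1_A t)%:E.

Lemma einds_ge0 A t : 0 <= einds A t.
Proof. by rewrite lee_fin. Qed.

Lemma measurable_einds A : measurable A -> measurable_fun setT (einds A : T -> \bar R).
Proof. by move=> mA; apply/measurable_EFinP; exact: measurable_indic. Qed.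

Lemma einds_bigcup (F : (set T)^nat) t : (forall k, measurable (F k)) -> trivIset setT F ->
  einds (\bigcup_k F k) t = \sum_(k <oo) einds (F k) t.
Proof.
move=> mF tF; have dE A : einds A t = \d_(t : T) A by rewrite diracE /einds indicE.
rewrite dE measure_semi_bigcup//; last by apply: bigcup_measurable => k _; exact: mF.
Qed.

Section Density_measure.
Variable f : T -> R.
Hypotheses (mf : measurable_fun setT f) (f0 : forall t, (0 <= f t)%R).

(* The proofs are arguments so that the measure structure is inferrable. *)
Definition density_measure of measurable_fun setT f & (forall t, (0 <= f t)%R) :=
  fun A : set T => cubeint (fun t : T => (f t)%:E * einds A t).

Local Notation nu := (density_measure mf f0).

Lemma measurable_mul_einds A : measurable A ->
  measurable_fun setT (fun t : T => (f t)%:E * einds A t).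
Proof.
move=> mA; apply: emeasurable_funM; last exact: measurable_einds.
exact/measurable_EFinP.
Qed.

Lemma mul_einds_ge0 A t : 0 <= (f t)%:E * einds A t.
Proof. by rewrite mule_ge0// ?lee_fin// einds_ge0. Qed.

Let nu0 : nu set0 = 0.
Proof.
rewrite /density_measure -[RHS](@iint0 R m (enum 'I_m) (fun=> 1%R) (fun=> 1%R)).
by apply: cubeint_eq => t _; rewrite /einds indic0 mule0.
Qed.

Let nu_ge0 A : 0 <= nu A.
Proof. by apply: iint_ge0 => t; exact: mul_einds_ge0. Qed.

Let nu_sigma_additive : semi_sigma_additive nu.
Proof.
move=> F mF tF mUF.
have -> : nu (\bigcup_n F n) = \sum_(k <oo) nu (F k).
  rewrite /density_measure -iint_nneseries; last 2 first.
  - by move=> n; exact: measurable_mul_einds.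
  - by move=> n t; exact: mul_einds_ge0.
  apply: cubeint_eq => t _; rewrite einds_bigcup// nneseriesZl// => k _.
  exact: einds_ge0.
by apply: is_cvg_nneseries => n _ _; exact: nu_ge0.
Qed.

HB.instance Definition _ := isMeasure.Build _ T R nu nu0 nu_ge0 nu_sigma_additive.

End Density_measure.

Let m1 : measurable_fun setT (fun _ : T => 1%R : R).
Proof. exact: measurable_cst. Qed.
Let p1 (t : T) : (0 <= 1 :> R)%R := ler01.

Definition cube_measure : {measure set T -> \bar R} := density_measure m1 p1.

Lemma cube_measureE A : cube_measure A = cubeint (einds A).
Proof. by apply: cubeint_eq => t _; rewrite mul1e. Qed.

(** Lower orthants form a pi-system, and on them a density measure is read off from its distribution
    function. *)
Definition quadrant x : set T := [set t | forall i, (t i <= x i)%R].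

Lemma measurable_quadrant x : measurable (quadrant x).
Proof.
have -> : quadrant x = \bigcap_(i in [set: 'I_m]) ((fun t : T => t i) @^-1` `]-oo, x i]%classic).
  by apply/seteqP; split=> t /= h => [i _|i]; have := h i; rewrite /= in_itv//=; exact.
apply: fin_bigcap_measurable => // i _.
rewrite -[X in measurable X]setTI; apply: measurable_coord => //.
Qed.

Lemma measurable_quadrants : (@measurable _ T) = <<s [set quadrant x | x in setT] >>.
Proof.
apply/seteqP; split; last first.
  apply: smallest_sub; first exact: sigma_algebra_measurable.
  by move=> _ [x _ <-]; exact: measurable_quadrant.
apply: smallest_sub; first exact: smallest_sigma_algebra.
move=> _ [a [b ->]].
pose G : set (set T) := [set quadrant x | x in setT].
change ((@measurable _ (g_sigma_algebraType G)) (ocbox a b)).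
(* Lowering the [i]-th bound of [quadrant b] to [a i] and removing the result leaves the points with
   [a i < t i]. *)
have -> : ocbox a b = quadrant b `&`
    \bigcap_(i in [set: 'I_m]) ~` quadrant (fun j => if j == i then Num.min (a i) (b i) else b j).
  apply/seteqP; split=> [t h|t [h1 h2] i].
    split=> [i|i _ /(_ i)]; first by case/andP : (h i).
    by rewrite eqxx le_min => /andP[]; rewrite leNgt; case/andP : (h i) => ->.
  rewrite h1 andbT ltNge; apply/negP => ti; apply: (h2 i I) => j.
  by case: eqVneq => [->|_]; [rewrite le_min ti h1|exact: h1].
apply: measurableI; first by apply: sub_sigma_algebra; exists b.
apply: fin_bigcap_measurable => // i _; apply: measurableC.
by apply: sub_sigma_algebra; eexists.
Qed.

(** The measure lives on the unit cube: a negative bound misses the cube, and a bound above 1 acts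
    as 1. *)
Lemma density_measure_quadrant (F : ('I_m -> R) -> R) (c : ('I_m -> R) -> R)
    (mc : measurable_fun setT (c : T -> R)) (c0 : forall t, (0 <= c t)%R) x :
  (forall x, cube x -> (F x)%:E = boxint x (fun t => (c t)%:E)) ->
  density_measure mc c0 (quadrant x) =
  if [exists i, x i < 0]%R then 0 else (F (fun i => Num.min (x i) 1%R))%:E.
Proof.
move=> hF; case: ifPn => [/existsP[i xi]|/existsPn xn].
  rewrite /density_measure -[RHS](@iint0 R m (enum 'I_m) (fun=> 1%R) (fun=> 1%R)).
  apply: cubeint_eq => t ct; rewrite /einds indicE memNset ?mule0//= => /(_ i).
  by apply/negP; rewrite -ltNge (lt_le_trans xi)//; case/andP : (ct i).
have x01 : cube (fun i => Num.min (x i) 1%R).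
  by move=> i; rewrite ge_min lexx orbT andbT le_min ler01 leNgt xn.
rewrite (hF _ x01) boxint_restrict//; apply: cubeint_eq => t ct.
rewrite /einds indicE; case: ifPn => [/forallP h|/forallP h].
  rewrite mem_set ?mule1// => i; have := h i; rewrite le_min => /andP[]//.
rewrite memNset ?mule0// => q; apply: h => i; rewrite le_min q/=.
by case/andP : (ct i).
Qed.

Lemma density_measure_unique (F : ('I_m -> R) -> R) (c1 c2 : ('I_m -> R) -> R)
    (mc1 : measurable_fun setT (c1 : T -> R)) (c10 : forall t, (0 <= c1 t)%R)
    (mc2 : measurable_fun setT (c2 : T -> R)) (c20 : forall t, (0 <= c2 t)%R) :
  (forall x, cube x -> (F x)%:E = boxint x (fun t => (c1 t)%:E)) ->
  (forall x, cube x -> (F x)%:E = boxint x (fun t => (c2 t)%:E)) ->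
  forall A, measurable A -> density_measure mc1 c10 A = density_measure mc2 c20 A.
Proof.
move=> F1 F2 A mA.
apply: (measure_unique [set quadrant x | x in setT] (fun k => quadrant (fun=> k%:R))) => //.
- exact: measurable_quadrants.
- move=> _ _ [x _ <-] [y _ <-]; exists (fun i => Num.min (x i) (y i)) => //.
  apply/seteqP; split=> [t h|t [h1 h2] i]; last by rewrite le_min h1 h2.
  by split=> i; have := h i; rewrite le_min => /andP[].
- rewrite -subTset => t _; exists (Num.truncn (\sum_j `|t j|)%R).+1 => // i.
  apply/ltW; apply: le_lt_trans (truncnS_gt _); apply: le_trans (ler_norm _) _.
  by rewrite (bigD1 i)//= lerDl; apply: sumr_ge0.
- move=> _ [x _ <-]; apply: etrans (esym (density_measure_quadrant mc2 c20 x F2)).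
  exact: density_measure_quadrant.
- move=> k; rewrite [ltLHS](density_measure_quadrant mc1 c10 (fun=> k%:R%R) F1).
  by case: ifP => _; rewrite ltry.
Qed.

End Box_integral.

(** * Null sets *)

Section Null_sets.
Variables (R : realType) (m : nat).
Local Notation T := (boxT R m).
Implicit Types (x t : 'I_m -> R) (f g : T -> \bar R) (A : set T).
Local Open Scope ereal_scope.

Lemma borel_funP (c : ('I_m -> R) -> R) :
  borel_fun c <-> measurable_fun setT (c : T -> R).
Proof.
split=> [bc|mc a]; last by have := mc measurableT _ (measurable_itv `]a, +oo[); rewrite setTI.
apply: (measurability (@measurable_realfun.RGenOInfty.G R)) => [|/= _ [_] [r] -> <-].
  exact: measurable_realfun.RGenOInfty.measurableE.
by rewrite setTI; exact: bc.
Qed.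

Lemma cubeint_ge0 f : (forall t, 0 <= f t) -> 0 <= cubeint f.
Proof. exact: iint_ge0. Qed.

Lemma le_cubeint f g : measurable_fun setT f -> measurable_fun setT g ->
  (forall t, 0 <= f t) -> (forall t, f t <= g t) -> cubeint f <= cubeint g.
Proof. exact: le_iint. Qed.

Lemma cubeint_cst1 : cubeint (fun _ : T => 1) = 1.
Proof.
suff main s t : iint s (fun=> 1%R) (fun _ : T => 1) t = 1 by exact: main.
elim: s t => [//|i s IH] t /=; rewrite (eq_integral (cst 1)) => [|u _]; last exact: IH.
by rewrite integral_cst//= lebesgue_measure_itv/= lte_fin ltr01 mul1e oppr0 adde0.
Qed.

Lemma measurable_cube : measurable (@cube R m : set T).
Proof.
have -> : @cube R m = \bigcap_(i in [set: 'I_m]) ((fun t : T => t i) @^-1` `[0%R, 1%R]%classic).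
  by apply/seteqP; split=> t /= h => [i _|i]; have := h i; rewrite /= in_itv//=; exact.
apply: fin_bigcap_measurable => // i _.
rewrite -[X in measurable X]setTI; apply: measurable_coord => //.
Qed.

Lemma cubeint_cube : cubeint (einds (@cube R m)) = 1.
Proof.
rewrite -[RHS]cubeint_cst1; apply: cubeint_eq => t ct.
by rewrite /einds indicE mem_set.
Qed.

Lemma cubeint_bigcup_eq0 (F : (set T)^nat) : (forall k, measurable (F k)) ->
  (forall k, cubeint (einds (F k)) = 0) -> cubeint (einds (\bigcup_k F k)) = 0.
Proof.
move=> mF F0; apply/eqP; rewrite -cube_measureE eq_le measure_ge0 andbT.
apply: le_trans (generalized_Boole_inequality _ mF _) _; first exact: bigcupT_measurable.
rewrite (eq_eseriesr (g := fun=> 0)); last by move=> k _; exact: (etrans (cube_measureE _) (F0 k)).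
by rewrite eseries0.
Qed.

Lemma le_cubeint_einds A B : measurable A -> measurable B -> A `<=` B ->
  cubeint (einds A) <= cubeint (einds B).
Proof.
move=> mA mB AB; rewrite -!cube_measureE.
by apply: le_measure; rewrite ?inE.
Qed.

(** On [F k] the densities differ by at least [1 / (k + 1)], so the two integrals over [F k] differ
    by at least that fraction of its volume. They are equal and finite, hence the volume is 0, and
    the sets [F k] exhaust [N]. *)
Let density_lt_null (c1 c2 : T -> R) (mc1 : measurable_fun setT c1)
    (c10 : forall t, (0 <= c1 t)%R)
    (mc2 : measurable_fun setT c2) (c20 : forall t, (0 <= c2 t)%R) :
  (forall A, measurable A -> density_measure mc1 c10 A = density_measure mc2 c20 A) ->
  cubeint (fun t => (c2 t)%:E) < +oo ->
  let N := [set t | (c2 t < c1 t)%R] in measurable N /\ cubeint (einds N) = 0.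
Proof.
move=> c12 foo N.
pose F k := [set t | (c2 t + k.+1%:R^-1 < c1 t)%R].
have mF k : measurable (F k).
  have := @measurable_fun_ltr _ T R setT (fun t => c2 t + k.+1%:R^-1)%R c1.
  move=> /(_ _ mc1 measurableT [set true] I); rewrite setTI; apply.
  by apply: measurable_funD.
have NE : N = \bigcup_k F k.
  apply/seteqP; split=> [t /= ct|t [k _] /=]; last first.
    by rewrite /N/=; apply: lt_trans; rewrite ltrDl invr_gt0.
  have d0 : (0 < c1 t - c2 t)%R by rewrite subr_gt0.
  exists (Num.truncn (c1 t - c2 t)^-1) => //=.
  by rewrite /F/= -ltrBrDl invf_plt ?posrE// truncnS_gt.
split; first by rewrite NE; exact: bigcupT_measurable.
rewrite NE; apply: cubeint_bigcup_eq0 => // k.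
have mE := measurable_einds (mF k).
have k0 : (0 <= k.+1%:R^-1 :> R)%R by rewrite invr_ge0.
have ge : k.+1%:R^-1%:E * cubeint (einds (F k)) + cubeint (fun t => (c2 t)%:E * einds (F k) t)
    <= cubeint (fun t => (c1 t)%:E * einds (F k) t).
  rewrite /cubeint /boxint -iintZ//; last exact: einds_ge0.
  rewrite -iintD//.
  - apply: le_iint.
    + apply: emeasurable_funD; last exact: measurable_mul_einds.
      exact: emeasurable_funM.
    + exact: measurable_mul_einds.
    + by move=> t; rewrite adde_ge0// ?mul_einds_ge0// mule_ge0// einds_ge0.
    + move=> t; rewrite /einds indicE; case: (boolP (t \in F k)) => [/set_mem/= tF|_].
        by rewrite !mule1 -EFinD lee_fin addrC ltW.
      by rewrite !mule0 adde0.
  - exact: emeasurable_funM.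
  - exact: measurable_mul_einds.
  - by move=> t; rewrite mule_ge0// einds_ge0.
  - by move=> t; exact: mul_einds_ge0.
have fin : cubeint (fun t => (c2 t)%:E * einds (F k) t) \is a fin_num.
  rewrite ge0_fin_numE; last by apply: cubeint_ge0 => t; exact: mul_einds_ge0.
  apply: le_lt_trans foo; apply: le_cubeint.
  - exact: measurable_mul_einds.
  - exact/measurable_EFinP.
  - by move=> t; exact: mul_einds_ge0.
  - move=> t; rewrite /einds indicE; case: (_ \in _); first by rewrite mule1.
    by rewrite mule0 lee_fin.
have E := c12 _ (mF k); rewrite /density_measure in E.
rewrite E -[X in _ <= X]add0e leeD2rE// in ge.
apply/eqP; rewrite eq_le cubeint_ge0 ?andbT; last by move=> t; exact: einds_ge0.
by move: ge; rewrite pmule_rle0// lte_fin invr_gt0.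
Qed.

Lemma density_ae_unique (F c1 c2 : ('I_m -> R) -> R) :
  is_density F c1 -> is_density F c2 ->
  exists N : set T, [/\ measurable N, cubeint (einds N) = 0 &
    forall x, ~ N x -> c1 x = c2 x].
Proof.
move=> [/borel_funP mc1 c10 F1] [/borel_funP mc2 c20 F2].
have one : cube (fun _ : 'I_m => 1%R : R) by move=> i; rewrite ler01 lexx.
have fin1 : cubeint (fun t => (c1 t)%:E) < +oo by rewrite /cubeint -F1// ltry.
have fin2 : cubeint (fun t => (c2 t)%:E) < +oo by rewrite /cubeint -F2// ltry.
have [mN1 N10] := density_lt_null (density_measure_unique mc1 c10 mc2 c20 F1 F2) fin2.
have [mN2 N20] := density_lt_null (density_measure_unique mc2 c20 mc1 c10 F2 F1) fin1.
set N1 := [set _ | _] in mN1 N10; set N2 := [set _ | _] in mN2 N20.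
exists (N1 `|` N2); split; first exact: measurableU.
  rewrite -bigcup2E; apply: cubeint_bigcup_eq0 => -[|[|k]] //=.
  rewrite -[RHS](@iint0 R m (enum 'I_m) (fun=> 1%R) (fun=> 1%R)).
  by apply: cubeint_eq => t _; rewrite /einds indic0.
move=> x nx; apply/eqP; rewrite eq_le !leNgt; apply/andP; split; apply/negP => lt; apply: nx.
  by left.
by right.
Qed.

(* The covering volume: [mu_ext] applied to it is the outer Lebesgue measure. *)
Definition cover_volume A : \bar R :=
  ereal_inf [set (\prod_i (ab.2 i - ab.1 i))%:E | ab in
    [set ab : (('I_m -> R) * ('I_m -> R))%type |
      (forall i, ab.1 i <= ab.2 i)%R /\ A `<=` ccbox ab.1 ab.2]].

Lemma cover_volume_ge0 A : 0 <= cover_volume A.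
Proof.
apply: le_ereal_inf_tmp => _ [[a b] [/= ab _] <-]; rewrite lee_fin.
by apply: prodr_ge0 => i _; rewrite subr_ge0.
Qed.

Lemma measurable_ccbox (a b : 'I_m -> R) : measurable (ccbox a b : set T).
Proof.
have -> : ccbox a b = \bigcap_(i in [set: 'I_m]) ((fun t : T => t i) @^-1` `[a i, b i]%classic).
  by apply/seteqP; split=> t /= h => [i _|i]; have := h i; rewrite /= in_itv//=; exact.
apply: fin_bigcap_measurable => // i _.
by rewrite -[X in measurable X]setTI; apply: measurable_coord.
Qed.

(** Only an inequality, since the box may stick out of the unit cube. *)
Lemma cube_measure_ccbox (a b : 'I_m -> R) : (forall i, a i <= b i)%R ->
  cubeint (einds (ccbox a b)) <= (\prod_i (b i - a i))%:E.
Proof.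
move=> ab.
have mcc := measurable_ccbox a b.
have main s t : uniq s -> iint s (fun=> 1%R) (einds (ccbox a b)) t <=
    (\prod_(i <- s) (b i - a i))%:E.
  elim: s t => [|i s IH] t /=.
    by rewrite big_nil /einds indicE; case: (_ \in _).
  move=> /andP[si us]; rewrite big_cons.
  pose P := (\prod_(j <- s) (b j - a j))%R.
  have P0 : (0 <= P)%R by apply: prodr_ge0 => j _; rewrite subr_ge0.
  apply: (@le_trans _ _ (\int[lebesgue_measure]_(u in `[0%R, 1%R]) (P * \1_(`[a i, b i]) u)%:E)).
    apply: ge0_le_integral => //.
    - by move=> u _; apply: iint_ge0 => t'; exact: einds_ge0.
    - apply: measurable_funTS; apply: measurable_iint_upd; last exact: einds_ge0.
      exact: measurable_einds.
    - apply/measurable_EFinP; apply: measurable_funM => //.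
    - move=> u _; rewrite indicE.
      have [uab|uab] := boolP (u \in _); first by rewrite mulr1; exact: IH.
      rewrite mulr0; suff -> : iint s (fun=> 1%R) (einds (ccbox a b)) (upd t i u) = 0 by [].
      rewrite -[RHS](@iint0 R m s (fun=> 1%R) (upd t i u)).
      apply: iint_eq => t' _ /(_ i si) ti.
      rewrite /einds indicE memNset// => /(_ i); rewrite ti /upd eqxx => h.
      by move/negP: uab; apply; rewrite inE/= in_itv.
  under eq_integral do rewrite EFinM.
  rewrite ge0_integralZl_EFin//; last first.
    by apply/measurable_EFinP; exact: measurable_indic.
  rewrite integral_indic// mulrC EFinM lee_wpmul2l//.
  apply: le_trans (le_measure _ _ _ (@subIsetl _ _ _)) _; rewrite ?inE//.
    exact: measurableI.
  rewrite /= lebesgue_measure_itv/= lte_fin; case: ifPn => // _.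
  by rewrite lee_fin subr_ge0.
by rewrite /cubeint /boxint (le_trans (main _ _ (enum_uniq _)))// big_enum.
Qed.

Lemma cubeint_le_cover_volume A : measurable A -> cubeint (einds A) <= cover_volume A.
Proof.
move=> mA; apply: le_ereal_inf_tmp => _ [[a b] [/= ab Aab] <-].
apply: le_trans (cube_measure_ccbox ab).
apply: le_cubeint_einds => //; exact: measurable_ccbox.
Qed.

End Null_sets.

(** * From vanishing iterated integrals to coverings by boxes *)

Section Outer_measure.
Variables (R : realType) (m : nat).
Local Notation T := (boxT R m.+1).
Implicit Types (A : set T).
Local Open Scope ereal_scope.

(** The dimension is [m.+1] because in dimension 0 the empty product would give the empty set volume
    1. *)
Definition outer_volume : set T -> \bar R := mu_ext (@cover_volume R m.+1).

Let cv0 : cover_volume (set0 : set T) = 0.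
Proof.
apply/eqP; rewrite eq_le cover_volume_ge0 andbT; apply: ereal_inf_lbound.
exists (fun=> 0%R, fun=> 0%R) => /=; first by split => // t.
by rewrite subr0 big_ord_recl mul0r.
Qed.

Let cv_ge0 A : 0 <= cover_volume A.
Proof. exact: cover_volume_ge0. Qed.

HB.instance Definition _ := isOuterMeasure.Build R T outer_volume
  (mu_ext0 cv0 cv_ge0) (mu_ext_ge0 cv_ge0) (le_mu_ext _) (mu_ext_sigma_subadditive cv_ge0).

Let cover_volume_halfspace (i : 'I_m.+1) (c : R) A :
  cover_volume (A `&` [set t : T | (t i <= c)%R]) +
  cover_volume (A `&` ~` [set t : T | (t i <= c)%R]) <= cover_volume A.
Proof.
apply: le_ereal_inf_tmp => _ [[a b] [/= ab Aab] <-].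
(* The cutting position [c] is clamped to the side [[a i, b i]], so that both pieces are boxes even
   when the hyperplane misses the box; their volumes add up exactly. *)
pose e := Num.max (a i) (Num.min (b i) c).
have ae : (a i <= e)%R by rewrite le_max lexx.
have eb : (e <= b i)%R by rewrite ge_max ab ge_min lexx.
pose b' := upd b i e; pose a' := upd a i e.
have E : (\prod_j (b j - a j) = \prod_j (b' j - a j) + \prod_j (b j - a' j))%R.
  rewrite (bigD1 i)//= [X in _ = (X + _)%R](bigD1 i)//= [X in _ = (_ + X)%R](bigD1 i)//=.
  rewrite /b' /a' /upd eqxx.
  rewrite [X in _ = (_ * X + _)%R](eq_bigr (fun j => b j - a j)%R); last first.
    by move=> j /negbTE ->.
  rewrite [X in _ = (_ + _ * X)%R](eq_bigr (fun j => b j - a j)%R); last first.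
    by move=> j /negbTE ->.
  by rewrite -mulrDl; congr (_ * _)%R; ring.
rewrite E EFinD; apply: leeD; apply: ereal_inf_lbound.
- exists (a, b') => //; split=> [j|t [At /= tc] j] /=.
    by rewrite /b' /upd; case: eqVneq => [->|].
  have /andP[h1 h2] := Aab t At j; rewrite h1 /b' /upd; case: eqVneq => // ji.
  by rewrite -ji in tc; rewrite /e -ji le_max le_min h2 tc orbT.
- exists (a', b) => //; split=> [j|t [At /= /negP tc] j] /=.
    by rewrite /a' /upd; case: eqVneq => [->|].
  have /andP[h1 h2] := Aab t At j; rewrite h2 andbT /a' /upd; case: eqVneq => // ji.
  by rewrite -ji -ltNge in tc; rewrite /e -ji ge_max h1 ge_min (ltW tc) orbT.
Qed.

(** Any cover of [X] splits along the hyperplane into covers of both parts of [X], and by the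
    one-box computation no volume is gained. *)
Lemma halfspace_caratheodory (i : 'I_m.+1) (c : R) :
  outer_volume.-caratheodory [set t : T | (t i <= c)%R].
Proof.
have mH : measurable [set t : T | (t i <= c)%R].
  have -> : [set t : T | (t i <= c)%R] = (fun t : T => t i) @^-1` `]-oo, c]%classic.
    by apply/seteqP; split=> t /=; rewrite in_itv.
  by rewrite -[X in measurable X]setTI; apply: measurable_coord.
apply: le_caratheodory_measurable => X.
apply: le_ereal_inf_tmp => _ [F [mF XF] <-].
set H := [set t : T | _] in mH *.
apply: (@le_trans _ _ (\sum_(k <oo) cover_volume (F k `&` H) +
    \sum_(k <oo) cover_volume (F k `&` ~` H))).
  apply: leeD; apply: ereal_inf_lbound; eexists => //; split=> [k|].
  - exact: measurableI.
  - by rewrite -setI_bigcupl; exact: setSI.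
  - by apply: measurableI => //; exact: measurableC.
  - by rewrite -setI_bigcupl; exact: setSI.
rewrite -nneseriesD//; apply: lee_nneseries => [k _ _|k _].
  by rewrite adde_ge0.
exact: cover_volume_halfspace.
Qed.

Lemma measurable_caratheodory A : measurable A -> outer_volume.-caratheodory A.
Proof.
have sC := @sigma_algebra_measurable _ (caratheodory_type outer_volume).
suff : (@measurable _ T) `<=` (@measurable _ (caratheodory_type outer_volume)) by exact.
rewrite measurable_quadrants; apply: smallest_sub => // _ [x _ <-].
have -> : quadrant x = \bigcap_(i in [set: 'I_m.+1]) [set t : T | (t i <= x i)%R].
  by apply/seteqP; split=> t /= h i; have := h i; [|exact].
apply: (@fin_bigcap_measurable _ (caratheodory_type outer_volume)) => // i _.
exact: halfspace_caratheodory.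
Qed.

Lemma cubeint_le_outer_volume A : measurable A -> cubeint (einds A) <= outer_volume A.
Proof.
move=> mA; apply: le_ereal_inf_tmp => _ [F [mF AF] <-].
have mUF : measurable (\bigcup_k F k) by exact: bigcupT_measurable.
apply: le_trans (le_cubeint_einds mA mUF AF) _.
rewrite -cube_measureE; apply: le_trans (generalized_Boole_inequality _ mF mUF) _.
apply: lee_nneseries => // k _; apply: le_trans (cubeint_le_cover_volume (mF k)).
by rewrite -cube_measureE.
Qed.

Lemma outer_volume_cube : outer_volume (@cube R m.+1) <= 1.
Proof.
pose F k : set T := if k is 0%N then @cube R m.+1 else set0.
apply: (@le_trans _ _ (\sum_(k <oo) cover_volume (F k))).
  apply: ereal_inf_lbound; exists F => //; split=> [[|k]|t ct]; last by exists 0%N.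
    exact: measurable_cube.
  exact: measurable0.
rewrite nneseries_recl//= eseries_cond/= eseries0 ?adde0; last first.
  by move=> [|k]//= _ _.
apply: ereal_inf_lbound; exists (fun=> 0%R, fun=> 1%R) => /=; first by split.
by rewrite subr0 big1.
Qed.

(* [mu A + mu (cube \ A) <= mu cube <= 1 = lambda (cube \ A) <= mu (cube \ A)]. *)
Lemma outer_volume_eq0 A : measurable A -> A `<=` @cube R m.+1 ->
  cubeint (einds A) = 0 -> outer_volume A = 0.
Proof.
move=> mA Ac A0; have mc := @measurable_cube R m.+1.
have mD : measurable ((@cube R m.+1 : set T) `\` A) by exact: measurableD.
have := measurable_caratheodory mA (@cube R m.+1).
rewrite setIidr//= -setDE => E.
have h1 : 1 <= outer_volume ((@cube R m.+1 : set T) `\` A).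
  apply: le_trans (cubeint_le_outer_volume mD).
  have dis : A `&` ((@cube R m.+1 : set T) `\` A) = set0.
    by rewrite setDE setICA setICr setI0.
  have : cubeint (einds (@cube R m.+1)) =
      cubeint (einds A) + cubeint (einds ((@cube R m.+1 : set T) `\` A)).
    rewrite -!cube_measureE; have := measureU (@cube_measure R m.+1) mA mD dis.
    by rewrite setDUK.
  by rewrite A0 add0e cubeint_cube => <-.
have h2 := outer_volume_cube; rewrite E in h2.
have o0 : 0 <= outer_volume A by exact: outer_measure_ge0.
apply/eqP; rewrite eq_le o0 andbT.
have fA : outer_volume A \is a fin_num.
  rewrite ge0_fin_numE//; apply: le_lt_trans (ltry 1); apply: le_trans h2.
  by rewrite leeDl// outer_measure_ge0.
have := le_trans (leeD2l (outer_volume A) h1) h2.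
by rewrite -[leRHS]add0e leeD2rE.
Qed.

(** The outer measure covers [A] by sets of total covering volume below [e / 2]; replacing the
    [k]-th set by one box costs at most [e / 2 / 2 ^ k.+1], for a total below [e]. *)
Lemma cubeint0_lebesgue_null A : measurable A -> A `<=` @cube R m.+1 ->
  cubeint (einds A) = 0 -> lebesgue_null A.
Proof.
move=> mA Ac /(outer_volume_eq0 mA Ac) A0 e e0.
have e2 : (0 < e / 2)%R by rewrite divr_gt0.
have : outer_volume A < (e / 2)%:E by rewrite A0 lte_fin.
move=> /ereal_inf_lt[_ [F [mF AF] <-] Fe].
have Foo k : cover_volume (F k) \is a fin_num.
  rewrite ge0_fin_numE//; apply: le_lt_trans (ltry (e / 2)); apply: le_trans (ltW Fe).
  by rewrite (nneseriesD1 (n := k))// leeDl// nneseries_ge0.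
have /choice[ab hab] k : exists ab : (('I_m.+1 -> R) * ('I_m.+1 -> R))%type,
    [/\ (forall i, ab.1 i <= ab.2 i)%R, F k `<=` ccbox ab.1 ab.2 &
      (\prod_i (ab.2 i - ab.1 i))%:E <= cover_volume (F k) + (e / 2 / (2 ^ k.+1)%:R)%:E].
  have ek : (0 < e / 2 / (2 ^ k.+1)%:R)%R by rewrite divr_gt0// ltr0n expn_gt0.
  have [_ [ab [h1 h2] <-] h3] := lb_ereal_inf_adherent ek (Foo k).
  by exists ab; split => //; exact: ltW.
exists (fun k => (ab k).1), (fun k => (ab k).2); split.
- by move=> k i; case: (hab k).
- by move=> t /AF[k _ Fkt]; exists k => //; case: (hab k) => _ + _; exact.
- apply: le_lt_trans (_ : _ <= \sum_(k <oo) cover_volume (F k) + (e / 2)%:E) _.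
    apply: le_trans (epsilon_trick _ _ (ltW e2)); last by [].
    apply: lee_nneseries => [k _ _|k _]; last by case: (hab k).
    rewrite lee_fin; apply: prodr_ge0 => i _; rewrite subr_ge0; by case: (hab k).
  by rewrite [in ltRHS](splitr e) EFinD lteD2rE.
Qed.

End Outer_measure.

(** * Densities of the margins *)

Section Copula_density.
Variables (R : realType) (psi : R -> R) (d : nat).
Hypothesis gen : Car_generator d psi.
Variable m : nat.
Hypotheses (m0 : (0 < m)%N) (md : (m <= d - 1)%N) (d2 : (2 <= d)%N).
Local Notation T := (boxT R m).
Implicit Types (x t : 'I_m -> R) (s : seq 'I_m).

Definition open_cube_pred t := [forall i, 0 < t i < 1].

(** [sleft psi m.-1] has order [m], hence the predecessor. The value 0 on the faces avoids infinite
    [phi psi 0] and derivatives of [psi] at 0. *)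
Definition cop_density t : R :=
  if open_cube_pred t then
    sleft psi m.-1 (\sum_i phir psi (t i)) * \prod_i dphi psi (t i)
  else 0.

Let m1d : (m.-1 <= d - 2)%N.
Proof. by move: m0 md d2; lia. Qed.

Lemma sum_phir_gt0 t : open_cube_pred t -> 0 < \sum_i phir psi (t i).
Proof.
move=> /forallP t01; rewrite (bigD1 (Ordinal m0))//= ltr_wpDr//.
  by apply: sumr_ge0 => i _; apply/ltW/(phir_gt0 gen).
exact: (phir_gt0 gen).
Qed.

Lemma cop_density_ge0 t : 0 <= cop_density t.
Proof.
rewrite /cop_density; case: ifPn => // t01; rewrite mulr_ge0//.
  by apply: (sleft_ge0 gen) => //; exact: sum_phir_gt0.
by apply: prodr_ge0 => i _; apply/ltW/(dphi_gt0 gen)/(forallP t01).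
Qed.

Lemma measurable_open_cube_pred : measurable_fun setT (open_cube_pred : T -> bool).
Proof.
apply: (measurable_fun_bool true); rewrite setTI.
have -> : open_cube_pred @^-1` [set true] =
    \bigcap_(i in [set: 'I_m]) ((fun t : T => t i) @^-1` `]0, 1[%classic).
  apply/seteqP; split=> t /= => [/forallP h i _|h]; first by rewrite /= in_itv/=; exact: h.
  by apply/forallP => i; have := h i I; rewrite /= in_itv.
apply: fin_bigcap_measurable => // i _.
by rewrite -[X in measurable X]setTI; apply: measurable_coord.
Qed.

Let E : set T := setT `&` open_cube_pred @^-1` [set true].

Let measurable_coord_comp (h : R -> R) i : measurable_fun `](0 : R), 1[ h ->
  measurable_fun E (fun t : T => h (t i)).
Proof.
move=> mh; apply: (measurable_comp (F := `](0 : R), 1[) _ _ mh) => //.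
  by move=> _ [t [_ /= /forallP/(_ i) h'] <-]; rewrite /= in_itv.
by apply: measurable_funTS; exact: measurable_coord.
Qed.

Lemma measurable_sum_phir : measurable_fun E (fun t : T => \sum_i phir psi (t i)).
Proof.
apply: measurable_sum => i; apply: measurable_coord_comp; exact: (measurable_phir gen).
Qed.

Lemma measurable_cop_density : measurable_fun setT (cop_density : T -> R).
Proof.
apply: measurable_fun_if => //; first exact: measurable_open_cube_pred.
rewrite -/E; apply: measurable_funM.
  apply: (measurable_comp (F := `](0 : R), +oo[) _ _ (measurable_sleft gen m1d)) => //.
    by move=> _ [t [_ /= /sum_phir_gt0 h] <-]; rewrite /= in_itv/= h.
  exact: measurable_sum_phir.
apply: measurable_prod => i _; apply: measurable_coord_comp; exact: (measurable_dphi gen).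
Qed.

(** The signed derivative of order [k], taken from the left at [k = m] because for [m = d - 1] the
    derivative of that order may not exist. *)
Let level (k : nat) z : R := if k == m then sleft psi m.-1 z else sder psi k z.

Let level_sleft k z : (k < m)%N -> 0 < z -> level k.+1 z = sleft psi k z.
Proof.
rewrite /level => km z0; case: eqVneq => [<-//|kSm].
by rewrite (sleftE gen)//; move: km kSm md; lia.
Qed.

Lemma iint_cop_density_out s x t : [exists i, (i \notin s) && ~~ (0 < t i < 1)] ->
  iint s x (fun t => (cop_density t)%:E) t = 0%E.
Proof.
move=> /existsP[i /andP[si ti]]; rewrite -[RHS](@iint0 R m s x t).
apply: iint_eq => t' _ /(_ i si) t'i; rewrite /cop_density ifF//.
by apply/negP => /forallP/(_ i); rewrite t'i; apply/negP.
Qed.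

(** Each integration consumes one factor [dphi] and lowers the order of the derivative by one;
    integrated coordinates sit at their upper bounds [x i], the others are still free in the open
    interval. *)
Lemma iint_cop_density s x t : uniq s -> cube x -> (forall i, i \notin s -> 0 < t i < 1) ->
  iint s x (fun t => (cop_density t)%:E) t =
  (if has (fun i => x i == 0) s then 0 else
     level (m - size s)%N (\sum_i phir psi (if i \in s then x i else t i)) *
     \prod_(i | i \notin s) dphi psi (t i))%:E.
Proof.
move=> + x01; elim: s t => [|i s IH] t /=.
  move=> _ t01; rewrite /cop_density ifT; last by apply/forallP => i; exact: t01.
  by rewrite subn0 /level eqxx.
move=> /andP[si us] t01.
set k := (m - (size s).+1)%N.
have sm : ((size s).+1 <= m)%N.
  have := max_card (mem (i :: s)); rewrite card_ord.
  by have /card_uniqP -> : uniq (i :: s) by rewrite /= si.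
have km : (k < m)%N by rewrite /k; lia.
have kS : (m - size s = k.+1)%N by rewrite /k; lia.
have kd : (k <= d - 2)%N by lia.
have [hs|/hasPn hs] := boolP (has (fun i => x i == 0) s).
  rewrite orbT; apply: integral0_eq => u _.
  have [u01|u01] := boolP (0 < u < 1); last first.
    apply: iint_cop_density_out; apply/existsP; exists i.
    by rewrite si /upd eqxx.
  rewrite IH ?hs// => j js; rewrite /upd; case: eqVneq => // ji.
  by apply: t01; rewrite inE negb_or ji.
rewrite orbF.
pose S := \sum_(j | j != i) phir psi (if j \in i :: s then x j else t j).
pose P := \prod_(j | j \notin i :: s) dphi psi (t j).
have yI j : j != i -> 0 < (if j \in i :: s then x j else t j) <= 1.
  move=> ji; case: ifPn => [|js].
    rewrite inE (negbTE ji)/= => js; have /andP[xj ->] := x01 j.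
    by rewrite andbT lt_neqAle eq_sym hs.
  by have /andP[-> /ltW ->] := t01 j js.
have S0 : 0 <= S by apply: sumr_ge0 => j ji; apply: (phir_ge0 gen); exact: yI.
(* As long as [k > 0], some coordinate outside [i :: s] is free in the open unit interval and
   contributes a positive term to [S]. *)
have kS0 : k = 0%N \/ 0 < S.
  have [->|k0] := posnP k; [by left|right].
  have /existsP[l ls] : [exists l, l \notin i :: s].
    apply: contrapT => /negP; rewrite negb_exists => /forallP h.
    have : #|i :: s| = m.
      by rewrite -[RHS]card_ord; apply: eq_card => j; have := h j; rewrite negbK => ->.
    have /card_uniqP -> : uniq (i :: s) by rewrite /= si.
    by rewrite /=; move: k0; rewrite /k; lia.
  have li : l != i by apply: contraNneq ls => ->; rewrite mem_head.
  rewrite /S (bigD1 l)//= ltr_wpDr//.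
    by apply: sumr_ge0 => j /andP[ji _]; apply: (phir_ge0 gen); exact: yI.
  by rewrite (negbTE ls); apply: (phir_gt0 gen); exact: t01.
transitivity (\int[lebesgue_measure]_(u in `[0%R, x i])
    (P%:E * (if 0 < u < 1 then sleft psi k (S + phir psi u) * dphi psi u else 0)%:E))%E.
  apply: eq_integral => u _; case: ifPn => u01; last first.
    rewrite mule0; apply: iint_cop_density_out; apply/existsP; exists i.
    by rewrite si /upd eqxx.
  rewrite IH//; last first.
    move=> j js; rewrite /upd; case: eqVneq => // ji.
    by apply: t01; rewrite inE negb_or ji.
  rewrite ifF; last by apply/negbTE/hasPn.
  rewrite kS -EFinM; congr EFin.
  have -> : \sum_j phir psi (if j \in s then x j else upd t i u j) = S + phir psi u.
    rewrite (bigD1 i)//= (negbTE si) /upd eqxx addrC; congr (_ + _).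
    by apply: eq_bigr => j ji; rewrite inE (negbTE ji).
  have -> : \prod_(j | j \notin s) dphi psi (upd t i u j) = P * dphi psi u.
    rewrite (bigD1 i)//= {1}/upd eqxx mulrC; congr (_ * _).
    apply: eq_big => j; first by rewrite inE negb_or andbC.
    by move=> /andP[_ /negbTE ji]; rewrite /upd ji.
  rewrite level_sleft//; last by rewrite ltr_wpDl// (phir_gt0 gen).
  by rewrite mulrCA.
have mf : measurable_fun `[0%R, x i] (fun u : R =>
    (if 0 < u < 1 then sleft psi k (S + phir psi u) * dphi psi u else 0)%:E).
  apply/measurable_EFinP/measurable_funTS.
  have -> : (fun u : R => if 0 < u < 1 then sleft psi k (S + phir psi u) * dphi psi u else 0) =
      (fun u => sleft psi k (S + phir psi u) * dphi psi u) \_ `]0, 1[%classic.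
    by apply/funext => u; rewrite patchE mem_setE in_itv.
  apply/(measurable_restrictT _ (measurable_itv _)).
  by apply: measurable_funM; [exact: (measurable_sleft_phir gen)|exact: (measurable_dphi gen)].
rewrite ge0_integralZl_EFin//; last 2 first.
- move=> u _; rewrite lee_fin; case: ifPn => // u01; rewrite mulr_ge0//.
    by apply: (sleft_ge0 gen) => //; rewrite ltr_wpDl// (phir_gt0 gen).
  exact/ltW/(dphi_gt0 gen).
- by apply: prodr_ge0 => j js; apply/ltW/(dphi_gt0 gen)/t01.
rewrite (integral_sleft_phir gen)//.
rewrite -EFinM; congr EFin; case: ifPn => xi0; first by rewrite mulr0.
rewrite mulrC /level ltn_eqF//; congr (sder _ _ _ * _).
by rewrite [RHS](bigD1 i)//= mem_head addrC.
Qed.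

Lemma margC_density x : cube x ->
  (margC d psi x)%:E = boxint x (fun t => (cop_density t)%:E).
Proof.
move=> x01; rewrite /boxint iint_cop_density ?enum_uniq//; last first.
  by move=> i; rewrite mem_enum.
rewrite (margCE gen); last by move: md; lia.
rewrite (psiE_sum gen)//; congr EFin.
have -> : has (fun i => x i == 0) (enum 'I_m) = [exists i, x i == 0].
  by apply/hasP/existsP => [[i _ xi]|[i xi]]; exists i => //; rewrite mem_enum.
case: ifP => // _.
rewrite size_enum_ord subnn /level ltn_eqF// sder0 [X in _ * X]big1 ?mulr1.
  by congr psi; apply: eq_bigr => i _; rewrite mem_enum.
by move=> i; rewrite mem_enum.
Qed.

Lemma cop_density_is_density : is_density (margC d psi : ('I_m -> R) -> R) cop_density.
Proof.
split; [|exact: cop_density_ge0|exact: margC_density].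
by apply/borel_funP; exact: measurable_cop_density.
Qed.

End Copula_density.

Section Finite_limits.
Variables (R : realType) (I : finType) (F : nat -> I -> R) (G : I -> R).
Hypothesis FG : forall i, F n i @[n --> \oo] --> G i.

Lemma cvg_bigsum : \sum_i F n i @[n --> \oo] --> \sum_i G i.
Proof.
elim: (index_enum I) => [|i r IH].
  by rewrite big_nil; under eq_fun do rewrite big_nil; exact: cvg_cst.
by rewrite big_cons; under eq_fun do rewrite big_cons; exact: cvgD.
Qed.

Lemma cvg_bigprod : \prod_i F n i @[n --> \oo] --> \prod_i G i.
Proof.
elim: (index_enum I) => [|i r IH].
  by rewrite big_nil; under eq_fun do rewrite big_nil; exact: cvg_cst.
by rewrite big_cons; under eq_fun do rewrite big_cons; exact: cvgM.
Qed.

End Finite_limits.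

Lemma limn_einf_ge_near (R : realType) (u : nat -> R) (a e : R) :
  (a%:E <= limn_einf (fun n => (u n)%:E))%E -> 0 < e -> \forall n \near \oo, a - e < u n.
Proof.
move=> au e0; have : ((a - e)%:E < limn_einf (fun n => (u n)%:E))%E.
  by apply: lt_le_trans au; rewrite lte_fin ltrBlDr ltrDl.
rewrite limn_einf_lim (cvg_lim _ (@cvg_einfs_sup _ _))//.
move=> /ereal_sup_gt[_ [n _ <-] h]; exists n => // k /= nk.
rewrite -lte_fin; apply: lt_le_trans h _; apply: ereal_inf_lbound.
by exists k.
Qed.

(** * Exceptional sets and convergence of densities *)

Section Level_sets.
Variables (R : realType) (psi : R -> R) (d : nat).
Hypothesis gen : Car_generator d psi.
Variable m : nat.
Hypotheses (m0 : (0 < m)%N).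
Local Notation T := (boxT R m).

Definition sum_level (Z : set R) : set T :=
  [set t | open_cube_pred t /\ Z (\sum_i phir psi (t i))].

Lemma countable_measurableR (Z : set R) : countable Z -> measurable (Z : set (measurableTypeR R)).
Proof. by move=> cZ; apply: countable_measurable. Qed.

Lemma measurable_sum_level Z : measurable (Z : set (measurableTypeR R)) ->
  measurable (sum_level Z).
Proof.
move=> mZ; have mE : measurable (setT `&` (@open_cube_pred R m : T -> bool) @^-1` [set true]).
  exact: (measurable_open_cube_pred (R := R) (m := m)).
have := measurable_sum_phir gen mE mZ; rewrite setTI.
by congr (measurable _); apply/seteqP; split=> t [].
Qed.

(** With all other coordinates fixed, injectivity of [phir psi] leaves at most one value of the
    innermost variable per element of [Z]. So the innermost integral is already 0. *)
Lemma cubeint_sum_level Z : countable Z -> cubeint (einds (sum_level Z)) = 0%E.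
Proof.
move=> cZ; have mA := measurable_sum_level (countable_measurableR cZ).
rewrite /cubeint /boxint.
have : (0 < size (enum 'I_m))%N by rewrite size_enum_ord.
suff main s t : (0 < size s)%N -> iint s (fun=> 1) (einds (sum_level Z)) t = 0%E by exact: main.
elim: s t => [//|i [|j s] IH] t _; last first.
  by rewrite /=; apply: integral0_eq => u _; exact: IH.
rewrite /=; pose B := [set u : R | sum_level Z (upd t i u)].
have mB : measurable (B : set (measurableTypeR R)).
  by have := @measurable_upd_snd R m t i measurableT _ mA; rewrite setTI.
have cB : countable B.
  have [f injf] := elimT (countable_injP _) cZ.
  apply/countable_injP; exists (fun u => f (\sum_k phir psi (upd t i u k))).
  move=> u v; rewrite !inE => -[/forallP uc uZ] [/forallP vc vZ] /injf.
  rewrite !inE => /(_ uZ vZ); rewrite (bigD1 i)//= [RHS](bigD1 i)//=.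
  have -> : \sum_(k | k != i) phir psi (upd t i u k) = \sum_(k | k != i) phir psi (upd t i v k).
    by apply: eq_bigr => k ki; rewrite /upd (negbTE ki).
  move=> /addIr; have := uc i; have := vc i; rewrite /upd eqxx => v01 u01 e.
  by rewrite -(psi_phir_oo gen u01) e (psi_phir_oo gen v01).
transitivity (\int[lebesgue_measure]_(u in `[0%R, 1%R]) (\1_B u)%:E)%E.
  apply: eq_integral => u _; rewrite /einds !indicE.
  by suff -> : (upd t i u \in sum_level Z) = (u \in B) by []; apply/idP/idP; rewrite !inE.
rewrite integral_indic//; apply/eqP; rewrite eq_le measure_ge0 andbT.
rewrite -(countable_lebesgue_measure0 cB); apply: le_measure; rewrite ?inE//.
exact: measurableI.
Qed.

End Level_sets.

Section Density_convergence.
Variables (R : realType) (d : nat) (psi : R -> R) (psis : nat -> R -> R).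
Hypothesis gen : Car_generator d psi.
Hypothesis gens : forall n, Car_generator d (psis n).
Hypothesis d3 : (3 <= d)%N.

Definition discontinuities k : set R := [set z | 0 < z /\ ~ {for z, continuous (sleft psi k)}].

Lemma countable_discontinuities k : (k <= d - 2)%N -> countable (discontinuities k).
Proof.
by move=> kd; apply: nonincreasing_discontinuities => x y; exact: (sleft_noninc gen).
Qed.

Lemma sum_phir_cvg m (t : 'I_m -> R) : pt_conv psi psis -> open_cube_pred t ->
  \sum_i phir (psis n) (t i) @[n --> \oo] --> \sum_i phir psi (t i).
Proof.
move=> cv /forallP t01; apply: cvg_bigsum => i; apply: (pt_conv_phir gen gens) => //.
by have /andP[-> /ltW ->] := t01 i.
Qed.

(** The factors [dphi] converge everywhere on the open cube because [0 < d - 2] makes [sleft psi 0]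
    continuous; only the outer factor of order [m] can meet a discontinuity. *)
Lemma cop_density_cvg m (t : 'I_m -> R) : pt_conv psi psis -> (0 < m)%N -> (m <= d - 1)%N ->
  ~ sum_level psi (discontinuities m.-1) t ->
  cop_density (psis n) t @[n --> \oo] --> cop_density psi t.
Proof.
move=> cv m0 md nt; rewrite /cop_density; have [t01|_] := boolP (open_cube_pred t); last exact: cvg_cst.
have s0 := sum_phir_gt0 gen m0 t01.
apply: cvgM.
  apply: (sleft_cvg gen gens) => //; [lia|exact: sum_phir_cvg|].
  by apply: contrapT => nc; apply: nt.
apply: cvg_bigprod => i; have ti := forallP t01 i.
apply: cvgV; first by rewrite gt_eqF// (sleft_phir_gt0 gen).
have p0 := phir_gt0 gen ti.
apply: (sleft_cvg gen gens) => //.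
  by apply: (pt_conv_phir gen gens) => //; have /andP[-> /ltW ->] := ti.
by apply: (sleft_continuous gen) => //; lia.
Qed.

Lemma pt_conv_densities : pt_conv psi psis ->
  forall m : nat, (2 <= m <= d - 1)%N ->
  forall (cn : nat -> ('I_m -> R) -> R) (c : ('I_m -> R) -> R),
    (forall n, is_density (margC d (psis n)) (cn n)) ->
    is_density (margC d psi) c ->
    exists N : set ('I_m -> R), lebesgue_null N /\
      forall x, cube x -> ~ N x -> cn n x @[n --> \oo] --> c x.
Proof.
move=> cv [//|m] /andP[m2 md] cn c dn dc.
have d2 : (2 <= d)%N by lia.
have m0 : (0 < m.+1)%N by [].
have [Ac [mAc Ac0 hAc]] := density_ae_unique dc (cop_density_is_density gen m0 md d2).
have /choice[A hA] n := density_ae_unique (dn n) (cop_density_is_density (gens n) m0 md d2).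
have cZ := @countable_discontinuities m ltac:(lia).
pose L := sum_level psi (discontinuities m) : set (boxT R m.+1).
have mL : measurable L := measurable_sum_level gen (countable_measurableR cZ).
have L0 : cubeint (einds L) = 0%E := cubeint_sum_level gen m0 cZ.
(* One countable family gathers the bad level set and the sets where [c] or some [cn n] differs from
   the explicit density. Intersecting with the cube is harmless and necessary, as [cubeint] sees
   only the cube. *)
pose B k : set (boxT R m.+1) := if k is k'.+1 then if k' is k''.+1 then A k'' else Ac else L.
have mB k : measurable (B k) by case: k => [|[|k]] //=; case: (hA k).
have B0 k : cubeint (einds (B k)) = 0%E by case: k => [|[|k]] //=; case: (hA k).
pose N := (\bigcup_k B k) `&` @cube R m.+1 : set (boxT R m.+1).
have mU : measurable (\bigcup_k B k) by exact: bigcupT_measurable.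
have mN : measurable N by apply: measurableI => //; exact: measurable_cube.
exists N; split.
  apply: cubeint0_lebesgue_null => //; first by move=> t [].
  apply: le_anti; apply/andP; split; last by apply: cubeint_ge0 => t; exact: einds_ge0.
  apply: le_trans (le_cubeint_einds mN mU (@subIsetl _ _ _)) _.
  by rewrite cubeint_bigcup_eq0.
move=> x xc xN; have xB k : ~ B k x by move=> Bx; apply: xN; split => //; exists k.
rewrite (hAc x (xB 1%N)).
have -> : (fun n => cn n x) = (fun n => cop_density (psis n) x).
  by apply/funext => n; have [_ _ h] := hA n; exact: h x (xB n.+2).
exact: cop_density_cvg (xB 0%N).
Qed.

End Density_convergence.

(** * Fatou's lemma for densities *)

Section Scheffe.
Variables (R : realType) (m : nat).
Local Notation T := (boxT R m).
Local Open Scope ereal_scope.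

(** A null set need not be Borel: intersecting covers of volume below [1 / (k + 1)] gives a
    measurable null set containing it. *)
Lemma lebesgue_null_cover (N : set T) : lebesgue_null N ->
  exists N' : set T, [/\ measurable N', N `<=` N' & cubeint (einds N') = 0].
Proof.
move=> nN.
have pos k : (0 < k.+1%:R^-1 :> R)%R by rewrite invr_gt0.
have /choice[ab hab] k : exists ab : (nat -> 'I_m -> R) * (nat -> 'I_m -> R),
    [/\ (forall k i, ab.1 k i <= ab.2 k i)%R, N `<=` \bigcup_k ccbox (ab.1 k) (ab.2 k)
      & (\sum_(0 <= k <oo) (\prod_(i < m) (ab.2 k i - ab.1 k i))%:E < k.+1%:R^-1%:E)%E].
  by have [a [b h]] := nN _ (pos k); exists (a, b).
pose U k : set T := \bigcup_j ccbox ((ab k).1 j) ((ab k).2 j).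
have mcc k j : measurable (ccbox ((ab k).1 j) ((ab k).2 j) : set T) := measurable_ccbox _ _.
have mU k : measurable (U k) by exact: bigcupT_measurable.
have mI : measurable (\bigcap_k U k) by exact: bigcapT_measurable.
exists (\bigcap_k U k); split => //.
  by move=> t Nt k _; case: (hab k) => _ /(_ t Nt).
apply/eqP; rewrite eq_le cubeint_ge0 ?andbT; last by move=> t; exact: einds_ge0.
apply/lee_addgt0Pr => e e0; rewrite add0e.
pose k := Num.truncn e^-1.
have ke : (k.+1%:R^-1 < e)%R by rewrite invf_plt ?posrE// truncnS_gt.
apply: (@le_trans _ _ (cubeint (einds (U k)))).
  by apply: le_cubeint_einds => //; exact: bigcap_inf.
have [ab1 _ ab2] := hab k.
apply: le_trans (_ : _ <= k.+1%:R^-1%:E) _; last by rewrite lee_fin ltW.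
apply: le_trans (ltW ab2).
rewrite -cube_measureE; apply: le_trans (generalized_Boole_inequality _ (mcc k) (mU k)) _.
apply: lee_nneseries => // j _; apply: le_trans (cube_measure_ccbox _); last by [].
by rewrite -cube_measureE.
Qed.

Section Absolute_continuity.
Variable f : T -> R.
Hypotheses (mf : measurable_fun setT f) (f0 : forall t, (0 <= f t)%R).

(** The density may be unbounded, so [A] is cut into the parts where [f <= k], on each of which the
    mass is at most [k] times the volume. *)
Lemma density_measure_null (A : set T) : measurable A -> cubeint (einds A) = 0 ->
  density_measure mf f0 A = 0.
Proof.
move=> mA A0; pose F k := A `&` [set t | (f t <= k%:R)%R].
have mF k : measurable (F k).
  apply: measurableI => //.
  have := @measurable_fun_ler _ T R setT f (cst k%:R) mf (measurable_cst _) measurableT [set true] I.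
  by rewrite setTI.
have AE : A = \bigcup_k F k.
  apply/seteqP; split=> [t At|t [k _ []]//].
  by exists (Num.truncn (f t)).+1 => //; split => //=; exact/ltW/truncnS_gt.
have F0 k : density_measure mf f0 (F k) = 0.
  apply/eqP; rewrite eq_le measure_ge0 andbT /density_measure.
  apply: (@le_trans _ _ (cubeint (fun t => k%:R%:E * einds A t))).
    apply: le_cubeint.
    - exact: measurable_mul_einds.
    - by apply: emeasurable_funM => //; exact: measurable_einds.
    - by move=> t; exact: mul_einds_ge0.
    - move=> t; rewrite /einds !indicE; case: (boolP (t \in F k)) => [|_].
        by rewrite inE => -[At /= fk]; rewrite mem_set// !mule1 lee_fin.
      by rewrite mule0 mule_ge0// lee_fin.
  rewrite /cubeint /boxint iintZ//; last by move=> t; exact: einds_ge0.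
    by rewrite -/(boxint _ _) -/(cubeint _) A0 mule0.
  exact: measurable_einds.
apply/eqP; rewrite eq_le measure_ge0 andbT {1}AE.
apply: le_trans (generalized_Boole_inequality _ mF _) _; first by rewrite -AE.
by rewrite eseries0// => k _ _; exact: F0.
Qed.

End Absolute_continuity.

(** The lower limit of the integrands is identified only off [N], so a measurable null cover of [N]
    is removed first; density measures give it no mass. *)
Lemma density_measure_fatou (cn : nat -> T -> R) (c : T -> R)
    (mn : forall n, measurable_fun setT (cn n)) (cn0 : forall n t, (0 <= cn n t)%R)
    (mc : measurable_fun setT c) (c0 : forall t, (0 <= c t)%R) (N B : set T) :
  lebesgue_null N -> (forall t, cube t -> ~ N t -> cn n t @[n --> \oo] --> c t) ->
  measurable B ->
  density_measure mc c0 B <= limn_einf (fun n => density_measure (mn n) (cn0 n) B).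
Proof.
move=> /lebesgue_null_cover[N' [mN' NN' N'0]] cv mB.
have dropN (f : T -> R) (mf : measurable_fun setT f) (f0 : forall t, (0 <= f t)%R) :
    density_measure mf f0 B = density_measure mf f0 (B `\` N').
  rewrite [LHS](measureDI (density_measure mf f0) mB mN').
  rewrite [X in _ + X](_ : _ = 0) ?adde0//.
  apply: (subset_measure0 (B := N')) => //; first exact: measurableI.
  exact: density_measure_null.
rewrite dropN; under eq_fun do rewrite dropN.
have mD : measurable (B `\` N') by exact: measurableD.
pose g n t := (cn n t)%:E * einds (B `\` N') t.
apply: le_trans (@iint_fatou R m (enum 'I_m) (fun=> 1%R) g (fun=> 1%R) _ _); last 2 first.
- by move=> n; exact: measurable_mul_einds.
- by move=> n t; exact: mul_einds_ge0.
rewrite le_eqVlt; apply/orP; left; apply/eqP; apply: cubeint_eq => t ct.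
rewrite /g /einds indicE; case: (boolP (t \in _)) => [|_].
  rewrite inE => -[_ tN']; rewrite mule1; under eq_fun do rewrite mule1.
  apply/esym/(cvg_limn_einf_sup _).1.
  by apply: cvg_EFin; [exact: nearW|apply: cv => // /NN'].
rewrite mule0; under eq_fun do rewrite mule0.
by apply/esym/(cvg_limn_einf_sup _).1; exact: cvg_cst.
Qed.

End Scheffe.

Section Densities_to_copulas.
Variables (R : realType) (d : nat) (psi : R -> R) (psis : nat -> R -> R).
Hypothesis gen : Car_generator d psi.
Hypothesis gens : forall n, Car_generator d (psis n).
Hypothesis d3 : (3 <= d)%N.

Lemma margC1 m (f : R -> R) : Car_generator d f -> (m <= d)%N -> margC d f (fun _ : 'I_m => 1) = 1.
Proof.
move=> gf md; rewrite (margCE gf)//.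
rewrite big1; last by move=> i _; exact: (phi1 gf).
by rewrite /= ltxx (psi0 gf).
Qed.

(** All the densities have total mass 1, so a lower bound for the mass of the complement of a
    quadrant is an upper bound for that of the quadrant, and no mass can be lost in the limit. *)
Lemma densities_pt_conv :
  (forall (cn : nat -> ('I_2 -> R) -> R) (c : ('I_2 -> R) -> R),
    (forall n, is_density (margC d (psis n)) (cn n)) ->
    is_density (margC d psi) c ->
    exists N : set ('I_2 -> R), lebesgue_null N /\
      forall x, cube x -> ~ N x -> cn n x @[n --> \oo] --> c x) ->
  pt_conv psi psis.
Proof.
move=> H; have m0 : (0 < 2)%N by []; have md : (2 <= d - 1)%N by lia.
have d2 : (2 <= d)%N by lia.
have dn n := cop_density_is_density (gens n) m0 md d2.
have dc := cop_density_is_density gen m0 md d2.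
have [N [nN cv]] := H _ _ dn dc.
have mn n := measurable_cop_density (gens n) m0 md d2.
have pn n := cop_density_ge0 (gens n) m0 md d2.
have mc := measurable_cop_density gen m0 md d2.
have pc := cop_density_ge0 gen m0 md d2.
have fat B := density_measure_fatou mn pn mc pc nN cv (B := B).
have quad (f : R -> R) (gf : Car_generator d f) (x : 'I_2 -> R)
    (mf : measurable_fun setT (@cop_density R f 2 : boxT R 2 -> R))
    (pf : forall t : 'I_2 -> R, 0 <= cop_density f t) : cube x ->
    density_measure mf pf (quadrant x) = (margC d f x)%:E /\
    density_measure mf pf (~` quadrant x) = (1 - margC d f x)%:E.
  move=> x01.
  have [_ _ hF] := cop_density_is_density gf m0 md d2.
  have q y : cube y -> density_measure mf pf (quadrant y) = (margC d f y)%:E.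
    move=> y01; rewrite (density_measure_quadrant _ _ _ hF) ifF; last first.
      by apply/negbTE; rewrite negb_exists; apply/forallP => i; rewrite -leNgt; case/andP : (y01 i).
    by congr (margC _ _ _)%:E; apply/funext => i; apply: min_l; case/andP : (y01 i).
  split; first exact: q.
  have one : cube (fun _ : 'I_2 => 1 : R) by move=> i; rewrite ler01 lexx.
  have := q _ one; rewrite margC1// => q1.
  have mq := @measurable_quadrant R 2.
  have tot : density_measure mf pf setT = 1%E.
    rewrite -q1; apply: cubeint_eq => t ct; rewrite /einds !indicE in_setT mem_set//.
    by move=> i; case/andP : (ct i).
  rewrite -setTD [LHS](measureD (mu := density_measure mf pf) measurableT (mq x))//.
    by rewrite setTI [X in (X - _)%E]tot [X in (_ - X)%E](q x x01).
  by rewrite [ltLHS]tot ltry.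
have mq := @measurable_quadrant R 2.
have F (x : 'I_2 -> R) : cube x -> margC d (psis n) x @[n --> \oo] --> margC d psi x.
  move=> x01; apply/cvgrPdist_lt => e e0.
  have := fat _ (mq x); have [-> _] := quad _ gen x mc pc x01.
  under eq_fun do rewrite (quad _ (gens _) x (mn _) (pn _) x01).1.
  move=> /limn_einf_ge_near/(_ e0) h1.
  have := fat _ (measurableC (mq x)); have [_ ->] := quad _ gen x mc pc x01.
  under eq_fun do rewrite (quad _ (gens _) x (mn _) (pn _) x01).2.
  move=> /limn_einf_ge_near/(_ e0) h2.
  apply: filterS2 h1 h2 => n h1 h2; rewrite ltr_norml; apply/andP; split; lra.
apply: (cop2_pt_conv gen gens) => u v u01 v01.
pose x (i : 'I_2) := if i == ord0 then u else v.
have x01 : cube x by move=> i; rewrite /x; case: ifP.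
have E f (gf : Car_generator d f) : margC d f x = cop2 f u v.
  rewrite (margCE gf)// /cop2 big_ord_recl big_ord1/=.
  by [].
have := F x x01; rewrite (E _ gen); apply: cvg_trans; apply: near_eq_cvg.
by apply: nearW => n; rewrite (E _ (gens n)).
Qed.

End Densities_to_copulas.

(** * Weak convergence of conditional distributions *)

Section Weak_convergence.
Variable R : realType.
Implicit Types (x y z a b e : R) (g : R -> R).

Lemma uniform_continuity_itv g : continuous g -> forall e, 0 < e ->
  exists2 r, 0 < r & forall x y, 0 <= x <= 1 -> `|x - y| < r -> `|g x - g y| < e.
Proof.
move=> cg e e0.
have := @segment_compact R 0 1; rewrite compact_near_coveringP.
move=> /(_ R 0^'+ (fun r x => forall y, `|x - y| < r -> `|g x - g y| < e) _).
have H (x : R) : `[0, 1]%classic x -> \forall x' \near x & r \near 0^'+,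
    forall y, `|x' - y| < r -> `|g x' - g y| < e.
  move=> _; have e2 : 0 < e / 2 by rewrite divr_gt0.
  have /cvgrPdist_lt/(_ _ e2)/nbhs_ballP[r /= r0 hr] := cg x.
  have r2 : 0 < r / 2 by rewrite divr_gt0.
  exists (ball x (r / 2), [set s | s < r / 2]) => /=.
    split; first exact: nbhsx_ballx.
    exact: nbhs_right_lt.
  move=> [x' s] /= [xx' sr] y x'y; rewrite /ball/= in xx'.
  have h1 : `|g x - g x'| < e / 2 by apply: hr; rewrite /ball/=; lra.
  have h2 : `|g x - g y| < e / 2.
    apply: hr; rewrite /ball/=; apply: le_lt_trans (ler_distD x' _ _) _; lra.
  by apply: le_lt_trans (ler_distD (g x) _ _) _; rewrite (distrC (g x')); lra.
move=> /(_ H) nr.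
have [r [hr r0]] : exists r, [set` `[0, 1]] `<=` (fun x => forall y, `|x - y| < r -> `|g x - g y| < e) /\ 0 < r.
  near (0:R)^'+ => r; exists r; split; first by near: r.
  by near: r; exact: nbhs_right_gt.
by exists r => // x y x01; apply: hr; rewrite /= in_itv.
Unshelve. all: by end_near. Qed.

(** A step function written with indicators of half-lines, whose integrals are [1 - F (t j)];
    exactly the first [k] jumps lie below [x]. *)
Lemma telescope_step (a t : nat -> R) (N k : nat) x : (k <= N)%N ->
  (forall j, (j < k)%N -> t j < x) -> (forall j, (k <= j < N)%N -> x <= t j) ->
  \sum_(0 <= j < N) (a j.+1 - a j) * \1_(`]t j, +oo[) x = a k - a 0%N.
Proof.
move=> kN lt ge; rewrite (big_cat_nat _ (n := k))//= [X in _ + X]big_nat_cond [X in _ + X]big1.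
  rewrite addr0 -(telescope_sumr a (leq0n k)) big_nat_cond [RHS]big_nat_cond.
  apply: eq_bigr => j /andP[/andP[_ jk] _].
  by rewrite indicE mem_set ?mulr1//= in_itv/= lt.
move=> j /andP[kjN _]; rewrite indicE memNset ?mulr0//= in_itv/= andbT.
by apply/negP; rewrite -leNgt ge.
Qed.

Lemma probability_itvoy (P : probability (measurableTypeR R) R) (F : R -> R) y :
  (forall y, P `]-oo, y]%classic = (F y)%:E) -> P `]y, +oo[%classic = (1 - F y)%:E.
Proof. by move=> PF; rewrite -setCitvl probability_setC ?PF. Qed.

Lemma integral_step (P : probability (measurableTypeR R) R) (F : R -> R) (a t : nat -> R) (N : nat) :
  (forall y, P `]-oo, y]%classic = (F y)%:E) ->
  let h x := a 0%N + \sum_(0 <= j < N) (a j.+1 - a j) * \1_(`]t j, +oo[) x in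
  P.-integrable setT (EFin \o h) /\
  (\int[P]_x (h x)%:E = (a 0%N + \sum_(0 <= j < N) (a j.+1 - a j) * (1 - F (t j)))%:E)%E.
Proof.
move=> PF h.
have PI j := probability_itvoy (t j) PF.
have ii j : P.-integrable setT (fun x => (a j.+1 - a j)%:E * (\1_(`]t j, +oo[) x)%:E)%E.
  by apply: integrableZl => //; exact: integrable_indic.
have i0 : P.-integrable setT (fun _ => (a 0%N)%:E) by exact: finite_measure_integrable_cst.
have hE : (fun x => (h x)%:E) = (fun x => (a 0%N)%:E +
    \sum_(0 <= j < N) ((a j.+1 - a j)%:E * (\1_(`]t j, +oo[) x)%:E))%E.
  by apply/funext => x; rewrite /h EFinD -sumEFin; congr (_ + _)%E.
have isum : P.-integrable setT (fun x =>
    \sum_(0 <= j < N) ((a j.+1 - a j)%:E * (\1_(`]t j, +oo[) x)%:E))%E.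
  by apply: (integrable_sum measurableT) => j _; exact: ii.
split; first by rewrite /comp hE; exact: (integrableD measurableT).
have c0 : (\int[P]_x (a 0%N)%:E)%E = (a 0%N)%:E.
  by rewrite -[RHS]mule1 -(@probability_setT _ _ _ P); exact: integral_cst.
rewrite hE (integralD measurableT i0 isum) c0 EFinD; congr (_ + _)%E.
rewrite (integral_sum measurableT)// -sumEFin; apply: eq_bigr => j _.
rewrite integralZl//; last exact: integrable_indic.
rewrite integral_indic// setIT EFinM; congr (_ * _)%E; exact: PI.
Qed.

Lemma countable_avoid (Z : set R) a b : countable Z -> a < b ->
  exists2 t, a < t < b & ~ Z t.
Proof.
move=> cZ ab; apply: contrapT => H.
have sub : `]a, b[%classic `<=` Z.
  move=> t /=; rewrite in_itv/= => tab; apply: contrapT => nZ; apply: H; by exists t.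
have c : countable `]a, b[%classic by apply: sub_countable cZ; exact: subset_card_le.
have := countable_lebesgue_measure0 c; rewrite lebesgue_measure_itv/= lte_fin ab => /eqP.
by rewrite -EFinD eqe subr_eq0 gt_eqF.
Qed.

Lemma probability_outside_eq0 (P : probability (measurableTypeR R) R) (F : R -> R) :
  (forall y, P `]-oo, y]%classic = (F y)%:E) -> (forall y, y < 0 -> F y = 0) -> F 1 = 1 ->
  P (~` `[0, 1]%classic) = 0%E.
Proof.
move=> PF F0 F1.
have -> : ~` `[0, 1]%classic = `]1, +oo[%classic `|` \bigcup_n `]-oo, - n.+1%:R^-1]%classic :> set R.
  apply/seteqP; split=> x /=; rewrite in_itv/=.
    move=> /negP; rewrite negb_and -!ltNge => /orP[x0|x1]; last by left; rewrite /= in_itv/= x1.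
    right; exists (Num.truncn (- x)^-1) => //=; rewrite in_itv/= lerNr ltW//.
    by rewrite invf_plt ?posrE ?oppr_gt0// truncnS_gt.
  case=> [|[n _]] /=; rewrite in_itv/= ?andbT => h; apply/negP; rewrite negb_and -!ltNge.
    by rewrite h orbT.
  by apply/orP; left; apply: le_lt_trans h _; rewrite oppr_lt0 invr_gt0.
have n1 : P.-negligible `]1, +oo[%classic.
  apply/negligibleP => //; apply: etrans (probability_itvoy 1 PF) _.
  by rewrite F1 subrr.
have n2 : P.-negligible (\bigcup_n `]-oo, - n.+1%:R^-1]%classic).
  apply: negligible_bigcup => n; apply/negligibleP => //; apply: etrans (PF _) _.
  by rewrite F0// oppr_lt0 invr_gt0.
apply/negligibleP; last exact: negligibleU.
by apply: measurableU => //; apply: bigcupT_measurable.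
Qed.

(** The nodes [t] and the error [e] are independent of [P], so a single step function serves all the
    measures at once. Points outside the unit interval carry no mass. *)
Lemma integral_step_approx (P : probability (measurableTypeR R) R) (F : R -> R) g e
    (t : nat -> R) N :
  (forall y, P `]-oo, y]%classic = (F y)%:E) -> (forall y, y < 0 -> F y = 0) -> F 1 = 1 ->
  continuous g -> (exists M, forall t, `|g t| <= M) -> 0 <= e ->
  (forall x, 0 <= x <= 1 -> exists k, [/\ (k <= N)%N,
     (forall j, (j < k)%N -> t j < x), (forall j, (k <= j < N)%N -> x <= t j) &
     `|g x - g (t k)| <= e]) ->
  exists2 r, (\int[P]_x (g x)%:E)%E = r%:E &
    `|r - (g (t 0%N) + \sum_(0 <= j < N) (g (t j.+1) - g (t j)) * (1 - F (t j)))| <= e.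
Proof.
move=> PF F0 F1 cg [M gM] e0 part.
have [ih Ih] := @integral_step P F (fun j => g (t j)) t N PF.
set h := (fun x : R => _ + _) in ih Ih.
have mg : measurable_fun setT (g : measurableTypeR R -> R) by exact: continuous_measurable_fun.
have ig : P.-integrable setT (EFin \o g).
  apply: measurable_bounded_integrable => //; first exact: le_lt_trans (probability_le1 P measurableT) (ltry 1).
  by exists M; split; [exact: num_real|move=> M' MM' x _ /=; rewrite (le_trans (gM x))// ltW].
have fg := integrable_fin_num measurableT ig.
exists (fine (\int[P]_x (g x)%:E)%E); first by rewrite fineK.
rewrite -lee_fin -abse_EFin EFinB fineK// -Ih.
rewrite -[X in (_ <= X)%E](_ : (\int[P]_x (cst e%:E x) = _)%E); last first.
  by rewrite -[RHS]mule1 -(@probability_setT _ _ _ P); exact: integral_cst.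
have -> : (\int[P]_x (g x)%:E - \int[P]_x (h x)%:E = \int[P]_x ((EFin \o g) x - (EFin \o h) x))%E.
  by rewrite integralB.
have md : measurable_fun setT (fun x : measurableTypeR R => ((EFin \o g) x - (EFin \o h) x)%E).
  by have /integrableP[] := integrableB measurableT ig ih.
apply: le_trans (le_abse_integral _ measurableT md) _.
apply: ae_ge0_le_integral => //.
  by apply: measurableT_comp.
exists (~` `[0, 1]%classic); split.
- exact: measurableC.
- exact: probability_outside_eq0 PF F0 F1.
move=> x /= nx; apply: contra_not nx => x01 _; rewrite /= in_itv/= in x01.
have [k [kN lt ge gk]] := part x x01.
by rewrite /= lee_fin /h (telescope_step _ kN lt ge) addrCA subrr addr0.
Qed.

Lemma cdf_weak_convergence (Pn : nat -> probability (measurableTypeR R) R)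
    (P : probability (measurableTypeR R) R) (Fn : nat -> R -> R) (F : R -> R) (Z : set R) :
  (forall n y, Pn n `]-oo, y]%classic = (Fn n y)%:E) ->
  (forall y, P `]-oo, y]%classic = (F y)%:E) ->
  (forall n y, y < 0 -> Fn n y = 0) -> (forall y, y < 0 -> F y = 0) ->
  (forall n, Fn n 1 = 1) -> F 1 = 1 -> countable Z ->
  (forall y, 0 < y < 1 -> ~ Z y -> Fn n y @[n --> \oo] --> F y) ->
  forall g, continuous g -> (exists M, forall t, `|g t| <= M) ->
    (\int[Pn n]_t (g t)%:E)%E @[n --> \oo] --> (\int[P]_t (g t)%:E)%E.
Proof.
move=> PFn PF Fn0 F0 Fn1 F1 cZ cv g cg bg.
have approx e : 0 < e -> [/\ (\int[P]_t (g t)%:E)%E \is a fin_num,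
    (forall n, (\int[Pn n]_t (g t)%:E)%E \is a fin_num) &
    \forall n \near \oo, `|fine (\int[P]_t (g t)%:E)%E - fine (\int[Pn n]_t (g t)%:E)%E| < e].
  move=> e0; have e3 : 0 < e / 3 by rewrite divr_gt0.
  have [d d0 hd] := uniform_continuity_itv cg e3.
  pose N := (Num.truncn (2 / d)).+1.
  have N0 : 0 < N%:R :> R by rewrite ltr0n.
  have Nd : 2 / N%:R < d.
    by rewrite ltr_pdivrMr// -ltr_pdivrMl// [ltLHS]mulrC truncnS_gt.
  (* One node per cell of length [1 / N], off [Z] so that the distribution functions converge there.
     Consecutive nodes are within [2 / N < d], the modulus of continuity for [e / 3]; the final node
     1 closes the partition. *)
  have /choice[s hs] j : exists s, j%:R / N%:R < s < j.+1%:R / N%:R /\ ~ Z s.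
    have [|s s1 s2] := countable_avoid (a := j%:R / N%:R) (b := j.+1%:R / N%:R) cZ.
      by rewrite ltr_pM2r ?invr_gt0// ltr_nat.
    by exists s.
  pose t j := if (j < N)%N then s j else 1.
  have part x : 0 <= x <= 1 -> exists k, [/\ (k <= N)%N,
     (forall j, (j < k)%N -> t j < x), (forall j, (k <= j < N)%N -> x <= t j) &
     `|g x - g (t k)| <= e / 3].
    move=> x01; have /andP[x0 x1] := x01.
    have ex : exists k, (k == N) || (x <= t k) by exists N; rewrite eqxx.
    case: (ex_minnP ex) => k hk mink.
    have kN : (k <= N)%N by apply: mink; rewrite eqxx.
    have lt j : (j < k)%N -> t j < x.
      move=> jk; rewrite ltNge; apply/negP => xt.
      by have := mink j; rewrite xt orbT => /(_ isT); rewrite leqNgt jk.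
    exists k; split => //.
      move=> j /andP[kj jN]; have kN' : (k < N)%N := leq_ltn_trans kj jN.
      move: hk; rewrite ltn_eqF//= => /le_trans; apply.
      move: kj; rewrite leq_eqVlt => /predU1P[->//|kj].
      rewrite /t kN' jN; have [/andP[_ h1] _] := hs k; have [/andP[h2 _] _] := hs j.
      apply: ltW; apply: lt_le_trans h1 (le_trans _ (ltW h2)).
      by rewrite ler_pM2r ?invr_gt0// ler_nat.
    apply/ltW/hd => //; apply: le_lt_trans Nd.
    have below : k%:R / N%:R - 1 / N%:R <= x.
      case: k lt {hk mink kN} => [_|k lt].
        by rewrite mul0r sub0r (le_trans _ x0)// oppr_le0 divr_ge0// ltW.
      have := lt k (ltnSn _); rewrite /t; case: ifP => [kN|_ /lt_geF]; last by rewrite x1.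
      have [/andP[h1 _] _] := hs k; rewrite -mulrBl -natr1 addrK => h2.
      exact/ltW/(lt_trans h1 h2).
    have E : 2 / N%:R = 1 / N%:R + 1 / N%:R :> R by rewrite -mulrDl.
    have [kN'|Nk] := ltnP k N.
      move: hk; rewrite ltn_eqF//= => xt.
      have tk : t k < k%:R / N%:R + 1 / N%:R.
        by rewrite /t kN' -mulrDl natr1; have [/andP[_ ->]] := hs k.
      rewrite ler0_norm ?subr_le0//; lra.
    have kE : k = N by apply/eqP; rewrite eqn_leq kN.
    move: below; rewrite /t ltnNge Nk/= kE divff ?gt_eqF// => below.
    have iN : 0 < 1 / N%:R :> R by rewrite divr_gt0.
    rewrite ler0_norm ?subr_le0//; lra.
  have e30 := ltW e3.
  have [r rE hr] := integral_step_approx PF F0 F1 cg bg e30 part.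
  have /choice[rn hrn] n : exists rn, (\int[Pn n]_t (g t)%:E)%E = rn%:E /\
      `|rn - (g (t 0%N) + \sum_(0 <= j < N) (g (t j.+1) - g (t j)) * (1 - Fn n (t j)))| <= e / 3.
    have [rn rnE hrn] := integral_step_approx (PFn n) (Fn0 n) (Fn1 n) cg bg e30 part.
    by exists rn.
  split; [by rewrite rE|by move=> n; have [-> _] := hrn n|].
  pose sn n := \sum_(0 <= j < N) (g (t j.+1) - g (t j)) * (1 - Fn n (t j)).
  pose sl := \sum_(0 <= j < N) (g (t j.+1) - g (t j)) * (1 - F (t j)).
  have csn : sn n @[n --> \oo] --> sl.
    rewrite /sl big_mkord; have -> : sn = fun n => \sum_(j < N) (g (t j.+1) - g (t j)) * (1 - Fn n (t j)).
      by apply/funext => n; rewrite /sn big_mkord.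
    apply: cvg_bigsum => j; apply: cvgM; first exact: cvg_cst.
    apply: cvgB; first exact: cvg_cst.
    rewrite /t ltn_ord; have [/andP[s1 s2] nZ] := hs j; apply: cv => //.
    rewrite (le_lt_trans _ s1) ?divr_ge0//= (lt_le_trans s2)//.
    by rewrite ler_pdivrMr// mul1r ler_nat.
  have /cvgrPdist_lt/(_ _ e3) := csn; apply: filterS => n hn.
  have [-> h2] := hrn n; rewrite rE /=.
  move: hr h2 hn; rewrite -/(sn n) -/sl !ler_norml !ltr_norml.
  by move=> /andP[? ?] /andP[? ?] /andP[? ?]; apply/andP; split; lra.
have [f1 f2 _] := approx 1 ltr01.
rewrite -(fineK f1); under eq_fun do rewrite -(fineK (f2 _)).
apply: cvg_EFin; first exact: nearW.
by apply/cvgrPdist_lt => e e0; have [_ _] := approx e e0.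
Qed.

End Weak_convergence.

(** * Conditional distribution functions as quotients *)

Section Kernel.
Variables (R : realType) (psi : R -> R) (d : nat).
Hypothesis gen : Car_generator d psi.
Hypothesis d3 : (3 <= d)%N.
Implicit Types (x : 'I_d.-1 -> R) (y z : R).

Let d1 : (0 < d.-1)%N. Proof. lia. Qed.

Lemma DE_sleft z : DE psi (d - 2) z%:E = (-1) ^+ (d - 2).+1 * sleft psi (d - 2) z.
Proof. exact: leftder_sleft. Qed.

Lemma sum_phi_fin x : open_cube_pred x ->
  (\sum_(i < d.-1) phi psi (x i))%E = (\sum_(i < d.-1) phir psi (x i))%:E.
Proof.
move=> /forallP x01; rewrite -sumEFin; apply: eq_bigr => i _; apply: (phi_fin gen).
by have /andP[-> /ltW ->] := x01 i.
Qed.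

Let bigmin_neq1 x : open_cube_pred x -> \big[Order.min/1]_(i < d.-1) x i == 1 = false.
Proof.
move=> /forallP x01; apply/negbTE; rewrite lt_eqF//.
have := bigmin_le (1 : R) (Ordinal d1) x.
by move=> /le_lt_trans; apply; case/andP : (x01 (Ordinal d1)).
Qed.

Lemma kernel_cdf1 x : open_cube_pred x -> kernel_cdf psi x 1 = 1.
Proof.
move=> x01; have S0 := sum_phir_gt0 gen d1 x01.
rewrite /kernel_cdf bigmin_neq1//= sum_phi_fin// (phi0_le gen) ?ltW//.
case: ifPn => // pS; rewrite ifF.
  rewrite (phi1 gen) adde0 DE_sleft divff// mulf_neq0 ?signr_eq0//.
  rewrite gt_eqF// (sleft_gt0 gen)// lt_neqAle eq_sym pS (psi_ge0 gen)//.
  exact: ltW.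
apply/negbTE; rewrite -leNgt /psiE; case: (_ - _)%E => [r| |] //.
by case: ltP => // r0; exact: (psi_le1 gen).
Qed.

(** The case distinction on [y] disappears: for [y] below the threshold the numerator is evaluated
    beyond a zero of [psi], where it vanishes. The signs of the two derivatives cancel. *)
Lemma kernel_cdfE x y : open_cube_pred x -> 0 < psi (\sum_(i < d.-1) phir psi (x i)) ->
  0 < y < 1 ->
  kernel_cdf psi x y = sleft psi (d - 2) (\sum_(i < d.-1) phir psi (x i) + phir psi y) /
    sleft psi (d - 2) (\sum_(i < d.-1) phir psi (x i)).
Proof.
move=> x01 pS y01; have S0 := sum_phir_gt0 gen d1 x01.
have yI : 0 < y <= 1 by have /andP[-> /ltW ->] := y01.
rewrite /kernel_cdf bigmin_neq1//= sum_phi_fin// (phi0_le gen) ?(ltW S0)//.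
rewrite gt_eqF//; set S := \sum_(i < d.-1) _ in S0 pS *.
rewrite (phi_fin gen yI) -EFinD !DE_sleft invfM mulrACA divff ?signr_eq0// mul1r.
case: ifPn => // ylt; symmetry.
suff -> : sleft psi (d - 2) (S + phir psi y) = 0 by rewrite mul0r.
(* If [phi psi 0] is infinite, the threshold is [psiE] at infinity, that is 0, which contradicts
   [0 < y]. If it is finite, it is itself a zero of [psi]. *)
move: ylt; have := phi_ge0 psi 0; have := phi0_le gen (z := fine (phi psi 0)).
case: (phi psi 0) => [z| |] //=; last by move=> _ _; have /andP[/ltW /le_gtF ->] := y01.
rewrite lexx => hz; rewrite lee_fin => z0; have {hz} pz : psi z = 0 by apply/eqP; rewrite -hz.
case: (ltP (z - S) 0) => [zS _|zS ylt].
  apply: (sleft_eq0 gen _ z0 pz) => //; rewrite subr_lt0 in zS.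
  by rewrite (lt_le_trans zS)// lerDl (phir_ge0 gen).
apply: (sleft_eq0 gen _ z0 pz) => //.
rewrite -ltrBlDl; apply: (psi_ltW gen); first exact: (phir_ge0 gen).
by rewrite (psi_phir gen).
Qed.

End Kernel.

Section Weak_conditional_convergence.
Variables (R : realType) (d : nat) (psi : R -> R) (psis : nat -> R -> R).
Hypothesis gen : Car_generator d psi.
Hypothesis gens : forall n, Car_generator d (psis n).
Hypothesis d3 : (3 <= d)%N.

Let d1 : (0 < d.-1)%N. Proof. lia. Qed.
Let dd : (d - 2 <= d - 2)%N. Proof. by []. Qed.

Lemma kernel_cvg (x : 'I_d.-1 -> R) (y : R) : pt_conv psi psis -> open_cube_pred x ->
  ~ discontinuities psi (d - 2) (\sum_i phir psi (x i)) ->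
  0 < psi (\sum_i phir psi (x i)) -> 0 < y < 1 ->
  ~ discontinuities psi (d - 2) (\sum_i phir psi (x i) + phir psi y) ->
  kernel_cdf (psis n) x y @[n --> \oo] --> kernel_cdf psi x y.
Proof.
move=> cv x01 nS pS y01 nSy; have S0 := sum_phir_gt0 gen d1 x01.
have cS := sum_phir_cvg gen gens cv x01.
have p0 := phir_gt0 gen y01.
have cy : phir (psis n) y @[n --> \oo] --> phir psi y.
  by apply: (pt_conv_phir gen gens) => //; have /andP[-> /ltW ->] := y01.
rewrite (kernel_cdfE gen d3)//.
have : \forall n \near \oo, 0 < psis n (\sum_i phir (psis n) (x i)).
  have /(cvgr_gt _)/(_ 0 pS) := psi_continuous_gt0 gen S0.
  move=> /nbhs_ballP[r /= r0 hr].
  (* A point beyond the limiting sum where [psi] is still positive; eventually it exceeds the [n]-th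
     sum, so the quotient formula is valid for [psis n] too. *)
  pose S' := \sum_i phir psi (x i) + r / 2.
  have pS' : 0 < psi S'.
    apply: hr; rewrite /ball/= /S' opprD addrA subrr add0r normrN gtr0_norm ?divr_gt0//.
    by rewrite ltr_pdivrMr// ltr_pMr// ltr1n.
  have SS' : \sum_i phir psi (x i) < S' by rewrite ltrDl divr_gt0.
  have S'0 : 0 <= S' by rewrite ltW// (lt_trans S0).
  apply: filterS2 (cvgr_lt _ cS _ SS') (cvgr_gt _ (cv _ S'0) _ pS') => n h1 h2.
  apply: lt_le_trans h2 _; apply: (psi_noninc (gens n)); last exact: ltW.
  exact/ltW/(sum_phir_gt0 (gens n)).
move=> pSn.
apply: cvg_trans (_ : (fun n => sleft (psis n) (d - 2) (\sum_i phir (psis n) (x i) + phir (psis n) y) /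
    sleft (psis n) (d - 2) (\sum_i phir (psis n) (x i))) @ \oo --> _); last first.
  apply: cvgM.
    apply: (sleft_cvg gen gens) => //.
    - by rewrite addr_gt0.
    - exact: cvgD.
    - by apply: contrapT => nc; apply: nSy; split => //; rewrite addr_gt0.
  apply: cvgV; first by rewrite gt_eqF// (sleft_gt0 gen).
  apply: (sleft_cvg gen gens) => //.
  by apply: contrapT => nc; apply: nS.
apply: near_eq_cvg; apply: filterS pSn => n pn.
by rewrite (kernel_cdfE (gens n) d3).
Qed.

Definition kernel_good : set ('I_d.-1 -> R) := [set x | [/\ open_cube_pred x,
  ~ discontinuities psi (d - 2) (\sum_i phir psi (x i)) &
  0 < psi (\sum_i phir psi (x i))]].

Lemma kernel_good_weak_conv x : pt_conv psi psis -> kernel_good x ->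
  kernel_weak_conv psis psi x.
Proof.
move=> cv [x01 nS pS] Pn P PFn PF.
have cZ := countable_discontinuities gen dd.
(* For fixed [x] the map from [y] to the argument of the numerator is injective on the open unit
   interval, so only countably many [y] hit a discontinuity. *)
pose Z := [set y | 0 < y < 1 /\ discontinuities psi (d - 2) (\sum_i phir psi (x i) + phir psi y)].
have cZ' : countable Z.
  have [f injf] := elimT (countable_injP _) cZ.
  apply/countable_injP; exists (fun y => f (\sum_i phir psi (x i) + phir psi y)).
  move=> u v; rewrite !inE => -[u01 uZ] [v01 vZ] /injf.
  rewrite !inE => /(_ uZ vZ)/addrI e.
  by rewrite -(psi_phir_oo gen u01) e (psi_phir_oo gen v01).
apply: (cdf_weak_convergence PFn PF _ _ _ _ cZ').
- by move=> n y y0; rewrite /kernel_cdfR y0.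
- by move=> y y0; rewrite /kernel_cdfR y0.
- by move=> n; rewrite /kernel_cdfR ltxx ltNge ler01/= (kernel_cdf1 (gens n)).
- by rewrite /kernel_cdfR ltxx ltNge ler01/= (kernel_cdf1 gen).
- move=> y y01 nZ; have /andP[y0 y1] := y01.
  rewrite /kernel_cdfR (le_gtF (ltW y0)) (le_gtF (ltW y1)).
  by apply: kernel_cvg => // h; apply: nZ.
Qed.

Lemma borel_kernel_good : borel kernel_good.
Proof.
have cZ := countable_discontinuities gen dd.
(* The values of [psi] at negative reals are arbitrary; together with [0 <= z] the condition
   describes an interval, by monotonicity. *)
have mpos : measurable ([set z : R | 0 <= z /\ 0 < psi z] : set (measurableTypeR R)).
  apply: is_interval_measurable => u v /= [u0 pu] [v0 pv] z /andP[uz zv].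
  have z0 : 0 <= z by apply: le_trans uz.
  by split => //; apply: lt_le_trans pv _; exact: (psi_noninc gen).
have mW := measurableD mpos (countable_measurableR cZ).
have := measurable_sum_level (m := d.-1) gen mW.
suff -> : kernel_good = sum_level psi ([set z : R | 0 <= z /\ 0 < psi z] `\` discontinuities psi (d - 2)) by [].
apply/seteqP; split=> t; first move=> [t01 nt pt].
  by split => //; split => //; split => //; exact/ltW/(sum_phir_gt0 gen).
by move=> [t01 [[_ pt] nt]].
Qed.

Lemma pt_conv_weak_cond_conv : pt_conv psi psis -> weak_cond_conv d psis psi.
Proof.
move=> cv; exists kernel_good; split.
- exact: borel_kernel_good.
- by move=> x [/forallP x01 _ _] i; have /andP[/ltW -> /ltW ->] := x01 i.
- have md : (d.-1 <= d - 1)%N by lia.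
  have d2 : (2 <= d)%N by lia.
  exists (@cop_density R psi d.-1); split; first exact: cop_density_is_density.
  have mc := measurable_cop_density gen d1 md d2.
  have c0 := cop_density_ge0 gen d1 md d2.
  have mL : measurable (kernel_good : set (boxT R d.-1)) := borel_kernel_good.
  have tot : density_measure mc c0 setT = 1%E.
    rewrite -[RHS](_ : (margC d psi (fun _ : 'I_d.-1 => 1))%:E = _); last first.
      by rewrite margC1//; lia.
    rewrite (margC_density gen d1 md d2); last by move=> i; rewrite ler01 lexx.
    by apply: cubeint_eq => t _; rewrite /einds indicT mule1.
  have cZ := countable_discontinuities gen dd.
  have mA := measurable_sum_level (m := d.-1) gen (countable_measurableR cZ).
  have A0 := cubeint_sum_level gen d1 cZ.
  have dm : d.-1.-1 = (d - 2)%N by lia.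
  (* Off the level set of discontinuities, a point of the open cube outside [kernel_good] has
     [psi s = 0] at its sum [s]. Then [sleft] vanishes to the right of [s] and is continuous at [s],
     so the density is 0 there; off the open cube it is 0 by definition. *)
  have nul : density_measure mc c0 (~` kernel_good) = 0%E.
    apply/eqP; rewrite eq_le measure_ge0 andbT.
    rewrite -[X in (_ <= X)%E](density_measure_null mc c0 mA A0).
    apply: le_cubeint.
    + by apply: measurable_mul_einds => //; exact: measurableC.
    + exact: measurable_mul_einds.
    + by move=> t; exact: mul_einds_ge0.
    move=> t; rewrite /einds !indicE.
    have [tA|tA] := boolP (t \in sum_level psi (discontinuities psi (d - 2))).
      by rewrite mule1; case: (_ \in _); rewrite ?mule1// mule0 lee_fin.
    rewrite mule0; have [tg|_] := boolP (t \in ~` kernel_good); last by rewrite mule0.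
    rewrite mule1 lee_fin /cop_density; case: ifPn => // t01.
    rewrite dm (_ : sleft _ _ _ = 0) ?mul0r//.
    move: tA; rewrite notin_setE => tA; move: tg; rewrite inE => tg.
    have s0 := sum_phir_gt0 gen d1 t01; set s := \sum_i _ in s0 *.
    have cs : {for s, continuous (sleft psi (d - 2))}.
      by apply: contrapT => nc; apply: tA; split.
    have ps : psi s = 0.
      apply/eqP/negP => /negP ps; apply: tg; split => //.
        by move=> h; apply: tA; split.
      by rewrite lt_neqAle eq_sym ps (psi_ge0 gen)// ltW.
    apply/eqP; rewrite eq_le (sleft_ge0 gen)// andbT leNgt; apply/negP => spos.
    have /(cvgr_gt _)/(_ 0 spos) : sleft psi (d - 2) z @[z --> s] --> sleft psi (d - 2) s := cs.
    move=> /nbhs_ballP[r /= r0 hr].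
    have := hr (s + r / 2); rewrite (sleft_eq0 gen _ (ltW s0) ps)// ?ltrDl ?divr_gt0// ltxx.
    suff b : ball s r (s + r / 2) by move=> /(_ b).
    rewrite /ball/= opprD addrA subrr add0r normrN gtr0_norm ?divr_gt0//.
    by rewrite ltr_pdivrMr// ltr_pMr// ltr1n.
  transitivity (density_measure mc c0 kernel_good).
    by apply: cubeint_eq => t _; rewrite /einds EFinM muleC.
  rewrite -tot -(setUv kernel_good).
  rewrite [RHS](measureU (density_measure mc c0) mL (measurableC mL)) ?setICr//.
  by rewrite [X in (_ + X)%E]nul adde0.
- by move=> x; exact: kernel_good_weak_conv.
Qed.

End Weak_conditional_convergence.

Theorem theorem4p1 (R : realType) (d : nat) (psi : R -> R) (psis : nat -> R -> R) :
  (3 <= d)%N ->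
  Car_generator d psi ->
  (forall n, Car_generator d (psis n)) ->
  let P1 := unif_conv_on (@cube R d) (fun n => archC (psis n)) (archC psi) in
  let P2 := forall i j : 'I_d, i != j ->
      unif_conv_on [set p : R * R | (0 <= p.1 <= 1) /\ (0 <= p.2 <= 1)]
        (fun n => bivC (psis n) i j) (bivC psi i j) in
  let P3 := forall y : R, 0 < y <= 1 ->
      phi (psis n) y @[n --> \oo] --> phi psi y in
  let P4 := unif_conv_on `[0, +oo[%classic psis psi in
  let P5 :=
      (forall m : nat, (1 <= m <= d - 2)%N -> forall x : R, 0 < x ->
         derive1n m (psis n) x @[n --> \oo] --> derive1n m psi x) /\
      (forall x : R, 0 < x ->
         {for x, continuous (leftder (derive1n (d - 2) psi))} ->
         leftder (derive1n (d - 2) (psis n)) x @[n --> \oo]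
           --> leftder (derive1n (d - 2) psi) x) in
  let P6 := forall m : nat, (2 <= m <= d - 1)%N ->
      forall (cn : nat -> ('I_m -> R) -> R) (c : ('I_m -> R) -> R),
        (forall n, is_density (margC d (psis n)) (cn n)) ->
        is_density (margC d psi) c ->
        exists N : set ('I_m -> R), lebesgue_null N /\
          forall x, cube x -> ~ N x -> cn n x @[n --> \oo] --> c x in
  [/\ P1 <-> P2, P1 <-> P3, P1 <-> P4, P1 <-> P5 & P1 <-> P6] /\
  (P1 -> weak_cond_conv d psis psi).
Proof.
move=> d3 gen gens P1 P2 P3 P4 P5 P6.
have d2 : (0 < d - 2)%N by lia.
have pt_P1 : pt_conv psi psis -> P1 := pt_conv_archC gen gens.
have P1_P2 : P1 -> P2.
  move=> p1 i j ij e e0; have [N hN] := p1 e e0; exists N => n Nn p [p1' p2'].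
  by apply: hN => // k; case: ifP => // _; case: ifP => // _; rewrite ler01 lexx.
have P2_pt : P2 -> pt_conv psi psis.
  move=> p2; apply: (cop2_pt_conv gen gens) => u v u01 v01.
  have [i [j ij]] : exists i j : 'I_d, i != j.
    by exists (Ordinal (ltn_trans (ltn0Sn 1) d3)), (Ordinal (ltn_trans (ltnSn 1) d3)).
  apply/cvgrPdist_lt => e e0; have [N hN] := p2 i j ij e e0; exists N => // n /= Nn.
  have := hN n Nn (u, v) (conj u01 v01).
  by rewrite (bivCE (gens n) _ ij) (bivCE gen _ ij) distrC.
have P1_pt : P1 -> pt_conv psi psis by move=> /P1_P2/P2_pt.
have P5_pt : P5 -> pt_conv psi psis.
  move=> [p5 _]; apply: (sder1_pt_conv gen gens d2) => x x0.
  by rewrite /sder; apply: cvgMr; apply: p5.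
have pt_P5 : pt_conv psi psis -> P5.
  move=> cv; split=> [m /andP[_ md] x x0|x x0 cx].
    rewrite derive1n_sder; under eq_fun do rewrite derive1n_sder.
    by apply: cvgMr; exact: (sder_cvg gen gens).
  rewrite leftder_sleft; under eq_fun do rewrite leftder_sleft.
  apply: cvgMr; apply: (sleft_cvg gen gens) => //; first exact: cvg_cst.
  rewrite /sleft /prop_for/continuous_at; apply: cvgMr; exact: cx.
split; first split.
- by split=> // /P2_pt/pt_P1.
- split=> [/P1_pt|]; first exact: (pt_conv_phi gen gens).
  by move=> /(phi_pt_conv gen gens)/pt_P1.
- split=> [/P1_pt|]; first exact: (pt_conv_unif gen gens).
  by move=> /unif_pt_conv/pt_P1.
- by split=> [/P1_pt/pt_P5|/P5_pt/pt_P1].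
- split=> [/P1_pt cv|p6]; first exact: (pt_conv_densities gen gens d3 cv).
  by apply/pt_P1/(densities_pt_conv gen gens d3)/p6; lia.
- by move=> /P1_pt; exact: (pt_conv_weak_cond_conv gen gens d3).
Qed.
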